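(* Let $\varphi=\varphi(y)$ be a Minkowski norm on $\mathbb{R}^n$ and $\Omega=\{y\in\mathbb{R}^n\mid\varphi(y)<1\}$. Let $\tilde{\mathbf G}$ denote the R-flat spray on $\Omega$ defined by $\tilde{\mathbf G}=y^i\frac{\partial}{\partial x^i}-2F\,y^i\frac{\partial}{\partial y^i}$, where $F=F(x,y)$ is the Funk metric on $\Omega$. If $\tilde F=\tilde F(x,y)$ is a Finsler metric on a neighborhood of the origin $0\in\Omega$ that induces $\tilde{\mathbf G}$, then $\tilde F$ is given by $$\tilde F=\sum_{m=0}^{\infty}\frac1{m!}\,\frac{d^m}{dt^m}\Big[\varphi^m(y+tx)\,\psi(y+tx)\Big]\Big|_{t=0},\qquad( * )$$ where $\psi(y):=\tilde F(0,y)$. Conversely, for any Minkowski norm $\psi=\psi(y)$ on $\mathbb{R}^n$, the function $\tilde F$ defined by $( * )$ induces $\tilde{\mathbf G}$; hence it is a pointwise projectively flat Finsler metric with flag curvature $\mathbf K=0$.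
   Context: Summation over repeated indices is understood; $(x,y)=(x^i,y^i)$ are the standard coordinates on $T\mathbb{R}^n=\mathbb{R}^n\times\mathbb{R}^n$. A Minkowski norm on a vector space $V$ is a nonnegative function $\varphi$ on $V$ such that (a) $\varphi(\lambda y)=\lambda\varphi(y)$ for all $\lambda>0$, $y\in V$; (b) $\varphi$ is $C^\infty$ on $V\setminus\{0\}$ and for every $y\in V\setminus\{0\}$ the symmetric bilinear form $g_y(u,v)=\frac12\frac{\partial^2}{\partial s\,\partial t}[\varphi^2(y+su+tv)]|_{s=t=0}$ is positive definite. A Finsler metric on a manifold $M$ is a family of Minkowski norms on the tangent spaces $T_pM$, $p\in M$, which is $C^\infty$ on $TM\setminus\{0\}$ (Finsler metrics are always positive definite). The Funk metric $F=F(x,y)$ on $\Omega$ is defined, for $x\in\Omega$ and $0\neq y\in T_x\Omega=\mathbb{R}^n$, as the positive number $F$ with $x+\frac{y}{F}\in\partial\Omega$ (equivalently $\varphi(x+y/F)=1$), and $F(x,0)=0$. A Finsler metric $L$ induces the spray $y^i\frac{\partial}{\partial x^i}-2G^i\frac{\partial}{\partial y^i}$ with $$G^i(x,y)=\tfrac14 g^{il}\Big\{2\frac{\partial g_{jl}}{\partial x^k}-\frac{\partial g_{jk}}{\partial x^l}\Big\}y^jy^k,\qquad g_{ij}=\tfrac12[L^2]_{y^iy^j},\quad (g^{ij})=(g_{ij})^{-1}.$$ Thus $L$ induces $\tilde{\mathbf G}$ if and only if its spray coefficients are $G^i=F\,y^i$. A Finsler metric on an open subset of $\mathbb{R}^n$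 is pointwise projectively flat if its geodesics are straight lines. The Riemann curvature of a spray is $\mathbf R_y(u)=R^i_{\ k}u^k\frac{\partial}{\partial x^i}$ with $$R^i_{\ k}=2\frac{\partial G^i}{\partial x^k}-y^j\frac{\partial^2G^i}{\partial x^j\partial y^k}+2G^j\frac{\partial^2G^i}{\partial y^j\partial y^k}-\frac{\partial G^i}{\partial y^j}\frac{\partial G^j}{\partial y^k},$$ and a spray is R-flat if its Riemann curvature vanishes. For a Finsler metric and a plane $P=\mathrm{span}\{y,u\}\subset T_pM$, the flag curvature is $\mathbf K(P,y)=\dfrac{g_y(\mathbf R_y(u),u)}{g_y(y,y)g_y(u,u)-g_y(y,u)^2}$, where $g_y(u,v)=g_{ij}(x,y)u^iv^j$; $\mathbf K=0$ if and only if the induced spray is R-flat.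
   Formalization: For smooth norms ( * ) can diverge, so it is proved as the Taylor expansion of F̃ in x at 0 (converse: existence and uniqueness near 0 of such an F̃ inducing the spray); convergence of ( * ) to F̃ is proved for φ, ψ real-analytic off 0 and x near 0, not on the whole given neighborhood. *)

(* Defs.v *)
From HB Require Import structures.
From mathcomp Require Import all_boot all_order all_algebra.
From mathcomp Require Import all_classical all_reals all_analysis.
Set Implicit Arguments.
Unset Strict Implicit.
Unset Printing Implicit Defensive.
Import Order.TTheory GRing.Theory Num.Theory.
Import numFieldNormedType.Exports.
Local Open Scope classical_set_scope.
Local Open Scope ring_scope.

Section Smoothness.
Variables (R : realType) (V : normedModType R).

Fixpoint iter_derive (vs : seq V) (f : V -> R) : V -> R :=
  if vs is v :: vs' then 'D_v (iter_derive vs' f) else f.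

(* C^oo on the open set A: every iterated directional derivative exists and is
   continuous at every point of A (values outside A are irrelevant). *)
Definition smooth_on (A : set V) (f : V -> R) : Prop :=
  forall (vs : seq V) (p : V), A p ->
    {for p, continuous (iter_derive vs f)} /\
    forall v : V, derivable (iter_derive vs f) p v.

End Smoothness.

Section Finsler.
Variables (R : realType) (n : nat).
Local Notation V := 'rV[R]_n.
Implicit Types (phi psi f : V -> R) (L : V -> V -> R) (G : V -> V -> V).
Implicit Types (U : set V) (x y u v : V) (i j k l : 'I_n).

(* Degree-m part of the power series with coefficients c (indexed by
   multi-indices) at h; multi-indices of degree m have all entries <= m. *)
Definition power_term (c : ('I_n -> nat) -> R) (h : V) (m : nat) : R :=
  \sum_(al : {ffun 'I_n -> 'I_m.+1} | (\sum_i al i)%N == m)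
     c (fun i => al i : nat) * \prod_i h 0 i ^+ al i.

Definition abs_power_term (c : ('I_n -> nat) -> R) (h : V) (m : nat) : R :=
  \sum_(al : {ffun 'I_n -> 'I_m.+1} | (\sum_i al i)%N == m)
     `|c (fun i => al i : nat) * \prod_i h 0 i ^+ al i|.

(* Real-analytic: near each point of A, f is the sum of an absolutely
   convergent power series in n variables. *)
Definition analytic_on (A : set V) f : Prop :=
  forall a : V, A a ->
    exists (c : ('I_n -> nat) -> R) (r : R), 0 < r /\
      forall h : V, `|h| < r ->
        cvgn (series (abs_power_term c h)) /\
        series (power_term c h) @ \oo --> f (a + h).

(* g_y(u, v) = 1/2 d^2/dsdt [phi^2 (y + s u + t v)] at s = t = 0 *)
Definition fund_form phi y u v : R :=
  2^-1 * derive1 (fun s : R =>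
    derive1 (fun t : R => phi (y + s *: u + t *: v) ^+ 2) 0) 0.

Definition minkowski_norm phi : Prop :=
  [/\ forall y, 0 <= phi y,
      forall (a : R) y, 0 < a -> phi (a *: y) = a * phi y,
      smooth_on [set y | y != 0] phi
    & forall y u, y != 0 -> u != 0 -> 0 < fund_form phi y u u].

Definition finsler_metric U L : Prop :=
  (forall x, U x -> minkowski_norm (L x)) /\
  smooth_on [set p : V * V | U p.1 /\ p.2 != 0] (fun p => L p.1 p.2).

Definition Omega phi : set V := [set y | phi y < 1].

(* Funk metric of the domain Omega phi; the default value 0 of xget is never
   used when phi is a Minkowski norm and x is in the domain. *)
Definition funk phi x y : R :=
  if y == 0 then 0
  else xget 0 [set a : R | 0 < a /\
         (closure (Omega phi) `\` interior (Omega phi)) (x + a^-1 *: y)].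

Definition e_ i : V := delta_mx 0 i.

(* partial derivatives with respect to x^k and to y^k *)
Definition dx k (f : V -> V -> R) x y : R := 'D_(e_ k) (fun z => f z y) x.
Definition dy k (f : V -> V -> R) x y : R := 'D_(e_ k) (f x) y.

Definition gmat L x y : 'M[R]_n :=
  \matrix_(i, j) (2^-1 * dy i (dy j (fun x' y' => L x' y' ^+ 2)) x y).

Definition gform L x y u v : R := \sum_i \sum_j gmat L x y i j * u 0 i * v 0 j.

(* The spray y^i d/dx^i - 2 G^i d/dy^i is represented by G = (G^i)_i. *)
Definition spray_coef L x y : V :=
  \row_i (4^-1 * \sum_l invmx (gmat L x y) i l *
    \sum_j \sum_k
      (2 * dx k (fun x' y' => gmat L x' y' j l) x y
         - dx l (fun x' y' => gmat L x' y' j k) x y) * y 0 j * y 0 k).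

Definition induces U L G : Prop :=
  forall x y, U x -> y != 0 -> spray_coef L x y = G x y.

Definition riemann G i k x y : R :=
  let Gc j := fun x' y' => G x' y' 0 j in
  2 * dx k (Gc i) x y
  - \sum_j y 0 j * dx j (dy k (Gc i)) x y
  + 2 * \sum_j G x y 0 j * dy j (dy k (Gc i)) x y
  - \sum_j dy j (Gc i) x y * dy k (Gc j) x y.

Definition R_flat U G : Prop :=
  forall x y i k, U x -> y != 0 -> riemann G i k x y = 0.

Definition riemann_op G x y u : V := \row_i \sum_k riemann G i k x y * u 0 k.

Definition flag_curvature L x y u : R :=
  gform L x y (riemann_op (spray_coef L) x y u) u /
  (gform L x y y y * gform L x y u u - gform L x y y u ^+ 2).

Definition zero_flag_curvature U L : Prop :=
  forall x y u, U x -> free [:: y; u] -> flag_curvature L x y u = 0.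

Definition geodesic U L (a b : R) (c : R -> V) : Prop :=
  forall t : R, a < t < b ->
    [/\ U (c t), derivable c t 1, derivable (derive1 c) t 1,
        derive1 c t != 0
      & derive1 (derive1 c) t = - (2 *: spray_coef L (c t) (derive1 c t))].

Definition projectively_flat U L : Prop :=
  forall (a b : R) (c : R -> V), a < b -> geodesic U L a b c ->
    exists p v, v != 0 /\
      forall t : R, a < t < b -> exists s : R, c t = p + s *: v.

(* The m-th term of the series (1/m!) d^m/dt^m [phi^m psi (y + t x)] at t = 0;
   it is homogeneous of degree m in x. *)
Definition series_term phi psi x y (m : nat) : R :=
  (m`!%:R)^-1 *
  derive1n m (fun t : R => phi (y + t *: x) ^+ m * psi (y + t *: x)) 0.

Definition series_sum phi psi x y : R := limn (series (series_term phi psi x y)).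

(* L has the series with terms series_term as its Taylor expansion in x at
   x = 0, degree by degree.  For C^oo data the series may diverge, and this is
   then the only meaning of an equality between L and the series. *)
Definition taylor_expansion phi psi L : Prop :=
  forall x y (m : nat),
    (m`!%:R)^-1 * derive1n m (fun t : R => L (t *: x) y) 0 =
    series_term phi psi x y m.

End Finsler.

(* Main.v *)
Require Import Defs.
From HB Require Import structures.
From mathcomp Require Import all_boot all_order all_algebra.
From mathcomp Require Import all_classical all_reals all_analysis.
From mathcomp Require Import ring lra.
Set Implicit Arguments.
Unset Strict Implicit.
Unset Printing Implicit Defensive.
Import Order.TTheory GRing.Theory Num.Theory.
Import numFieldNormedType.Exports.
Local Open Scope classical_set_scope.
Local Open Scope ring_scope.

(** The Funk metric is characterised by the equation F(x, y) = phi(z) with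
z = y + F(x, y) x: the ray from x in the direction y leaves the domain at
z / F(x, y).  Differentiating this equation shows that F, and more generally
every function f(z) of z alone, satisfies

   d/dx^k f(z) = F d/dy^k f(z)                                       (1)

([funk_transport], [exit_transport]).  On the other hand, Euler's identity and
the symmetry of second derivatives turn the condition that the spray
coefficients of a Finsler metric L are F y^i into the linear equation

   d/dx^k L = d/dy^k (F L)                                           (2)

([induces_transports], where a solution of (2) is said to be transported).  The
whole theorem is about (2).

 - Existence.  By (1), the function J = 1 + x^k dF/dy^k is transported, and so
   is f(z) J for every f.  Implicit differentiation gives
   J = 1 / (1 - D_x phi(z)), hence [sol], psi(z) / (1 - D_x phi(z)), is a
   solution whose restriction to x = 0 is psi.  The fundamental inequality
   D_x phi(z) <= phi(x) < 1 keeps the denominator positive.  Since the unit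
   sphere is compact, the solution is a positive definite Finsler metric for x
   near 0 ([sol_finsler_near]).

 - Uniqueness.  Along t |-> (t x, z - t phi(z) x) the Funk metric is constant
   and (2) prescribes the logarithmic derivative of L, so the quotient of two
   solutions is constant on a characteristic joining (0, z) to (x, y)
   ([char_unique]).

 - Taylor coefficients.  By (1) and (2), F^m L is transported along with L,
   so m-fold differentiation in x along x gives
   d^m/dt^m L(t x, y) = D_(0,x)^m (F^m L)(t x, y); at t = 0 the right-hand side
   is the derivative of phi^m psi, since F(0, .) = phi ([taylor_transport]).

 - Curvature.  R-flatness follows from (1) and Euler's identity
   ([riemann_flat]); a geodesic has acceleration -2 F c', a nonpositive multiple
   of its velocity, hence is straight ([straight_line]).

 - Convergence for analytic data.  Put f(t) = phi(y + t x), g(t) = psi(y + t x).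
   The root of tau = eps f(tau) is eps F(eps x, y), and the solution at eps x
   is g(tau) / (1 - eps f'(tau)): this is Lagrange's generating function, whose
   m-th coefficient in eps is the t^m-coefficient of f^m g.  The inversion
   formula is proved for polynomials in a weighted l^1 norm, with an error term
   uniform enough to pass to the limit along the partial sums of the power
   series of phi and psi ([lagrange_inversion], [lagr_series]).  The bounds give
   a radius of convergence at least 4 in eps when x is small, so that eps = 1 is
   reached ([series_near]); compactness of the sphere and homogeneity make the
   neighbourhood of x independent of y ([series_cvg_near]).

Smoothness is expressed by directional derivatives only.  The substitute for
Frechet differentiability is the convergence of the difference quotients
(f(p + a w) - f(p)) / a as p and a vary simultaneously ([slope_cvg]); linearity
in the direction, the chain rule and the symmetry of second derivatives all come
from it. *)

(** * Directional derivatives and smooth functions *)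

Section Lines.
Variables (R : realType) (V : normedModType R).
Implicit Types (f g : V -> R) (p q u v w : V) (s t a : R).

Lemma line_quotient f p w t h :
  h^-1 *: (f (p + (h + t) *: w) - f (p + t *: w)) =
  h^-1 *: ((f \o shift (p + t *: w)) (h *: w) - f (p + t *: w)).
Proof. by rewrite /shift /= scalerDl addrCA. Qed.

Lemma derive1_line f p w t :
  derive1 (fun s : R => f (p + s *: w)) t = 'D_w f (p + t *: w).
Proof.
rewrite /derive1 /derive.
under eq_fun do rewrite line_quotient.
by [].
Qed.

Lemma derive1_line0 f p w :
  derive1 (fun s : R => f (p + s *: w)) 0 = 'D_w f p.
Proof. by rewrite derive1_line scale0r addr0. Qed.

Lemma derivable_line f p w t :
  derivable f (p + t *: w) w -> derivable (fun s : R => f (p + s *: w)) t 1.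
Proof.
rewrite /derivable; set q1 := (X in cvg (X @ _) -> _).
set q2 := (X in _ -> cvg (X @ _)).
suff E : q2 = q1 by rewrite E.
apply/funext => h; rewrite /q1 /q2 /= /shift -line_quotient.
by rewrite [(h *: 1 : R)]mulr1.
Qed.

Lemma is_derive_line f p w t :
  derivable f (p + t *: w) w ->
  is_derive t 1 (fun s : R => f (p + s *: w)) ('D_w f (p + t *: w)).
Proof.
move=> df; apply: DeriveDef; first exact: derivable_line.
by rewrite -derive1E derive1_line.
Qed.

Lemma derive1n_line f p w m t :
  derive1n m (fun s : R => f (p + s *: w)) t =
  iter_derive (nseq m w) f (p + t *: w).
Proof.
elim: m t => [|m IH] t //=; rewrite -derive1_line.
by congr (derive1 _ t); apply/funext => s; rewrite -IH.
Qed.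

Lemma MVT_symmetric (g dg : R -> R) a :
  (forall s, `|s| <= `|a| -> is_derive s (1 : R) g (dg s)) ->
  exists2 s, `|s| <= `|a| & g a - g 0 = dg s * a.
Proof.
move=> dgP; case: (leP 0 a) => a0.
- have [||c] := @MVT_segment R g dg 0 a a0.
  + move=> x; rewrite in_itv /= => /andP[x0 xa]; apply: dgP.
    by rewrite !ger0_norm// ltW.
  + apply: derivable_within_continuous => x; rewrite in_itv /= => /andP[x0 xa].
    by have [] := dgP x; rewrite ?ger0_norm.
  + rewrite in_itv /= => /andP[c0 ca] ->; exists c; rewrite ?subr0//.
    by rewrite !ger0_norm.
- have [||c] := @MVT_segment R g dg a 0 (ltW a0).
  + move=> x; rewrite in_itv /= => /andP[x0 xa]; apply: dgP.
    by rewrite !ltr0_norm// lerN2 ltW.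
  + apply: derivable_within_continuous => x; rewrite in_itv /= => /andP[x0 xa].
    by have [] := dgP x; rewrite ?ler0_norm ?lerN2// ltW.
  + rewrite in_itv /= => /andP[c0 ca] E; exists c.
      by rewrite !ler0_norm ?lerN2// ltW.
    by rewrite -opprB E sub0r mulrN opprK.
Qed.

(** The difference quotient of f along w, extended by its limit value at step 0,
so that the base point and the step can vary together in limits. *)
Definition slope f w q (r : V * R) : R :=
  if r.2 == 0 then 'D_w f q else (f (r.1 + r.2 *: w) - f r.1) / r.2.

Lemma slopeE f w q p a : f (p + a *: w) - f p = a * slope f w q (p, a).
Proof.
rewrite /slope /=; case: eqP => [->|/eqP a0].
  by rewrite scale0r addr0 subrr mul0r.
by rewrite mulrC divfK.
Qed.

(** The difference quotient at (p, a) is a value of the derivative on the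
segment from p to p + a w, by the mean value theorem; this segment shrinks to q,
where the derivative is continuous. *)
Lemma slope_cvg f w q :
  (\forall p \near q, derivable f p w) -> {for q, continuous ('D_w f)} ->
  slope f w q @ (q, 0 : R) --> 'D_w f q.
Proof.
move=> df cf; apply/cvgrPdist_le => e e0.
have /cvgrPdist_le/(_ e e0) ce := cf.
have [d /= d0 dP] := (@nbhs_ballP _ _ _ _).1 (filterI df ce).
pose d' := d / 2 / (`|w| + 1).
have w0 : 0 < `|w| + 1 by rewrite ltr_wpDl.
have d'0 : 0 < d' by rewrite /d' !divr_gt0.
exists (ball q (d / 2), ball (0 : R) d') => /=.
  by split; apply: nbhsx_ballx; rewrite ?divr_gt0.
move=> [p a] [] /= qp.
rewrite -ball_normE /= sub0r normrN => ad.
have inb s : `|s| <= `|a| -> ball q d (p + s *: w).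
  move=> sa; rewrite -ball_normE /= opprD addrA.
  rewrite (le_lt_trans (ler_normB _ _))//.
  rewrite -ball_normE /= in qp.
  rewrite (splitr d) ltr_leD//.
  rewrite normrZ (@le_trans _ _ (d' * (`|w| + 1)))//.
    by apply: ler_pM => //; [exact: (le_trans sa (ltW ad)) | rewrite lerDl].
  by rewrite /d' divfK// gt_eqF.
rewrite /slope /=; case: eqP => [_|/eqP a0]; first by rewrite subrr normr0 ltW.
have [|s sa] := @MVT_symmetric (fun s => f (p + s *: w)) (fun s => 'D_w f (p + s *: w)) a.
  by move=> s /inb /dP[] ds _; exact: is_derive_line.
rewrite scale0r addr0 => ->; rewrite mulfK//.
by have [] := dP _ (inb _ sa).
Qed.

End Lines.

Section SmoothFacts.
Variables (R : realType) (V : normedModType R) (A : set V).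
Hypothesis oA : open A.
Implicit Types (f g : V -> R) (p q u v w : V) (s t a : R).

Lemma nearA p : A p -> \forall q \near p, A q.
Proof. by move=> Ap; apply: open_nbhs_nbhs. Qed.

Lemma smooth_continuous f p : smooth_on A f -> A p -> {for p, continuous f}.
Proof. by move=> sf Ap; have [] := sf [::] p Ap. Qed.

Lemma smooth_derivable f p v : smooth_on A f -> A p -> derivable f p v.
Proof. by move=> sf Ap; have [_] := sf [::] p Ap; apply. Qed.

Lemma iter_derive_rcons vs v f :
  iter_derive (rcons vs v) f = iter_derive vs ('D_v f).
Proof. by elim: vs => //= w vs ->. Qed.

Lemma smooth_derive f v : smooth_on A f -> smooth_on A ('D_v f).
Proof. by move=> sf vs p Ap; rewrite -iter_derive_rcons; exact: sf. Qed.

Lemma smooth_iter_derive f vs : smooth_on A f -> smooth_on A (iter_derive vs f).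
Proof. by move=> sf; elim: vs => //= v vs; exact: smooth_derive. Qed.

Lemma smooth_slope_cvg f w q : smooth_on A f -> A q ->
  slope f w q @ (q, 0 : R) --> 'D_w f q.
Proof.
move=> sf Aq; apply: slope_cvg.
  by near=> p; apply: smooth_derivable sf _; near: p; exact: nearA.
by apply: smooth_continuous => //; exact: smooth_derive.
Unshelve. all: by end_near. Qed.

(** One step of the chain rule: displacements a(h) w issued from moving base
points c(h).  A curve with several velocity components is handled by summing
such steps, one direction at a time. *)
Lemma smooth_step f w q (c : R -> V) (a : R -> R) (al : R) :
  smooth_on A f -> A q -> c h @[h --> 0^'] --> q ->
  (h^-1 * a h) @[h --> 0^'] --> al ->
  (h^-1 * (f (c h + a h *: w) - f (c h))) @[h --> 0^'] --> al * 'D_w f q.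
Proof.
move=> sf Aq cq aal.
have a0 : a h @[h --> 0^'] --> (0 : R).
  rewrite -[X in _ --> X](mul0r al); apply: (@cvg_trans _ (h * (h^-1 * a h) @[h --> 0^'])).
    apply: near_eq_cvg; near=> h; rewrite mulrA divff ?mul1r//.
    by near: h; exact: nbhs_dnbhs_neq.
  by apply: cvgM => //; exact: nbhs_dnbhs.
have -> : (fun h => h^-1 * (f (c h + a h *: w) - f (c h))) =
          (fun h => h^-1 * a h * slope f w q (c h, a h)).
  by apply/funext => h; rewrite (slopeE f w q) mulrA.
apply: cvgM => //.
apply: (@cvg_comp _ _ _ (fun h => (c h, a h)) (slope f w q)); last first.
  exact: smooth_slope_cvg.
exact: (cvg_pair cq a0).
Unshelve. all: by end_near. Qed.

Lemma cvg_dnbhs_id : h @[h --> (0 : R)^'] --> (0 : R).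
Proof. exact: nbhs_dnbhs. Qed.

Lemma cvg_dnbhs_ratio : (h^-1 * h) @[h --> (0 : R)^'] --> (1 : R).
Proof.
apply: (@cvg_trans _ ((1 : R) @[h --> (0:R)^'])); last exact: cvg_cst.
apply: near_eq_cvg; near=> h; rewrite mulVf//.
by near: h; exact: nbhs_dnbhs_neq.
Unshelve. all: by end_near. Qed.

Lemma cvg_line (p w : V) : (p + h *: w) @[h --> (0 : R)^'] --> p.
Proof.
have : (p + h *: w) @[h --> (0 : R)^'] --> p + 0 *: w.
  apply: cvgD; first exact: cvg_cst.
  by apply: cvgZr_tmp; exact: cvg_dnbhs_id.
by rewrite scale0r addr0.
Qed.

Lemma deriveDr f u v p : smooth_on A f -> A p ->
  'D_(u + v) f p = 'D_u f p + 'D_v f p.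
Proof.
move=> sf Ap; apply: cvg_lim => //.
have cp : p @[h --> (0 : R)^'] --> p by exact: cvg_cst.
have s1 := smooth_step (w := u) sf Ap cp cvg_dnbhs_ratio.
have s2 := smooth_step (w := v) sf Ap (@cvg_line p u) cvg_dnbhs_ratio.
rewrite !mul1r in s1 s2.
apply: cvg_trans (cvgD s1 s2); apply: near_eq_cvg; apply: nearW => h /=.
rewrite /shift /= (_ : h *: (u + v) + p = p + h *: u + h *: v); last first.
  by rewrite scalerDr addrC addrA.
rewrite -[LHS]/(h^-1 * (f (p + h *: u) - f p) +
  h^-1 * (f (p + h *: u + h *: v) - f (p + h *: u))).
rewrite -[RHS]/(h^-1 * (f (p + h *: u + h *: v) - f p)).
by ring.
Qed.

Lemma deriveZr f u a p : smooth_on A f -> A p ->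
  'D_(a *: u) f p = a * 'D_u f p.
Proof.
move=> sf Ap; apply: cvg_lim => //.
have ca : (h^-1 * (h * a)) @[h --> (0 : R)^'] --> a.
  rewrite -{2}[a]mul1r.
  under eq_cvg do rewrite mulrA.
  by apply: cvgM; [exact: cvg_dnbhs_ratio|exact: cvg_cst].
have cp : p @[h --> (0 : R)^'] --> p by exact: cvg_cst.
have := smooth_step (w := u) sf Ap cp ca.
apply: cvg_trans; apply: near_eq_cvg; apply: nearW => h /=.
by rewrite /shift /= scalerA [p + _]addrC.
Qed.

Lemma derive_sumr f (I : Type) (r : seq I) (P : pred I) (F : I -> V) p :
  smooth_on A f -> A p ->
  'D_(\sum_(i <- r | P i) F i) f p = \sum_(i <- r | P i) 'D_(F i) f p.
Proof.
move=> sf Ap; elim/big_ind2 : _ => //; first by rewrite derive0.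
by move=> x1 x2 y1 y2 <- <-; rewrite deriveDr.
Qed.

(** The second difference of f on the parallelogram spanned by h u and h v; its
symmetry in u and v is the reason for the symmetry of second derivatives. *)
Definition diff2 f u v p h :=
  f (p + h *: u + h *: v) - f (p + h *: u) - (f (p + h *: v) - f p).

(** The mean value theorem along v reduces the second difference to the
difference quotient along u of D_v f, at a base point tending to p. *)
Lemma diff2_cvg f u v p : smooth_on A f -> A p ->
  (h^-1 * h^-1 * diff2 f u v p h) @[h --> 0^'] --> 'D_u ('D_v f) p.
Proof.
move=> sf Ap; have sdf := smooth_derive v sf.
(* The increments h u and h v are kept inside a ball where the
   difference quotient of D_v f is e-close to its limit. *)
apply/cvgrPdist_le => e e0.
have /cvgrPdist_le/(_ e e0) := smooth_slope_cvg (w := u) sdf Ap.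
move=> [[B C]] /= [nB nC] BC.
have [d /= d0 dP] := (@nbhs_ballP _ _ _ _).1 (filterI nB (nearA Ap)).
pose d' := d / 2 / (`|u| + `|v| + 1).
have w0 : 0 < `|u| + `|v| + 1 by rewrite ltr_wpDl ?addr_ge0.
have d'0 : 0 < d' by rewrite /d' !divr_gt0.
have inb (h s r : R) : `|h| < d' -> `|s| <= `|h| -> `|r| <= `|h| ->
    ball p d (p + r *: u + s *: v).
  move=> hd sh rh; rewrite -ball_normE /= -addrA opprD addNKr normrN.
  rewrite (le_lt_trans (ler_normD _ _))// !normrZ.
  apply: (@le_lt_trans _ _ (d' * (`|u| + `|v| + 1))); last first.
    by rewrite /d' divfK ?gt_eqF// ltr_pdivrMr// ltr_pMr// ltr1n.
  have h1 := le_trans sh (ltW hd); have h2 := le_trans rh (ltW hd).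
  have := ler_pM (normr_ge0 _) (normr_ge0 _) h1 (lexx `|v|).
  have := ler_pM (normr_ge0 _) (normr_ge0 _) h2 (lexx `|u|).
  by nra.
near=> h.
have h0 : h != 0 by near: h; exact: nbhs_dnbhs_neq.
have hd : `|h| < d' by near: h; exact: dnbhs0_lt.
have hC : C h by near: h; apply: nbhs_dnbhs.
have [|s sh] := @MVT_symmetric R (fun s => f (p + h *: u + s *: v) - f (p + s *: v))
  (fun s => 'D_v f (p + h *: u + s *: v) - 'D_v f (p + s *: v)) h.
  move=> s sh; have /dP[_ A1] := inb h s h hd sh (lexx _).
  have := inb h s 0 hd sh; rewrite normr0 normr_ge0 scale0r addr0 => /(_ isT).
  move=> /dP[_ A2]; apply: is_deriveB; apply: is_derive_line;
  exact: smooth_derivable.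
rewrite scale0r !addr0 => E.
have -> : diff2 f u v p h = h * (h * slope ('D_v f) u p (p + s *: v, h)).
  rewrite -slopeE mulrC [p + s *: v + _]addrAC -E /diff2; ring.
rewrite -mulrA (mulKf h0) (mulKf h0).
apply: (BC (p + s *: v, h)); split => //=.
have := inb h s 0 hd sh; rewrite normr0 normr_ge0 scale0r addr0 => /(_ isT).
by move=> /dP[].
Unshelve. all: by end_near. Qed.

Lemma derive_comm f u v p : smooth_on A f -> A p ->
  'D_u ('D_v f) p = 'D_v ('D_u f) p.
Proof.
move=> sf Ap; have c1 := diff2_cvg (u := u) (v := v) sf Ap.
have := diff2_cvg (u := v) (v := u) sf Ap.
have -> : diff2 f v u p = diff2 f u v p.
  by apply/funext => h; rewrite /diff2 [p + h *: v + _]addrAC; ring.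
by move=> c2; exact: (cvg_unique _ c1 c2).
Qed.

End SmoothFacts.

Section SmoothAlg.
Variables (R : realType) (V : normedModType R) (A : set V).
Hypothesis oA : open A.
Implicit Types (f g : V -> R) (p q u v w : V) (s t a : R).

(** The algebra of functions generated by G under sums, products and inverses,
up to equality on A.  If the generators are differentiable with derivatives in
the algebra, then the algebra is stable by all directional derivatives, hence
made of smooth functions: this proves smoothness of all orders at once,
without computing a derivative of order two. *)
Inductive smalg (G : (V -> R) -> Prop) : (V -> R) -> Prop :=
| smalg_gen f : G f -> smalg G f
| smalg_cst a : smalg G (fun=> a)
| smalg_add f g : smalg G f -> smalg G g -> smalg G (fun p => f p + g p)
| smalg_mul f g : smalg G f -> smalg G g -> smalg G (fun p => f p * g p)
| smalg_inv f : (forall p, A p -> f p != 0) -> smalg G f ->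
    smalg G (fun p => (f p)^-1)
| smalg_ext f g : smalg G f -> (forall p, A p -> g p = f p) -> smalg G g.

Lemma near_eqA f g p : (forall p, A p -> g p = f p) -> A p ->
  \forall q \near p, f q = g q.
Proof.
by move=> fg Ap; near=> q; rewrite fg//; near: q; apply: open_nbhs_nbhs.
Unshelve. all: by end_near. Qed.

Lemma derive_ext f g v p : (forall p, A p -> g p = f p) -> A p ->
  'D_v g p = 'D_v f p.
Proof. by move=> fg Ap; apply/esym/near_eq_derive/near_eqA. Qed.

Lemma derivable_ext f g v p : (forall p, A p -> g p = f p) -> A p ->
  derivable f p v -> derivable g p v.
Proof. by move=> fg Ap; apply/near_eq_derivable/near_eqA. Qed.

Lemma continuous_ext f g p : (forall p, A p -> g p = f p) -> A p ->
  {for p, continuous f} -> {for p, continuous g}.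
Proof.
move=> fg Ap; rewrite /prop_for /continuous_at (fg _ Ap); apply: cvg_trans.
exact/near_eq_cvg/near_eqA.
Qed.

Section Closure.
Variable G : (V -> R) -> Prop.
Hypothesis Gc : forall f, G f -> forall p, A p ->
  {for p, continuous f} /\ forall v, derivable f p v.
Hypothesis Gd : forall f v, G f -> smalg G ('D_v f).

Lemma smalg_c1 f : smalg G f -> forall p, A p ->
  {for p, continuous f} /\ forall v, derivable f p v.
Proof.
elim=> {f} [f /Gc//|a|f g _ IHf _ IHg|f g _ IHf _ IHg|f f0 _ IHf|f g _ IHf fg] p Ap.
- by split=> [|v]; [exact: cvg_cst|exact: derivable_cst].
- have [cf df] := IHf p Ap; have [cg dg] := IHg p Ap.
  by split=> [|v]; [exact: cvgD|exact: derivableD].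
- have [cf df] := IHf p Ap; have [cg dg] := IHg p Ap.
  by split=> [|v]; [exact: cvgM|exact: derivableM].
- have [cf df] := IHf p Ap.
  by split=> [|v]; [apply: cvgV => //; exact: f0|apply: derivableV => //; exact: f0].
- have [cf df] := IHf p Ap.
  by split=> [|v]; [exact: continuous_ext cf|exact: derivable_ext (df v)].
Qed.

Lemma smalg_derive f v : smalg G f -> smalg G ('D_v f).
Proof.
elim=> {f} [f /Gd//|a|f g sf IHf sg IHg|f g sf IHf sg IHg|f f0 sf IHf|f g _ IHf fg].
- by apply: smalg_ext (smalg_cst G 0) _ => p _; exact: derive_cst.
- apply: smalg_ext (smalg_add IHf IHg) _ => p Ap.
  have [_ df] := smalg_c1 sf Ap; have [_ dg] := smalg_c1 sg Ap.
  exact: deriveD.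
- apply: smalg_ext (smalg_add (smalg_mul sf IHg) (smalg_mul sg IHf)) _ => p Ap.
  have [_ df] := smalg_c1 sf Ap; have [_ dg] := smalg_c1 sg Ap.
  exact: deriveM.
- have ff0 p : A p -> f p * f p != 0 by move=> Ap; rewrite mulf_neq0 ?f0.
  apply: smalg_ext (smalg_mul (smalg_cst G (-1))
     (smalg_mul (smalg_inv ff0 (smalg_mul sf sf)) IHf)) _ => p Ap.
   have [_ df] := smalg_c1 sf Ap.
  by rewrite deriveV ?f0// mulrA mulN1r -expr2.
- by apply: smalg_ext IHf _ => p Ap; exact: derive_ext.
Qed.

Lemma smalg_smooth f : smalg G f -> smooth_on A f.
Proof.
move=> sf vs; suff /smalg_c1 : smalg G (iter_derive vs f) by apply.
by elim: vs => //= v vs; exact: smalg_derive.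
Qed.
End Closure.

Lemma smooth_smalg f : smalg (smooth_on A) f -> smooth_on A f.
Proof.
apply: smalg_smooth => {}f.
- by move=> sf p; exact: (sf [::]).
- by move=> v sf; apply: smalg_gen; exact: smooth_derive.
Qed.

Lemma smooth_cst a : smooth_on A (fun=> a).
Proof. exact/smooth_smalg/smalg_cst. Qed.

Lemma smoothD f g : smooth_on A f -> smooth_on A g ->
  smooth_on A (fun p => f p + g p).
Proof. by move=> sf sg; apply/smooth_smalg/smalg_add; exact: smalg_gen. Qed.

Lemma smoothM f g : smooth_on A f -> smooth_on A g ->
  smooth_on A (fun p => f p * g p).
Proof. by move=> sf sg; apply/smooth_smalg/smalg_mul; exact: smalg_gen. Qed.

Lemma smoothX f m : smooth_on A f -> smooth_on A (fun p => f p ^+ m).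
Proof.
move=> sf; elim: m => [|m IH]; first exact: smooth_cst.
under eq_fun do rewrite exprS.
exact: smoothM.
Qed.

Lemma smooth_sum (I : Type) (r : seq I) (F : I -> V -> R) :
  (forall i, smooth_on A (F i)) -> smooth_on A (fun p => \sum_(i <- r) F i p).
Proof.
move=> sF; elim: r => [|i r IH].
  by under eq_fun do rewrite big_nil; exact: smooth_cst.
under eq_fun do rewrite big_cons.
exact: smoothD.
Qed.

Lemma smooth_ext f g : smooth_on A f -> (forall p, A p -> g p = f p) ->
  smooth_on A g.
Proof. by move=> sf fg; apply/smooth_smalg/smalg_ext/fg/smalg_gen. Qed.

Lemma derive_mul f g v p : smooth_on A f -> smooth_on A g -> A p ->
  'D_v (fun p => f p * g p) p = f p * 'D_v g p + g p * 'D_v f p.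
Proof.
by move=> sf sg Ap; apply: deriveM; [exact: smooth_derivable sf Ap|
  exact: smooth_derivable sg Ap].
Qed.

Lemma derive_add f g v p : smooth_on A f -> smooth_on A g -> A p ->
  'D_v (fun p => f p + g p) p = 'D_v f p + 'D_v g p.
Proof.
by move=> sf sg Ap; apply: deriveD; [exact: smooth_derivable sf Ap|
  exact: smooth_derivable sg Ap].
Qed.

Lemma iter_derive_ext f g vs p : (forall p, A p -> g p = f p) -> A p ->
  iter_derive vs g p = iter_derive vs f p.
Proof.
move=> fg; elim: vs p => [|v vs IH] p Ap /=; first exact: fg.
exact: derive_ext IH Ap.
Qed.

End SmoothAlg.

Lemma cvg_sum_seq (R : realType) (T : Type) (G : set_system T) (I : Type) (r : seq I)
    (f : I -> T -> R) (l : I -> R) : Filter G ->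
  (forall i, f i x @[x --> G] --> l i) ->
  (\sum_(i <- r) f i x) @[x --> G] --> \sum_(i <- r) l i.
Proof.
move=> FG fl; elim: r => [|i r IH].
  rewrite big_nil (_ : (fun x => _) = cst (0 : R)); first exact: cvg_cst.
  by apply/funext => x; rewrite big_nil.
rewrite big_cons (_ : (fun x => _) = (fun x => f i x + \sum_(j <- r) f j x)).
  exact: (cvgD (fl i) IH).
by apply/funext => x; rewrite big_cons.
Qed.

(** * Minkowski norms *)

Section Homogeneous.
Variables (R : realType) (V : normedModType R).
Implicit Types (f g : V -> R) (p q w : V).

Lemma euler f p w k :
  (forall s : R, -1 < s -> f (p + s *: w) = (1 + s) ^+ k * f p) ->
  'D_w f p = k%:R * f p.
Proof.
move=> fE; rewrite -derive1_line0.
have -> : derive1 (fun s : R => f (p + s *: w)) 0 =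
          derive1 (fun s : R => (1 + s) ^+ k * f p) 0.
  rewrite !derive1E; apply: near_eq_derive; near=> s.
  by apply: fE; near: s; apply: lt_nbhsr; rewrite ltrN10.
have d0 : is_derive (0 : R) (1 : R) (cst 1 + id : R -> R) (0 + 1).
  exact: (is_deriveD (is_derive_cst _ _ _) (is_derive_id _ _)).
have d1 : is_derive (0 : R) (1 : R) (fun s : R => (1 + s) ^+ k)
    ((k%:R * (1 + 0) ^+ k.-1) *: (0 + 1)).
  rewrite (_ : (fun s : R => _) = (cst 1 + id) ^+ k); first exact: is_deriveX.
  by apply/funext => s; rewrite exprfctE.
have d2 := is_deriveM d1 (is_derive_cst (f p) (0 : R) (1 : R)).
rewrite derive1E (@derive_val _ _ _ _ _ _ _ d2).
by rewrite /= scaler0 !add0r addr0 expr1n mulr1 scaler1 mulrC.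
Unshelve. all: by end_near. Qed.

End Homogeneous.

Section HomogeneousDerive.
Variables (R : realType) (V : normedModType R) (A : set V).
Hypothesis oA : open A.
Implicit Types (f g : V -> R) (p q w : V).

(** If f near q is c times f near p, with lengths along w scaled by b, then
the derivatives along w are in the ratio c b.  All homogeneity statements for
derivatives follow. *)
Lemma homog_derive f p q w (b c : R) : smooth_on A f -> A p ->
  (\forall s \near (0 : R), f (q + s *: w) = c * f (p + (s * b) *: w)) ->
  'D_w f q = c * b * 'D_w f p.
Proof.
move=> sf Ap fE; rewrite -derive1_line0.
have -> : derive1 (fun s : R => f (q + s *: w)) 0 =
          derive1 (fun s : R => c * f (p + s *: (b *: w))) 0.
  rewrite !derive1E; apply: near_eq_derive; near=> s.
  by rewrite scalerA; near: s.
have := @is_derive_line _ _ f p (b *: w) 0.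
rewrite scale0r addr0 => /(_ (smooth_derivable sf Ap)) d1.
have d2 := is_deriveM (is_derive_cst c (0 : R) (1 : R)) d1.
rewrite derive1E (@derive_val _ _ _ _ _ _ _ d2) /=.
by rewrite scaler0 addr0 (deriveZr oA _ _ sf Ap) -[LHS]/(c * _) mulrA.
Unshelve. all: by end_near. Qed.

End HomogeneousDerive.

Section RowSpace.
Variables (R : realType) (n : nat).
Local Notation V := 'rV[R]_n.

Lemma row_sum_e (x : V) : x = \sum_i x 0 i *: e_ R i.
Proof. exact: row_sum_delta. Qed.

Lemma open_neq0 : open [set y : V | y != 0].
Proof.
move=> y /= y0; apply/nbhs_ballP; exists `|y|; first by rewrite /= normr_gt0.
move=> z; rewrite -ball_normE /= => yz; apply/eqP => z0.
by rewrite z0 subr0 ltxx in yz.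
Qed.

Lemma derive_row (A : set V) (f : V -> R) (x p : V) : open A ->
  smooth_on A f -> A p -> 'D_x f p = \sum_i x 0 i * 'D_(e_ R i) f p.
Proof.
move=> oA sf Ap; rewrite {1}(row_sum_e x) (derive_sumr oA)//.
by apply: eq_bigr => i _; rewrite (deriveZr oA).
Qed.

End RowSpace.

Section Minkowski.
Variables (R : realType) (n : nat).
Local Notation V := 'rV[R]_n.
Variable phi : V -> R.
Hypothesis hphi : minkowski_norm phi.
Implicit Types (x y u v z w : V) (a s t : R).
Local Notation V0 := [set y : V | y != 0].

Lemma phi_ge0 y : 0 <= phi y. Proof. by case: hphi. Qed.

Lemma phiZ a y : 0 < a -> phi (a *: y) = a * phi y.
Proof. by case: hphi => _ h _ _; exact: h. Qed.

Lemma phi_smooth : smooth_on V0 phi. Proof. by case: hphi. Qed.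

Lemma phi0 : phi 0 = 0.
Proof. by have := @phiZ 2 0 (ltr0Sn _ _); rewrite scaler0; lra. Qed.

Lemma fund_formE (f : V -> R) y u v :
  fund_form f y u v = 2^-1 * 'D_u ('D_v (fun z => f z ^+ 2)) y.
Proof.
rewrite /fund_form; congr (_ * _).
rewrite -(derive1_line0 ('D_v (fun z => f z ^+ 2)) y u); congr (derive1 _ 0); apply/funext => s.
exact: (derive1_line0 (fun z => f z ^+ 2)).
Qed.

Lemma phi_euler y : 'D_y phi y = phi y.
Proof.
rewrite (@euler _ _ phi y y 1) ?mul1r// => s s1.
by rewrite expr1 -phiZ ?scalerDl ?scale1r//; lra.
Qed.

Lemma derive_sqr v z : z != 0 ->
  'D_v (fun z => phi z ^+ 2) z = 2 * phi z * 'D_v phi z.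
Proof.
move=> z0; under eq_fun do rewrite expr2.
by rewrite (derive_mul (A := V0)) //; [ring|exact: phi_smooth|exact: phi_smooth].
Qed.

(** If phi vanished at y, Euler's identity would make the second derivative of
phi^2 at y along y vanish as well, against positive definiteness. *)
Lemma phi_gt0 y : y != 0 -> 0 < phi y.
Proof.
move=> y0; rewrite lt_neqAle phi_ge0 andbT; apply/eqP => /esym phiy0.
have [_ _ _ /(_ y y y0 y0)] := hphi; rewrite fund_formE.
have sd := smooth_derive y phi_smooth.
rewrite (@derive_ext _ _ V0 (open_neq0 (n := n))
  (fun z => 2 * phi z * 'D_y phi z) _ y y _ y0); last by move=> p; exact: derive_sqr.
have s2 := smooth_cst (open_neq0 (n:=n)) (2 : R).
rewrite (derive_mul (A := V0) _ (smoothM (open_neq0 (n:=n)) s2 phi_smooth) sd y0).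
rewrite (derive_mul (A := V0) _ s2 phi_smooth y0).
by rewrite derive_cst phi_euler phiy0; lra.
Qed.

Lemma derive_phiZ a v z : 0 < a -> z != 0 -> 'D_v phi (a *: z) = 'D_v phi z.
Proof.
move=> a0 z0; have aN : a != 0 by rewrite gt_eqF.
rewrite (@homog_derive _ _ V0 (open_neq0 (n:=n)) phi z (a *: z) v a^-1 a)//.
- by rewrite divff ?mul1r.
- exact: phi_smooth.
- by near=> s; rewrite -phiZ// scalerDr scalerA mulrCA divff ?mulr1.
Unshelve. all: by end_near. Qed.

(** phi^2 lies above its tangent at z along any segment that avoids the origin,
where its second derivative is positive. *)
Lemma sqr_convex z d : d != 0 -> (forall t, 0 <= t <= 1 -> z + t *: d != 0) ->
  phi z ^+ 2 + 2 * phi z * 'D_d phi z <= phi (z + d) ^+ 2.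
Proof.
move=> d0 zd; set E := fun z => phi z ^+ 2.
have sE : smooth_on V0 E by apply/(smoothX (open_neq0 (n:=n)))/phi_smooth.
have sdE := smooth_derive d sE.
have [||c] := @MVT_segment R (fun t => E (z + t *: d)) (fun t => 'D_d E (z + t *: d)) 0 1 ler01.
- move=> t; rewrite in_itv /= => /andP[t0 t1]; apply: is_derive_line.
  by apply: (smooth_derivable sE); apply: zd; rewrite !ltW.
- apply: derivable_within_continuous => t; rewrite in_itv /= => t01.
  by apply: derivable_line; apply: (smooth_derivable sE); exact: zd.
rewrite in_itv /= => /andP[c0 c1]; rewrite scale1r scale0r addr0 subr0 mulr1 => E1.
have [||e] := @MVT_segment R (fun t => 'D_d E (z + t *: d))
    (fun t => 'D_d ('D_d E) (z + t *: d)) 0 c c0.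
- move=> t; rewrite in_itv /= => /andP[t0 t1]; apply: is_derive_line.
  by apply: (smooth_derivable sdE); apply: zd; rewrite ltW//=; lra.
- apply: derivable_within_continuous => t; rewrite in_itv /= => t01.
  by apply: (@derivable_line _ _ ('D_d E)); apply: (smooth_derivable sdE); apply: zd; lra.
rewrite in_itv /= => /andP[e0 ec]; rewrite scale0r addr0 subr0 => E2.
have ze : z + e *: d != 0 by apply: zd; lra.
have [_ _ _ /(_ _ d ze d0)] := hphi; rewrite fund_formE -/E => pos.
have z0 : z != 0 by have := zd 0; rewrite scale0r addr0 lexx ler01; exact.
rewrite -derive_sqr// -/E -[phi z ^+ 2]/(E z) -[phi (z + d) ^+ 2]/(E (z + d)).
have : 0 <= 'D_d ('D_d E) (z + e *: d) * c by rewrite mulr_ge0// ltW; lra.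
by lra.
Qed.

(** The fundamental inequality of Finsler geometry.  D_x phi is constant along
the ray of z, so z may be rescaled to have phi z = phi x; the tangent
inequality for phi^2 on the segment from z to x is then the claim.  If that
segment meets the origin, x is a nonpositive multiple of z. *)
Lemma fund_ineq x z : z != 0 -> 'D_x phi z <= phi x.
Proof.
move=> z0; have [->|x0] := eqVneq x 0; first by rewrite derive0 phi0.
pose r := phi x / phi z; have r0 : 0 < r by rewrite divr_gt0// phi_gt0.
pose z' := r *: z.
have z'0 : z' != 0 by rewrite scaler_eq0 negb_or gt_eqF.
have pz' : phi z' = phi x by rewrite phiZ// divfK// gt_eqF// phi_gt0.
rewrite -(derive_phiZ x r0 z0) -/z'.
have dZ b : 'D_(b *: z') phi z' = b * phi x.
  by rewrite (deriveZr (open_neq0 (n:=n)) _ _ phi_smooth)// phi_euler pz'.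
have [xz|xz] := eqVneq x z'; first by rewrite {1}xz -[X in 'D_X _ _]scale1r dZ mul1r.
have [[t /andP[t0 t1] zt]|noz] := pselect (exists2 t, 0 <= t <= 1 & z' + t *: (x - z') = 0).
  have tN : t != 0.
    by apply/eqP => t00; move: zt; rewrite t00 scale0r addr0; exact/eqP.
  have -> : x = (- ((1 - t) / t)) *: z'.
    apply: (scalerI tN); rewrite scalerA mulrN mulrCA divff// mulr1.
    apply/eqP; rewrite -subr_eq0 scaleNr opprK scalerBl scale1r; apply/eqP.
    by rewrite -zt scalerBr addrCA.
  rewrite dZ; have := phi_ge0 x; have : 0 <= (1 - t) / t by rewrite divr_ge0// subr_ge0.
  set k := (1 - t) / t; move=> k0 p0.
  apply: le_trans (phi_ge0 _).
  by rewrite mulNr oppr_le0 mulr_ge0.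
have := @sqr_convex z' (x - z'); rewrite subr_eq0 xz => /(_ isT) H.
rewrite (addrC z' (x - z')) subrK pz' in H.
have := H; rewrite (deriveDr (open_neq0 (n:=n)) _ _ phi_smooth)//.
rewrite -scaleN1r dZ => {}H.
have px := phi_gt0 x0.
have {H} : 2 * phi x * ('D_x phi z' + -1 * phi x) <= 0.
  suff : phi x ^+ 2 + 2 * phi x * ('D_x phi z' + -1 * phi x) <= phi x ^+ 2 by lra.
  apply: H => t t01; apply/eqP => zt; apply: noz; exists t => //.
  by rewrite -scaleN1r.
by rewrite pmulr_rle0 ?mulr_gt0//; lra.
Qed.

Lemma phi_triangle u v : phi (u + v) <= phi u + phi v.
Proof.
have [->|uv0] := eqVneq (u + v) 0; first by rewrite phi0 addr_ge0 ?phi_ge0.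
rewrite -phi_euler (deriveDr (open_neq0 (n:=n)) _ _ phi_smooth)//.
by rewrite lerD// fund_ineq.
Qed.

Lemma phi_sum (I : Type) (r : seq I) (F : I -> V) :
  phi (\sum_(i <- r) F i) <= \sum_(i <- r) phi (F i).
Proof.
elim/big_ind2 : _ => [|a b c d ab cd|//]; first by rewrite phi0.
by apply: le_trans (phi_triangle _ _) _; exact: lerD.
Qed.

Lemma phi_le_norm : exists2 C, 0 <= C & forall y, phi y <= C * `|y|.
Proof.
exists (\sum_i (phi (e_ R i) + phi (- e_ R i))).
  by apply: sumr_ge0 => i _; rewrite addr_ge0 ?phi_ge0.
move=> y; rewrite {1}(row_sum_e y) (le_trans (phi_sum _ _))// mulr_suml.
apply: ler_sum => i _.
have yi : `|y 0 i| <= `|y|.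
  by rewrite [leRHS]/Num.norm /= mx_normrE; apply: (le_bigmax _ _ (0, i)).
apply: (@le_trans _ _ (`|y 0 i| * (phi (e_ R i) + phi (- e_ R i)))); last first.
  by rewrite mulrC ler_wpM2l// addr_ge0 ?phi_ge0.
have := phi_ge0 (e_ R i); have := phi_ge0 (- e_ R i) => p1 p2.
case: (ltgtP (y 0 i) 0) => yi0.
- have -> : y 0 i *: e_ R i = `|y 0 i| *: (- e_ R i).
    by rewrite ltr0_norm// scaleNr scalerN opprK.
  by rewrite phiZ ?normr_gt0 ?lt_eqF// ler_wpM2l// lerDr.
- by rewrite gtr0_norm// phiZ// ler_wpM2l ?lerDl// ltW.
- by rewrite yi0 scale0r phi0 normr0 mul0r.
Qed.

Lemma phi_continuous : continuous phi.
Proof.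
move=> y; have [->|y0] := eqVneq y 0; last exact: smooth_continuous phi_smooth _.
rewrite /continuous_at phi0; have F0 : Filter (nbhs (0 : V)) by exact: nbhs_filter.
apply/cvgrPdist_lt => e e0.
have [C C0 phiC] := phi_le_norm.
have sm : \forall z \near (0 : V), `|z| < e / (C + 1).
  by apply: nbhs0_lt; rewrite divr_gt0 ?ltr_wpDl.
near=> z; rewrite sub0r normrN ger0_norm ?phi_ge0// (le_lt_trans (phiC z))//.
rewrite (@le_lt_trans _ _ ((C + 1) * `|z|))// ?ler_wpM2r ?lerDl//.
rewrite mulrC -ltr_pdivlMr ?ltr_wpDl//.
by near: z; exact: sm.
Unshelve. all: by end_near. Qed.

Lemma open_Omega : open (Omega phi).
Proof.
rewrite (_ : Omega phi = phi @^-1` [set r | r < 1])//.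
by apply: open_comp; [move=> y _; exact: phi_continuous|exact: open_lt].
Qed.

(** phi is continuous and increasing along rays, so the boundary of the sublevel
set is exactly the level set. *)
Lemma Omega_boundary z :
  (closure (Omega phi) `\` interior (Omega phi)) z <-> phi z = 1.
Proof.
have /interior_id -> := open_Omega; split.
  move=> [cz] /negP; rewrite -leNgt => p1; apply/eqP; rewrite eq_le p1 andbT.
  have clo : closed [set y | phi y <= 1].
    rewrite (_ : [set y | _] = phi @^-1` [set r | r <= 1])//.
    by apply: closed_comp; [move=> y _; exact: phi_continuous|exact: closed_le].
  have := clo z; apply; apply: closure_subset cz.
  by move=> y /ltW.
move=> pz; split; last by rewrite /Omega /= pz ltxx.
move=> B /nbhs_ballP[e /= e0 eB].
have z0 : z != 0 by apply/eqP => z0; move: pz; rewrite z0 phi0; lra.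
have nz : 0 < `|z| by rewrite normr_gt0.
(* Points of the domain close to z are found by shrinking z slightly. *)
pose d := Num.min (2^-1) (e / `|z| / 2).
have d0 : 0 < d by rewrite lt_min invr_gt0 ltr0n /= !divr_gt0.
have d1 : d <= 2^-1 by rewrite ge_min lexx.
have d2 : d <= e / `|z| / 2 by rewrite ge_min lexx orbT.
exists ((1 - d) *: z); split.
  by rewrite /Omega /= phiZ ?pz; lra.
apply: eB; rewrite -ball_normE /= -{1}[z]scale1r -scalerBl opprB addrC subrK normrZ.
rewrite gtr0_norm// -ltr_pdivlMr// (le_lt_trans d2)//.
by rewrite ltr_pdivrMr// ltr_pMr ?divr_gt0// ltr1n.
Qed.

End Minkowski.

(** * The Funk metric and its first derivatives *)

Section Funk.
Variables (R : realType) (n : nat).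
Local Notation V := 'rV[R]_n.
Local Notation W := (V * V)%type.
Variable phi : V -> R.
Hypothesis hphi : minkowski_norm phi.
Implicit Types (x y u v z : V) (a s t : R) (p q w : W).
Local Notation V0 := [set y : V | y != 0].
Local Notation F := (funk phi).

(** By the triangle inequality s - phi (y + s x) increases at rate at least
1 - phi x > 0 in the domain.  Existence, uniqueness and continuity of the root
defining the Funk metric rest on this bound. *)
Lemma funk_monotone x y s s' : s <= s' ->
  (s' - s) * (1 - phi x) <= (s' - phi (y + s' *: x)) - (s - phi (y + s *: x)).
Proof.
rewrite le_eqVlt => /predU1P[->|ss']; first by rewrite !subrr mul0r.
have := phi_triangle hphi (y + s *: x) ((s' - s) *: x).
by rewrite -addrA -scalerDl (addrC s) subrK phiZ ?subr_gt0//; lra.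
Qed.

Lemma funk_unique_root x y s s' : phi x < 1 ->
  phi (y + s *: x) = s -> phi (y + s' *: x) = s' -> s = s'.
Proof.
move=> x1; wlog ss' : s s' / s <= s'.
  by move=> H es es'; case: (leP s s') => [|/ltW] ss; [exact: H|exact/esym/H].
move=> es es'; have := funk_monotone x y ss'; rewrite es es'.
have : 0 < 1 - phi x by lra.
by move=> x1'; rewrite !subrr pmulr_lle0//; lra.
Qed.

Lemma funk_root_exists x y : phi x < 1 -> exists s, phi (y + s *: x) = s.
Proof.
(* At s = 0 the difference s - phi (y + s x) is nonpositive; b is the time
   at which its growth rate 1 - phi x has compensated the initial value
   - phi y. *)
move=> x1; pose b := phi y / (1 - phi x).
have x1' : 0 < 1 - phi x by lra.
have b0 : 0 <= b by rewrite divr_ge0 ?phi_ge0 ?ltW.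
have [||s _] := @IVT R (fun s => s - phi (y + s *: x)) 0 b 0 b0.
- apply: continuous_subspaceT => s; apply: cvgB; first exact: cvg_id.
  apply: (@cvg_comp _ _ _ (fun s : R => y + s *: x) phi); last exact: phi_continuous.
  by apply: cvgD; [exact: cvg_cst|apply: cvgZr_tmp; exact: cvg_id].
- have := funk_monotone x y b0; rewrite !scale0r !addr0 !subr0 !sub0r.
  rewrite /b divfK ?gt_eqF// -/b => H.
  by rewrite ge_min le_max oppr_le0 phi_ge0//=; apply/orP; right; lra.
by move=> es; exists s; lra.
Qed.

Lemma funk0 x : F x 0 = 0.
Proof. by rewrite /funk eqxx. Qed.

Lemma root_gt0 x y s : y != 0 -> phi (y + s *: x) = s -> 0 < s.
Proof.
move=> y0 es; have s0 : 0 <= s by rewrite -es phi_ge0.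
rewrite lt_neqAle s0 andbT; apply/eqP => /esym s00.
have := phi_gt0 hphi y0; move: es; rewrite s00 scale0r addr0 => ->.
by rewrite ltxx.
Qed.

Lemma funkP x y : phi x < 1 -> phi (y + F x y *: x) = F x y.
Proof.
move=> x1; rewrite /funk; case: eqP => [->|/eqP y0].
  by rewrite scale0r addr0 phi0.
have bd a : 0 < a -> (closure (Omega phi) `\` interior (Omega phi)) (x + a^-1 *: y)
    <-> phi (y + a *: x) = a.
  move=> a0; rewrite Omega_boundary//.
  have -> : y + a *: x = a *: (x + a^-1 *: y).
    by rewrite scalerDr scalerA divff ?gt_eqF// scale1r addrC.
  rewrite phiZ//; split=> [->|]; first by rewrite mulr1.
  by move=> ea; apply: (mulfI (lt0r_neq0 a0)); rewrite ea mulr1.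
have [s es] := funk_root_exists y x1.
have s0 := root_gt0 y0 es.
set P := [set a | _].
have Ps : P s by split => //; apply/bd.
by have [a0 /bd] := @xgetPex _ 0 P (ex_intro _ _ Ps); apply.
Qed.

Lemma funk_unique x y s : phi x < 1 -> phi (y + s *: x) = s -> F x y = s.
Proof. by move=> x1; apply: funk_unique_root => //; exact: funkP. Qed.

Lemma funk_gt0 x y : phi x < 1 -> y != 0 -> 0 < F x y.
Proof. by move=> x1 y0; apply: root_gt0 y0 (funkP _ x1). Qed.

Lemma funk_ge0 x y : phi x < 1 -> 0 <= F x y.
Proof. by move=> x1; rewrite -funkP// phi_ge0. Qed.

Lemma funkZ x y a : phi x < 1 -> 0 < a -> F x (a *: y) = a * F x y.
Proof.
move=> x1 a0; apply: funk_unique => //.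
by rewrite -scalerA -scalerDr phiZ// funkP.
Qed.

Lemma funk_at0 y : F 0 y = phi y.
Proof.
apply: funk_unique; first by rewrite phi0.
by rewrite scaler0 addr0.
Qed.

Definition funkp p := F p.1 p.2.

(** F (x, y) times the boundary point reached from x in the direction y. *)
Definition exit_pt p : V := p.2 + F p.1 p.2 *: p.1.
Definition funk_dom : set W := [set p | phi p.1 < 1 /\ p.2 != 0].

Lemma open_funk_dom : open funk_dom.
Proof.
rewrite (_ : funk_dom = (fst @^-1` (Omega phi)) `&` (snd @^-1` V0)).
  apply: openI; apply: open_comp.
  - by move=> p _; exact: cvg_fst.
  - exact: open_Omega.
  - by move=> p _; exact: cvg_snd.
  - exact: open_neq0.
by [].
Qed.

Lemma phi_exit p : phi p.1 < 1 -> phi (exit_pt p) = funkp p.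
Proof. exact: funkP. Qed.

Lemma exit_neq0 p : funk_dom p -> exit_pt p != 0.
Proof.
move=> [x1 y0]; apply/eqP => z0; have := funk_gt0 x1 y0.
by rewrite -[F _ _]/(funkp p) -phi_exit// z0 phi0// ltxx.
Qed.

Lemma den_gt0 x z : phi x < 1 -> z != 0 -> 0 < 1 - 'D_x phi z.
Proof. by move=> x1 z0; rewrite subr_gt0 (le_lt_trans (fund_ineq hphi _ z0)). Qed.

(** The function s - phi (q.2 + s q.1) is increasing in s, continuous in q, and
changes sign between F p - e and F p + e; the root at a nearby q is trapped
there. *)
Lemma funkp_continuous p : funk_dom p -> {for p, continuous funkp}.
Proof.
move=> [x1 y0]; apply/cvgrPdist_lt => e e0.
(* F q is the zero of the increasing function s |-> k s q. *)
pose k s q := s - phi (q.2 + s *: q.1).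
have kc s : {for p, continuous (k s)}.
  apply: cvgB; first exact: cvg_cst.
  apply: (@cvg_comp _ _ _ (fun q : W => q.2 + s *: q.1) phi); last exact: phi_continuous.
  apply: cvgD; first exact: cvg_snd.
  by apply: cvgZl_tmp; exact: cvg_fst.
have kE q : phi q.1 < 1 -> k (funkp q) q = 0.
  by move=> q1; rewrite /k /funkp funkP// subrr.
have kmono q s s' : phi q.1 < 1 -> s <= s' ->
    (s' - s) * (1 - phi q.1) <= k s' q - k s q.
  by move=> q1; exact: funk_monotone.
have kp : 0 < k (funkp p + e) p.
  have := kmono p (funkp p) (funkp p + e) x1.
  rewrite kE// lerDl ltW// subr0 => /(_ isT); apply: lt_le_trans.
  by rewrite mulr_gt0 ?subr_gt0//; lra.
have km : k (funkp p - e) p < 0.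
  have := kmono p (funkp p - e) (funkp p) x1.
  rewrite kE// gerBl ltW// sub0r => /(_ isT).
  have : 0 < (funkp p - (funkp p - e)) * (1 - phi p.1).
    by rewrite mulr_gt0 ?subr_gt0//; lra.
  by lra.
near=> q.
have q1 : phi q.1 < 1.
  have [] : funk_dom q by near: q; apply: (nearA open_funk_dom).
  by [].
have q1' : 0 < 1 - phi q.1 by lra.
have H1 : 0 < k (funkp p + e) q by near: q; exact: (cvgr_gt _ (kc _) _ kp).
have H2 : k (funkp p - e) q < 0 by near: q; exact: (cvgr_lt _ (kc _) _ km).
rewrite ltr_distlC; apply/andP; split; rewrite ltNge; apply/negP => le.
- have := kmono q _ _ q1 le; rewrite kE//.
  have : 0 <= (funkp p - e - funkp q) * (1 - phi q.1) by rewrite mulr_ge0 ?subr_ge0// ltW.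
  rewrite subr0 => h1 h2; have := le_lt_trans (le_trans h1 h2) H2.
  by rewrite ltxx.
- have := kmono q _ _ q1 le; rewrite kE//.
  have : 0 <= (funkp q - (funkp p + e)) * (1 - phi q.1) by rewrite mulr_ge0 ?subr_ge0// ltW.
  rewrite sub0r => h1 h2; have := le_trans h1 h2.
  by rewrite oppr_ge0 leNgt H1.
Unshelve. all: by end_near. Qed.

Lemma continuous_cvg_line (g : W -> R) p w : {for p, continuous g} ->
  g (p + h *: w) @[h --> (0 : R)^'] --> g p.
Proof. by move=> gc; apply: (@cvg_comp _ _ _ (fun h : R => p + h *: w) g _ _ _ (@cvg_line _ _ p w)). Qed.

(** The increment of the exit point along (p + h w) split into multiples of three
fixed directions, the only moving coefficients being scalars: each piece is a
step of the chain rule. *)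
Lemma exit_line p w (h : R) :
  exit_pt (p + h *: w) = exit_pt p + (funkp (p + h *: w) - funkp p) *: p.1 + h *: w.2
    + (h * funkp (p + h *: w)) *: w.1.
Proof.
rewrite (_ : exit_pt (p + h *: w) =
  (p.2 + h *: w.2) + funkp (p + h *: w) *: (p.1 + h *: w.1))//.
rewrite (_ : exit_pt p = p.2 + funkp p *: p.1)//.
move: (funkp (p + h *: w)) (funkp p) => a b.
by apply/rowP => i; rewrite !mxE; ring.
Qed.

Section ThreeSteps.
Variables (f : V -> R) (p w : W).
Hypotheses (sf : smooth_on V0 f) (Dp : funk_dom p).
Let s (h : R) := funkp (p + h *: w).
Let dl (h : R) := s h - funkp p.
Let c2 (h : R) := exit_pt p + dl h *: p.1.
Let c3 (h : R) := c2 h + h *: w.2.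

Let cs : s h @[h --> (0 : R)^'] --> funkp p.
Proof. by apply: continuous_cvg_line; exact: funkp_continuous. Qed.

Let cdl : dl h @[h --> (0 : R)^'] --> (0 : R).
Proof. by rewrite -[X in _ --> X](subrr (funkp p)); exact: (cvgB cs (cvg_cst _)). Qed.

Let cc2 : c2 h @[h --> (0 : R)^'] --> exit_pt p.
Proof.
have : c2 h @[h --> (0 : R)^'] --> exit_pt p + 0 *: p.1.
  by apply: cvgD; [exact: cvg_cst|apply: cvgZr_tmp; exact: cdl].
by rewrite scale0r addr0.
Qed.

Let cc3 : c3 h @[h --> (0 : R)^'] --> exit_pt p.
Proof.
have : c3 h @[h --> (0 : R)^'] --> exit_pt p + 0 *: w.2.
  by apply: cvgD; [exact: cc2|apply: cvgZr_tmp; exact: (@cvg_dnbhs_id R)].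
by rewrite scale0r addr0.
Qed.

Let chs : (h^-1 * (h * s h)) @[h --> (0 : R)^'] --> funkp p.
Proof.
rewrite (_ : (fun h : R => h^-1 * (h * s h)) = (fun h => h^-1 * h * s h)).
  by rewrite -[X in _ --> X]mul1r; exact: (cvgM (@cvg_dnbhs_ratio R) cs).
by apply/funext => h; rewrite mulrA.
Qed.

Let exit_slope (h : R) := slope f p.1 (exit_pt p) (exit_pt p, dl h).

Lemma exit_increment (h : R) : f (exit_pt (p + h *: w)) - f (exit_pt p) =
  dl h * exit_slope h + (f (c3 h) - f (c2 h)) +
   (f (c3 h + (h * s h) *: w.1) - f (c3 h)).
Proof. by rewrite /exit_slope -slopeE exit_line -/(s h) -/(dl h) -/(c2 h) -/(c3 h); ring. Qed.

Lemma exit_slope_cvg : exit_slope h @[h --> (0 : R)^'] --> 'D_(p.1) f (exit_pt p).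
Proof.
apply: (@cvg_comp _ _ _ (fun h => (exit_pt p, dl h)) (slope f p.1 (exit_pt p))); last first.
  by apply: (smooth_slope_cvg (open_neq0 (n := n)) sf); exact: exit_neq0.
exact: (cvg_pair (cvg_cst _) cdl).
Qed.

Lemma exit_rest_cvg :
  (h^-1 * (f (c3 h) - f (c2 h)) + h^-1 * (f (c3 h + (h * s h) *: w.1) - f (c3 h)))
    @[h --> (0 : R)^'] --> 'D_(w.2) f (exit_pt p) + funkp p * 'D_(w.1) f (exit_pt p).
Proof.
have z0 := exit_neq0 Dp.
have s1 := smooth_step (open_neq0 (n := n)) (w := w.2) sf z0 cc2 (@cvg_dnbhs_ratio R).
have s2 := smooth_step (open_neq0 (n := n)) (w := w.1) sf z0 cc3 chs.
rewrite mul1r in s1; exact: cvgD s1 s2.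
Qed.

Lemma exit_chain (l : R) : (h^-1 * dl h) @[h --> (0 : R)^'] --> l ->
  (h^-1 * (f (exit_pt (p + h *: w)) - f (exit_pt p))) @[h --> (0 : R)^'] -->
  l * 'D_(p.1) f (exit_pt p) + ('D_(w.2) f (exit_pt p) + funkp p * 'D_(w.1) f (exit_pt p)).
Proof.
move=> cl; rewrite (_ : (fun h => _) = (fun h => h^-1 * dl h * exit_slope h +
  (h^-1 * (f (c3 h) - f (c2 h)) + h^-1 * (f (c3 h + (h * s h) *: w.1) - f (c3 h))))).
  by apply: cvgD; [exact: (cvgM cl exit_slope_cvg)|exact: exit_rest_cvg].
by apply/funext => h; rewrite exit_increment; ring.
Qed.

End ThreeSteps.

Lemma derive_of_cvg (g : W -> R) p w (l : R) :
  (h^-1 * (g (p + h *: w) - g p)) @[h --> (0 : R)^'] --> l ->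
  is_derive p w g l.
Proof.
move=> cl; have E : (fun h : R => h^-1 *: ((g \o shift p) (h *: w) - g p)) =
  (fun h : R => h^-1 * (g (p + h *: w) - g p)).
  by apply/funext => h; rewrite /shift /= [p + _]addrC.
apply: DeriveDef; first by rewrite /derivable E; apply: cvgP cl.
by rewrite /derive E; exact: cvg_lim.
Qed.

Lemma solve_increment (h d m b c : R) : 1 - m != 0 -> d = d * m + b + c ->
  (h^-1 * b + h^-1 * c) * (1 - m)^-1 = h^-1 * d.
Proof.
move=> m0 E; apply: (mulIf m0); rewrite divfK// -mulrDr -mulrA; congr (_ * _).
by rewrite mulrBr mulr1 {1}E; ring.
Qed.

(** The value forced on the derivative of F at p along w by differentiating
F = phi (exit point). *)
Definition dfunk p w : R :=
  ('D_(w.2) phi (exit_pt p) + funkp p * 'D_(w.1) phi (exit_pt p)) / (1 - 'D_(p.1) phi (exit_pt p)).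

(** The increment of F equals that of phi at the exit point, whose first piece is
again a multiple of the increment of F, with coefficient tending to
D_x phi < 1; solving for the increment and passing to the limit gives both
differentiability and the derivative. *)
Lemma funkp_ratio p w : funk_dom p ->
  (h^-1 * (funkp (p + h *: w) - funkp p)) @[h --> (0 : R)^'] --> dfunk p w.
Proof.
move=> Dp; have sphi := phi_smooth hphi.
have dp : 0 < 1 - 'D_(p.1) phi (exit_pt p).
  by apply: den_gt0; [case: Dp|exact: exit_neq0].
have c1 := @exit_slope_cvg phi p w sphi Dp.
have c2 := @exit_rest_cvg phi p w sphi Dp.
have c3 : (1 - slope phi p.1 (exit_pt p) (exit_pt p, funkp (p + h *: w) - funkp p))
   @[h --> (0 : R)^'] --> 1 - 'D_(p.1) phi (exit_pt p).
  by apply: cvgB => //; exact: cvg_cst.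
have nD : \forall h \near (0 : R)^', funk_dom (p + h *: w).
  exact: ((@cvg_line R _ p w) _ (nearA open_funk_dom Dp)).
apply: cvg_trans (cvgM c2 (cvgV (lt0r_neq0 dp) c3)); apply: near_eq_cvg.
near=> h.
have h0 : h != 0 by near: h; exact: nbhs_dnbhs_neq.
have Dh : funk_dom (p + h *: w).
  by near: h; exact: nD.
have mh : 0 < 1 - slope phi p.1 (exit_pt p) (exit_pt p, funkp (p + h *: w) - funkp p).
  by near: h; exact: (cvgr_gt _ c3 _ dp).
have := @exit_increment phi p w h.
rewrite !phi_exit; [|by case: Dp|by case: Dh].
by move=> E; exact: (solve_increment h (lt0r_neq0 mh) E).
Unshelve. all: by end_near. Qed.

Lemma is_derive_funkp p w : funk_dom p -> is_derive p w funkp (dfunk p w).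
Proof. by move=> Dp; apply: derive_of_cvg; exact: funkp_ratio. Qed.

Lemma is_derive_exit (f : V -> R) p w : smooth_on V0 f -> funk_dom p ->
  is_derive p w (f \o exit_pt) (dfunk p w * 'D_(p.1) f (exit_pt p) +
    ('D_(w.2) f (exit_pt p) + funkp p * 'D_(w.1) f (exit_pt p))).
Proof.
move=> sf Dp; apply: derive_of_cvg; apply: (exit_chain sf Dp); exact: funkp_ratio.
Qed.

End Funk.

(** * Lagrange inversion for polynomials, with explicit bounds *)

Section PolyNorm.
Variable R : realType.
Implicit Types (p q h : {poly R}) (r s t : R).

(** The weighted l^1 norm, submultiplicative and dominating the values on the
disc of radius r; it takes the place of the supremum norm of complex
analysis. *)
Definition pnorm r p : R := \sum_(i < size p) `|p`_i| * r ^+ i.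

Lemma pnormE r p k : (size p <= k)%N -> pnorm r p = \sum_(i < k) `|p`_i| * r ^+ i.
Proof.
move=> pk; rewrite /pnorm (big_ord_widen _ (fun i => `|p`_i| * r ^+ i) pk) big_mkcond /=.
apply: eq_bigr => i _; case: ltnP => // pi.
by rewrite (nth_default 0 pi) normr0 mul0r.
Qed.

Lemma pnorm_ge0 r p : 0 <= r -> 0 <= pnorm r p.
Proof. by move=> r0; apply: sumr_ge0 => i _; rewrite mulr_ge0 ?exprn_ge0. Qed.

Lemma pnorm0 r : pnorm r 0 = 0.
Proof. by rewrite /pnorm size_poly0 big_ord0. Qed.

Lemma pnorm_cons r p c : pnorm r (p * 'X + c%:P) = pnorm r p * r + `|c|.
Proof.
have sz : (size (p * 'X + c%:P)%R <= (size p).+1)%N.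
  apply: leq_trans (size_polyD _ _) _; rewrite geq_max (leq_trans (size_polyC_leq1 _))// andbT.
  by case: (eqVneq p 0) => [->|p0]; rewrite ?mul0r ?size_poly0// size_mulX.
rewrite (pnormE r sz) big_ord_recl /= expr0 mulr1 coefD coefMX coefC /= add0r addrC.
congr (_ + _); rewrite /pnorm mulr_suml; apply: eq_bigr => i _.
by rewrite coefD coefMX coefC /= addr0 exprSr mulrA.
Qed.

Lemma pnormC r c : pnorm r c%:P = `|c|.
Proof. by rewrite -[c%:P]add0r -(mul0r 'X) pnorm_cons pnorm0 mul0r add0r. Qed.

Lemma pnormMX r p : pnorm r (p * 'X) = pnorm r p * r.
Proof. by rewrite -[p * 'X]addr0 -polyC0 pnorm_cons normr0 addr0. Qed.

Lemma pnorm1 r : pnorm r 1 = 1.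
Proof. by rewrite pnormC normr1. Qed.

Lemma pnormX r : pnorm r 'X = r.
Proof. by rewrite -['X]mul1r pnormMX pnorm1 mul1r. Qed.

Lemma pnorm_coef r p k : 0 <= r -> `|p`_k| * r ^+ k <= pnorm r p.
Proof.
move=> r0; rewrite (@pnormE r p (maxn (size p) k.+1)) ?leq_maxl//.
have kk : (k < maxn (size p) k.+1)%N by rewrite leq_max ltnSn orbT.
rewrite (bigD1 (Ordinal kk))//= lerDl.
by apply: sumr_ge0 => i _; rewrite mulr_ge0 ?exprn_ge0.
Qed.

Lemma pnormD r p q : 0 <= r -> pnorm r (p + q) <= pnorm r p + pnorm r q.
Proof.
move=> r0; set k := maxn (size p) (size q).
rewrite (@pnormE r p k) ?leq_maxl// (@pnormE r q k) ?leq_maxr//.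
rewrite (@pnormE r (p + q) k) ?size_polyD// -big_split /=.
by apply: ler_sum => i _; rewrite coefD -mulrDl ler_wpM2r ?exprn_ge0 ?ler_normD.
Qed.

Lemma pnorm_scale r a p : pnorm r (a *: p) = `|a| * pnorm r p.
Proof.
rewrite (@pnormE r (a *: p) (size p)) ?size_scale_leq// mulr_sumr.
by apply: eq_bigr => i _; rewrite coefZ normrM mulrA.
Qed.

Lemma pnormN r p : pnorm r (- p) = pnorm r p.
Proof. by rewrite -scaleN1r pnorm_scale normrN1 mul1r. Qed.

Lemma pnormM r p q : 0 <= r -> pnorm r (p * q) <= pnorm r p * pnorm r q.
Proof.
move=> r0; elim/poly_ind: p => [|p c IH]; first by rewrite mul0r pnorm0 mul0r.
rewrite mulrDl mulrAC (le_trans (pnormD _ _ r0))// pnormMX mul_polyC pnorm_scale.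
by rewrite pnorm_cons mulrDl lerD2r [leRHS]mulrAC ler_wpM2r.
Qed.

Lemma pnorm_exp r p m : 0 <= r -> pnorm r (p ^+ m) <= pnorm r p ^+ m.
Proof.
move=> r0; elim: m => [|m IH]; first by rewrite !expr0 pnorm1.
by rewrite !exprS (le_trans (pnormM _ _ r0))// ler_wpM2l ?pnorm_ge0.
Qed.

Lemma pnorm_sum r (I : Type) (s : seq I) (P : pred I) (F : I -> {poly R}) : 0 <= r ->
  pnorm r (\sum_(i <- s | P i) F i) <= \sum_(i <- s | P i) pnorm r (F i).
Proof.
move=> r0; elim/big_ind2 : _ => [|a b c d ab cd|//]; first by rewrite pnorm0.
by apply: le_trans (pnormD _ _ r0) _; exact: lerD.
Qed.

Lemma pnorm_horner r p t : `|t| <= r -> `|p.[t]| <= pnorm r p.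
Proof.
move=> tr; rewrite horner_coef (le_trans (ler_norm_sum _ _ _))//.
by apply: ler_sum => i _; rewrite normrM normrX ler_wpM2l// lerXn2r ?nnegrE// (le_trans _ tr).
Qed.

Lemma pnorm_le r s p : 0 <= r -> r <= s -> pnorm r p <= pnorm s p.
Proof.
move=> r0 rs; apply: ler_sum => i _; rewrite ler_wpM2l// lerXn2r ?nnegrE//.
exact: le_trans rs.
Qed.

Lemma pnorm_deriv r p : 0 <= r -> r * pnorm r p^`() <= pnorm (2 * r) p.
Proof.
move=> r0; elim/poly_ind: p => [|p c IH]; first by rewrite deriv0 !pnorm0 mulr0.
rewrite derivD derivC addr0 derivM derivX mulr1 pnorm_cons.
have h1 := pnormD (p^`() * 'X) p r0; rewrite pnormMX in h1.
have h2 : pnorm r p <= pnorm (2 * r) p by apply: pnorm_le => //; lra.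
have := ler_wpM2l r0 h1; have := ler_wpM2r r0 IH; have := ler_wpM2r r0 h2.
by have := normr_ge0 c; lra.
Qed.

(** The quotient by X - t of p - p(t) is bounded by the gap between the norms at
r and at |t|, by induction on p with Horner's rule. *)
Lemma poly_divided_difference r p t : `|t| <= r ->
  exists2 q, p - p.[t]%:P = ('X - t%:P) * q &
    (r - `|t|) * pnorm r q <= pnorm r p - pnorm `|t| p.
Proof.
move=> tr; elim/poly_ind: p => [|p c [q pE qN]].
  by exists 0; rewrite ?hornerC ?polyC0 ?mulr0 ?subr0// !pnorm0 mulr0 subr0.
exists (q * 'X + p.[t]%:P).
  rewrite hornerD hornerMX hornerC mulrDr mulrA -pE polyCD polyCM; ring.
rewrite !pnorm_cons.
have r0 : 0 <= r by apply: le_trans tr.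
have pt := pnorm_horner p (lexx `|t|).
have h1 := ler_wpM2r r0 qN.
have tr' : 0 <= r - `|t| by rewrite subr_ge0.
have h2 := ler_wpM2l tr' pt.
by lra.
Qed.

End PolyNorm.

Section Lagrange.
Variable R : realType.
Variables (r : R).
Hypothesis r0 : 0 < r.
Let r0' : 0 <= r := ltW r0.
Implicit Types (p q h v : {poly R}).

(** The partial sum at 1 of Lagrange's series.  When p is small it sums to the
residue h(t) / (1 - p'(t)) at the small fixed point t of p. *)
Definition lagr_sum p h K : R := \sum_(m < K) (p ^+ m * h)`_m.

Lemma lagrD p h h' K : lagr_sum p (h + h') K = lagr_sum p h K + lagr_sum p h' K.
Proof. by rewrite /lagr_sum -big_split; apply: eq_bigr => i _; rewrite mulrDr coefD. Qed.

Lemma lagrZ p a h K : lagr_sum p (a *: h) K = a * lagr_sum p h K.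
Proof. by rewrite /lagr_sum mulr_sumr; apply: eq_bigr => i _; rewrite -scalerAr coefZ. Qed.

Lemma lagrB p h h' K : lagr_sum p (h - h') K = lagr_sum p h K - lagr_sum p h' K.
Proof. by rewrite lagrD -scaleN1r lagrZ mulN1r. Qed.

Section Bounds.
Variable p : {poly R}.
Hypothesis pN : pnorm r p <= r / 4.

Lemma pnorm_pow h m : pnorm r (p ^+ m * h) <= (r / 4) ^+ m * pnorm r h.
Proof.
rewrite (le_trans (pnormM _ _ r0'))// ler_wpM2r ?pnorm_ge0//.
rewrite (le_trans (pnorm_exp _ _ r0'))// lerXn2r ?nnegrE ?pnorm_ge0//.
by rewrite divr_ge0.
Qed.

Lemma lagr_coef h m : `|(p ^+ m * h)`_m| <= 4^-1 ^+ m * pnorm r h.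
Proof.
have rm : 0 < r ^+ m by rewrite exprn_gt0.
rewrite -(ler_pM2r rm) (le_trans (pnorm_coef _ m r0'))// (le_trans (pnorm_pow h m))//.
by rewrite exprMn le_eqVlt; apply/orP; left; apply/eqP; ring.
Qed.

Lemma geometric_sum4 K : \sum_(m < K) (4^-1 : R) ^+ m <= 2.
Proof.
suff h : \sum_(m < K) (4^-1 : R) ^+ m <= 2 - 2 * 4^-1 ^+ K.
  by apply: le_trans h _; rewrite gerBl mulr_ge0// exprn_ge0.
elim: K => [|K IH]; first by rewrite big_ord0 expr0; lra.
rewrite big_ord_recr /= exprSr; have : 0 <= (4^-1 : R) ^+ K by rewrite exprn_ge0.
move: IH; set x := _ ^+ K; set S := \sum_(_ < _) _; clearbody S x => *; lra.
Qed.

Lemma lagr_bound h K : `|lagr_sum p h K| <= 2 * pnorm r h.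
Proof.
rewrite (le_trans (ler_norm_sum _ _ _))//.
apply: (@le_trans _ _ (\sum_(m < K) 4^-1 ^+ m * pnorm r h)).
  by apply: ler_sum => m _; exact: lagr_coef.
by rewrite -mulr_suml ler_wpM2r ?pnorm_ge0// geometric_sum4.
Qed.

(** Multiples of X - p contribute only the last term, because the sum telescopes:
formally, X = p at the fixed point. *)
Lemma lagr_shift h K : lagr_sum p (('X - p) * h) K.+1 = - (p ^+ K.+1 * h)`_K.
Proof.
elim: K => [|K IH].
  by rewrite /lagr_sum big_ord1 expr0 mul1r expr1 mulrBl coefB mulrC coefMX sub0r.
rewrite {1}/lagr_sum big_ord_recr /= -/(lagr_sum p (('X - p) * h) K.+1) IH.
rewrite (_ : p ^+ K.+1 * (('X - p) * h) = p ^+ K.+1 * h * 'X - p ^+ K.+2 * h).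
  by rewrite coefB coefMX /= addrA addNr add0r.
by rewrite [p ^+ K.+2]exprSr; ring.
Qed.

Lemma lagr_shift_bound h K : `|lagr_sum p (('X - p) * h) K| <= r * 4^-1 ^+ K * pnorm r h.
Proof.
case: K => [|K].
  by rewrite /lagr_sum big_ord0 normr0 expr0 mulr1 mulr_ge0 ?pnorm_ge0.
rewrite lagr_shift normrN; have rK : 0 < r ^+ K by rewrite exprn_gt0.
rewrite -(ler_pM2r rK) (le_trans (pnorm_coef _ K r0'))// (le_trans (pnorm_pow h K.+1))//.
by rewrite exprMn exprS; set x := r ^+ K; set y := _ ^+ K.+1; rewrite le_eqVlt; apply/orP; left; apply/eqP; ring.
Qed.

(** The t^K-coefficient of p^K p' and the t^(K+1)-coefficient of p^(K+1) agree, as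
one sees by differentiating p^(K+1); thus 1 - p' telescopes too.  This
calibrates the residue. *)
Lemma lagr_deriv K : lagr_sum p (1 - p^`()) K = 1 - (p ^+ K)`_K.
Proof.
elim: K => [|K IH]; first by rewrite /lagr_sum big_ord0 expr0 coef1 subrr.
rewrite {1}/lagr_sum big_ord_recr /= -/(lagr_sum p (1 - p^`()) K) IH.
rewrite mulrBr mulr1 coefB.
suff -> : (p ^+ K * p^`())`_K = (p ^+ K.+1)`_K.+1 by rewrite addrA subrK.
have := congr1 (fun q : {poly R} => q`_K) (deriv_exp p K.+1).
rewrite coef_deriv coefMn /= => /eqP; rewrite eqrMn2r => /eqP ->.
by rewrite mulrC.
Qed.

Section Root.
Variable t : R.
Hypothesis tr : `|t| <= r / 2.
Let e := t - p.[t].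

Lemma t_le_r : `|t| <= r. Proof. by apply: le_trans tr _; have := r0; lra. Qed.

Lemma half_le_gap : r / 2 <= r - `|t|.
Proof. by rewrite lerBrDr addrC -lerBrDr (_ : r - r / 2 = r / 2)//; lra. Qed.

Lemma diff_quotient_norm h q : (r - `|t|) * pnorm r q <= pnorm r h - pnorm `|t| h ->
  pnorm r q <= 2 / r * pnorm r h.
Proof.
move=> hq; have h0 := pnorm_ge0 h (normr_ge0 t).
have q0 := pnorm_ge0 q r0'.
have h1 : r / 2 * pnorm r q <= pnorm r h.
  apply: le_trans (_ : (r - `|t|) * pnorm r q <= _); last by lra.
  by rewrite ler_wpM2r// half_le_gap.
have rN : 0 < 2 / r by rewrite divr_gt0.
have := ler_wpM2l (ltW rN) h1.
by rewrite mulrA (_ : 2 / r * (r / 2) = 1) ?mul1r//; field; rewrite gt_eqF.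
Qed.

(** Write (X - t) q = (X - t) v q + (X - p) q - e q, where v is the divided
difference of p at t.  The middle term telescopes and the first is of the same
form with q replaced by v q, of half the norm.  Iterating j times makes the
remaining trivial bound as small as desired. *)
Lemma lagr_root_iter K j q :
  `|lagr_sum p (('X - t%:P) * q) K| <=
  (2^-1 ^+ j * (3 * r) + 2 * (r * 4^-1 ^+ K + 2 * `|e|)) * pnorm r q.
Proof.
set B := r * 4^-1 ^+ K + 2 * `|e|.
have B0 : 0 <= B by rewrite addr_ge0 ?mulr_ge0// exprn_ge0.
elim: j q => [|j IH] q; have q0 := pnorm_ge0 q r0'.
  rewrite expr0 mul1r (le_trans (lagr_bound _ _))//.
  apply: (@le_trans _ _ (2 * ((r + `|t|) * pnorm r q))).
    rewrite ler_wpM2l// (le_trans (pnormM _ _ r0'))// ler_wpM2r//.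
    by rewrite (le_trans (pnormD _ _ r0'))// pnormN pnormX pnormC.
  rewrite mulrA ler_wpM2r//; have := tr; lra.
have [v vE vN] := poly_divided_difference p t_le_r.
have vN' : pnorm r v <= 2^-1.
  have := diff_quotient_norm vN; have := ler_wpM2l (ltW (divr_gt0 (ltr0Sn R 1) r0)) pN.
  by rewrite (_ : 2 / r * (r / 4) = 2^-1); [lra|field; rewrite gt_eqF].
have qE : ('X - t%:P) * q = ('X - t%:P) * (v * q) + ('X - p) * q - e *: q.
  rewrite mulrA -vE -mul_polyC /e polyCB; ring.
rewrite qE lagrB lagrD lagrZ.
have h1 := IH (v * q); have h2 := lagr_shift_bound q K; have h3 := lagr_bound q K.
have h4 : pnorm r (v * q) <= 2^-1 * pnorm r q.
  by rewrite (le_trans (pnormM _ _ r0'))// ler_wpM2r.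
have S0 : 0 <= 2^-1 ^+ j * (3 * r) + 2 * B.
  by rewrite addr_ge0 ?mulr_ge0// exprn_ge0.
have h5 := ler_wpM2l S0 h4.
have h6 := ler_wpM2l (normr_ge0 e) h3.
rewrite (le_trans (ler_normB _ _))// normrM.
apply: (@le_trans _ _ (`|lagr_sum p (('X - t%:P) * (v * q)) K| + `|lagr_sum p (('X - p) * q) K| + `|e| * `|lagr_sum p q K|)).
  by rewrite lerD2r ler_normD.
have E : (2^-1 ^+ j.+1 * (3 * r) + 2 * B) * pnorm r q =
  (2^-1 ^+ j * (3 * r) + 2 * B) * (2^-1 * pnorm r q) + B * pnorm r q.
  by rewrite exprS; field.
rewrite E -addrA; apply: lerD; first exact: (le_trans h1 h5).
have -> : B * pnorm r q = r * 4^-1 ^+ K * pnorm r q + `|e| * (2 * pnorm r q).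
  by rewrite /B; ring.
exact: lerD h2 h6.
Qed.

Lemma lagr_root_bound K q :
  `|lagr_sum p (('X - t%:P) * q) K| <= 2 * (r * 4^-1 ^+ K + 2 * `|e|) * pnorm r q.
Proof.
set X := `|lagr_sum _ _ _|; set B := 2 * _; have q0 := pnorm_ge0 q r0'.
have H j : X <= (2^-1 ^+ j * (3 * r) + B) * pnorm r q by exact: lagr_root_iter.
have c : ((2^-1 ^+ j * (3 * r) + B) * pnorm r q) @[j --> \oo] --> ((0 * (3 * r) + B) * pnorm r q).
  apply: cvgM; last exact: cvg_cst.
  apply: cvgD; last exact: cvg_cst.
  apply: cvgM; last exact: cvg_cst.
  by apply: cvg_expr; rewrite ger0_norm ?invf_lt1 ?ltr1n.
rewrite mul0r add0r in c.
by apply: (ler_cvg_to (cvg_cst X) c); apply: nearW.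
Qed.

(** Modulo multiples of X - t, the polynomial h is the constant h(t). *)
Lemma lagr_eval h K : `|lagr_sum p h K - h.[t] * lagr_sum p 1 K| <=
  4 * (4^-1 ^+ K + 2 / r * `|e|) * pnorm r h.
Proof.
have [q qE qN] := poly_divided_difference h t_le_r.
have {1}-> : h = ('X - t%:P) * q + h.[t] *: 1 by rewrite -qE alg_polyC subrK.
rewrite lagrD lagrZ addrK (le_trans (lagr_root_bound K q))//.
have B0 : 0 <= 2 * (r * 4^-1 ^+ K + 2 * `|e|).
  by rewrite !(mulr_ge0, addr_ge0)// exprn_ge0.
have := ler_wpM2l B0 (diff_quotient_norm qN); move=> H; apply: le_trans H _.
rewrite le_eqVlt; apply/orP; left; apply/eqP.
by field; rewrite gt_eqF.
Qed.

(** The sum for h is close to h(t) times the sum S for 1; taking 1 - p' for h, whose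
sum is close to 1, shows that S is close to 1 / (1 - p'(t)).  The point t is not
required to be an exact fixed point: the defect enters the error term, which
allows p to be a truncation of the function whose fixed point is t. *)
Lemma lagrange_inversion h K (D C : R) : pnorm r p^`() <= D -> pnorm r h <= C ->
  `|(1 - p^`().[t]) * lagr_sum p h K - h.[t]| <=
  C * (5 + 8 * D) * (1 + 2 / r) * (4^-1 ^+ K + `|e|).
Proof.
move=> pD hC; set b := 4^-1 ^+ K; set a := `|e|.
have b0 : 0 <= b by rewrite exprn_ge0.
have a0 : 0 <= a by exact: normr_ge0.
have D0 : 0 <= D := le_trans (pnorm_ge0 _ r0') pD.
have C0 : 0 <= C := le_trans (pnorm_ge0 _ r0') hC.
set l1 := lagr_sum p 1 K; set lh := lagr_sum p h K; set ld := lagr_sum p p^`() K.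
set dt := p^`().[t]; set ht := h.[t].
set k := 2 / r; have k0 : 0 <= k by rewrite divr_ge0.
set M := (1 + k) * (b + a).
have M0 : 0 <= M by rewrite mulr_ge0 ?addr_ge0.
have bM : b + k * a <= M by rewrite /M; have := mulr_ge0 k0 b0; lra.
have bM' : b <= M by have := mulr_ge0 k0 a0; lra.
have k4 : 4 * (b + k * a) <= 4 * M by rewrite ler_pM2l.
have k40 : 0 <= 4 * (b + k * a) by rewrite mulr_ge0// addr_ge0// mulr_ge0.
have eh : `|lh - ht * l1| <= 4 * M * C.
  apply: le_trans (lagr_eval h K) _; rewrite -/a -/b -/k.
  by apply: ler_pM => //; exact: pnorm_ge0.
have ed : `|ld - dt * l1| <= 4 * M * D.
  apply: le_trans (lagr_eval p^`() K) _; rewrite -/a -/b -/k.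
  by apply: ler_pM => //; exact: pnorm_ge0.
have e1 : l1 - ld = 1 - (p ^+ K)`_K by rewrite -lagrB lagr_deriv.
have e2 : `|(p ^+ K)`_K| <= M.
  apply: le_trans bM'; have := lagr_coef 1 K; by rewrite mulr1 pnorm1 mulr1.
have ht' : `|ht| <= C := le_trans (pnorm_horner h t_le_r) hC.
have dt' : `|dt| <= D := le_trans (pnorm_horner _ t_le_r) pD.
have -> : (1 - dt) * lh - ht = (1 - dt) * (lh - ht * l1) + ht * (ld - dt * l1) + ht * (- (p ^+ K)`_K).
  have -> : (p ^+ K)`_K = 1 - (l1 - ld) by rewrite e1 subKr.
  by ring.
have f1 : `|(1 - dt) * (lh - ht * l1)| <= (1 + D) * (4 * M * C).
  rewrite normrM ler_pM//; apply: le_trans (ler_normB _ _) _.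
  by rewrite normr1 lerD2l.
have f2 : `|ht * (ld - dt * l1)| <= C * (4 * M * D) by rewrite normrM ler_pM.
have f3 : `|ht * (- (p ^+ K)`_K)| <= C * M by rewrite normrM normrN ler_pM.
have -> : C * (5 + 8 * D) * (1 + k) * (b + a) =
  (1 + D) * (4 * M * C) + C * (4 * M * D) + C * M by rewrite /M; ring.
by apply: le_trans (ler_normD _ _) _; apply: lerD => //; apply: le_trans (ler_normD _ _) _; exact: lerD.
Qed.

(** The error of the difference quotient is controlled by a second divided
difference, with a bound depending on p through its norm only; so derivatives
of a convergent sequence of such polynomials converge. *)
Lemma deriv_diff_quotient s : `|s| <= r ->
  `|p.[s] - p.[t] - (s - t) * p^`().[t]| <= (s - t) ^+ 2 / r.
Proof.
move=> sr; have [v vE vN] := poly_divided_difference p t_le_r.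
have vN' : pnorm r v <= 2^-1.
  have := diff_quotient_norm vN; have := ler_wpM2l (ltW (divr_gt0 (ltr0Sn R 1) r0)) pN.
  by rewrite (_ : 2 / r * (r / 4) = 2^-1); [lra|field; rewrite gt_eqF].
have [w wE wN] := poly_divided_difference v t_le_r.
have wN' : pnorm r w <= r^-1.
  have := diff_quotient_norm wN; have := ler_wpM2l (ltW (divr_gt0 (ltr0Sn R 1) r0)) vN'.
  by rewrite (_ : 2 / r * 2^-1 = r^-1); [lra|field; rewrite gt_eqF].
have pE u : p.[u] - p.[t] = (u - t) * v.[u].
  by have := congr1 (horner^~ u) vE; rewrite !hornerE.
have vsE : v.[s] - v.[t] = (s - t) * w.[s].
  by have := congr1 (horner^~ s) wE; rewrite !hornerE.
have -> : p^`().[t] = v.[t].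
  have := congr1 (fun q : {poly R} => q^`().[t]) vE.
  rewrite derivB derivC subr0 derivM derivXsubC mul1r => ->.
  by rewrite hornerD hornerM hornerXsubC subrr mul0r addr0.
rewrite pE -mulrBr vsE mulrA -expr2 normrM ger0_norm ?sqr_ge0// ler_wpM2l ?sqr_ge0//.
exact: le_trans (pnorm_horner _ sr) wN'.
Qed.

End Root.
End Bounds.
End Lagrange.

(** * Passage to the limit and power series in one variable *)

Section LagrangeLimit.
Variables (R : realType) (r C : R) (P H : nat -> {poly R}).
Hypotheses (r0 : 0 < r) (HP : forall N, pnorm (2 * r) (P N) <= r / 4)
  (HH : forall N, pnorm r (H N) <= C).
Let r0' : 0 <= r := ltW r0.

(** Coefficientwise convergence, enough for Lagrange's coefficients since each of
them involves finitely many coefficients of P and H. *)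
Definition coef_cvg (Q : nat -> {poly R}) := forall k, cvgn (fun N => (Q N)`_k).

Lemma coef_cvgM (Q S : nat -> {poly R}) : coef_cvg Q -> coef_cvg S ->
  coef_cvg (fun N => Q N * S N).
Proof.
move=> cQ cS k; under eq_fun do rewrite coefM.
rewrite (_ : (fun N => _) = \sum_(j < k.+1) (fun N => (Q N)`_j * (S N)`_(k - j))).
  apply: (big_ind (fun u : nat -> R => cvgn u)); first exact: is_cvg_cst.
  - by move=> u v; exact: is_cvgD.
  - by move=> j _; apply: is_cvgM; [exact: cQ|exact: cS].
by apply/funext => N; rewrite fct_sumE.
Qed.

Lemma coef_cvg_exp (Q : nat -> {poly R}) m : coef_cvg Q -> coef_cvg (fun N => Q N ^+ m).
Proof.
move=> cQ; elim: m => [|m IH]; last first.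
  by under eq_fun do rewrite exprS; exact: coef_cvgM.
move=> k; rewrite (_ : (fun N => _) = cst ((1 : {poly R})`_k)); first exact: is_cvg_cst.
by apply/funext => N; rewrite expr0.
Qed.

Hypotheses (cP : coef_cvg P) (cH : coef_cvg H).

Definition lagr_term m : R := limn (fun N => (P N ^+ m * H N)`_m).

Lemma lagr_term_cvg m : (P N ^+ m * H N)`_m @[N --> \oo] --> lagr_term m.
Proof. exact: (coef_cvgM (coef_cvg_exp cP) cH). Qed.

Lemma pnorm_P N : pnorm r (P N) <= r / 4.
Proof. by apply: le_trans (HP N); apply: pnorm_le => //; have := r0; lra. Qed.

Lemma pnorm_derivP N : pnorm r (P N)^`() <= 4^-1.
Proof.
have := le_trans (pnorm_deriv (P N) r0') (HP N).
by rewrite -[r / 4]/(r * 4^-1) ler_pM2l.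
Qed.

Lemma lagr_term_bound m : `|lagr_term m| <= C * 4^-1 ^+ m.
Proof.
have c : `|(P N ^+ m * H N)`_m| @[N --> \oo] --> `|lagr_term m|.
  by apply: cvg_norm; exact: lagr_term_cvg.
apply: (ler_cvg_to c (cvg_cst (C * 4^-1 ^+ m))); apply: nearW => N.
apply: le_trans (lagr_coef r0 (pnorm_P N) (H N) m) _.
by rewrite mulrC ler_wpM2r ?exprn_ge0.
Qed.

Lemma lagr_term_partial (eps t ft d g : R) K : `|eps| <= 1 -> `|t| <= r / 2 ->
  (P N).[t] @[N --> \oo] --> ft -> eps * ft = t ->
  (P N)^`().[t] @[N --> \oo] --> d -> (H N).[t] @[N --> \oo] --> g ->
  `|(1 - eps * d) * \sum_(m < K) lagr_term m * eps ^+ m - g| <=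
  C * (5 + 8 * 4^-1) * (1 + 2 / r) * 4^-1 ^+ K.
Proof.
move=> e1 tr cf ft_t cd cg.
have bound N : `|(1 - eps * (P N)^`().[t]) * \sum_(m < K) (P N ^+ m * H N)`_m * eps ^+ m - (H N).[t]|
    <= C * (5 + 8 * 4^-1) * (1 + 2 / r) * (4^-1 ^+ K + `|t - eps * (P N).[t]|).
  have pN : pnorm r (eps *: P N) <= r / 4.
    rewrite pnorm_scale (le_trans _ (pnorm_P N))// -[leRHS]mul1r ler_wpM2r//.
    exact: pnorm_ge0.
  have pD : pnorm r (eps *: P N)^`() <= 4^-1.
    rewrite derivZ pnorm_scale (le_trans _ (pnorm_derivP N))// -[leRHS]mul1r ler_wpM2r//.
    exact: pnorm_ge0.
  have := lagrange_inversion r0 pN tr K pD (HH N).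
  rewrite derivZ !hornerZ (_ : lagr_sum _ _ _ = \sum_(m < K) (P N ^+ m * H N)`_m * eps ^+ m)//.
  by apply: eq_bigr => m _; rewrite exprZn -scalerAl coefZ mulrC.
have cL : (`|(1 - eps * (P N)^`().[t]) * \sum_(m < K) (P N ^+ m * H N)`_m * eps ^+ m - (H N).[t]|)
    @[N --> \oo] --> `|(1 - eps * d) * \sum_(m < K) lagr_term m * eps ^+ m - g|.
  apply: cvg_norm; apply: cvgB => //; apply: cvgM.
    apply: cvgB; first exact: cvg_cst.
    by apply: cvgM; [exact: cvg_cst|exact: cd].
  apply: cvg_sum_seq => m.
  by apply: cvgM; [exact: lagr_term_cvg|exact: cvg_cst].
have cR : (C * (5 + 8 * 4^-1) * (1 + 2 / r) * (4^-1 ^+ K + `|t - eps * (P N).[t]|))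
    @[N --> \oo] --> C * (5 + 8 * 4^-1) * (1 + 2 / r) * (4^-1 ^+ K + `|t - eps * ft|).
  apply: cvgM; first exact: cvg_cst.
  apply: cvgD; first exact: cvg_cst.
  apply: cvg_norm; apply: cvgB; first exact: cvg_cst.
  by apply: cvgM; [exact: cvg_cst|exact: cf].
rewrite ft_t subrr normr0 addr0 in cR.
by apply: (ler_cvg_to cL cR); apply: nearW.
Qed.

Lemma lagr_series (eps t ft d g : R) : `|eps| <= 1 -> `|t| <= r / 2 ->
  (P N).[t] @[N --> \oo] --> ft -> eps * ft = t ->
  (P N)^`().[t] @[N --> \oo] --> d -> (H N).[t] @[N --> \oo] --> g ->
  1 - eps * d != 0 ->
  series (fun m => lagr_term m * eps ^+ m) @ \oo --> g / (1 - eps * d).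
Proof.
move=> e1 tr cf ft_t cd cg d0.
set S := series _; set b := C * (5 + 8 * 4^-1) * (1 + 2 / r).
have SE K : S K = \sum_(m < K) lagr_term m * eps ^+ m by rewrite /S /series /= big_mkord.
have c4 : (b * 4^-1 ^+ K) @[K --> \oo] --> (0 : R).
  rewrite -[X in _ --> X](mulr0 b); apply: cvgM; first exact: cvg_cst.
  by apply: cvg_expr; rewrite ger0_norm ?invf_lt1 ?ltr1n.
have c1 : ((1 - eps * d) * S K) @[K --> \oo] --> g.
  apply/cvgrPdist_le => e e0.
  have /cvgrPdist_le/(_ e e0) := c4; apply: filterS => K; rewrite sub0r normrN => h.
  rewrite distrC SE; apply: le_trans (lagr_term_partial K e1 tr cf ft_t cd cg) _.
  by apply: le_trans h; exact: ler_norm.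
have -> : S = (fun K => (1 - eps * d)^-1 * ((1 - eps * d) * S K)).
  by apply/funext => K; rewrite mulKf.
by rewrite [g / _]mulrC; exact: (cvgM (cvg_cst _) c1).
Qed.

Lemma deriv_limit (f : R -> R) t d : `|t| <= r / 2 ->
  (forall s, `|s| <= r -> (P N).[s] @[N --> \oo] --> f s) ->
  is_derive t (1 : R) f d -> (P N)^`().[t] @[N --> \oo] --> d.
Proof.
move=> tr cf df; apply/cvgrPdist_le => e e0.
have [/cvg_ex[l cl] dE] := df.
have {cl} : h^-1 *: ((f \o shift t) (h *: (1 : R)) - f t) @[h --> 0^'] --> d.
  by rewrite -dE /derive; apply: cvgP cl.
move=> /cvgrPdist_le/(_ (e / 3)) => /(_ (divr_gt0 e0 (ltr0Sn R 2))) near1.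
have r2 : 0 < r / 2 by rewrite divr_gt0.
have er : 0 < e / 3 * r by rewrite mulr_gt0 ?divr_gt0.
have [h [h0 hr he hd]] : exists h : R, [/\ h != 0, `|h| < r / 2, `|h| < e / 3 * r &
    `|d - h^-1 *: ((f \o shift t) (h *: (1 : R)) - f t)| <= e / 3].
  apply: (@filter_ex _ (0 : R)^'); near=> h; split; near: h.
  - exact: nbhs_dnbhs_neq.
  - exact: dnbhs0_lt.
  - exact: dnbhs0_lt.
  - exact: near1.
pose s := t + h.
have sr : `|s| <= r.
  by apply: le_trans (ler_normD _ _) _; rewrite [leRHS]splitr lerD// ltW.
have tr' : `|t| <= r by apply: le_trans tr _; have := r0; lra.
have st : s - t = h by rewrite /s addrAC subrr add0r.
have cq : (h^-1 * ((P N).[s] - (P N).[t])) @[N --> \oo] --> h^-1 * (f s - f t).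
  by apply: cvgM; [exact: cvg_cst|apply: cvgB; exact: cf].
have /cvgrPdist_le/(_ (e / 3)) := cq => /(_ (divr_gt0 e0 (ltr0Sn R 2))).
apply: filterS => N hN.
have := deriv_diff_quotient r0 (pnorm_P N) tr sr; rewrite st => hq.
have hq' : `|h^-1 * ((P N).[s] - (P N).[t]) - (P N)^`().[t]| <= e / 3.
  have -> : h^-1 * ((P N).[s] - (P N).[t]) - (P N)^`().[t] =
      h^-1 * ((P N).[s] - (P N).[t] - h * (P N)^`().[t]).
    by rewrite [in RHS]mulrBr mulKf.
  rewrite normrM normfV; have nh : 0 < `|h| by rewrite normr_gt0.
  rewrite ler_pdivrMl//; apply: le_trans hq _.
  rewrite -[h ^+ 2]ger0_norm ?sqr_ge0// normrX expr2 -mulrA ler_wpM2l//.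
  by rewrite ler_pdivrMr// ltW.
move: hd; rewrite /shift /= [(h *: 1 : R)]mulr1 [h + t]addrC -/s -[_ *: _]/(h^-1 * (f s - f t)) => hd.
rewrite (_ : d - (P N)^`().[t] = (d - h^-1 * (f s - f t)) +
  (h^-1 * (f s - f t) - h^-1 * ((P N).[s] - (P N).[t])) +
  (h^-1 * ((P N).[s] - (P N).[t]) - (P N)^`().[t])); last by ring.
rewrite (_ : e = e / 3 + e / 3 + e / 3); last by field.
apply: le_trans (ler_normD _ _) _; apply: lerD => //.
by apply: le_trans (ler_normD _ _) _; exact: lerD.
Unshelve. all: by end_near. Qed.

End LagrangeLimit.

Section PowerSeriesDerivatives.
Variable R : realType.
Implicit Types (c : nat -> R) (r t : R).

(** The coefficients are dominated by those of a geometric series of ratio 1 / r,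
a form of convergence for |t| < r that is stable by differentiation up to
shrinking r. *)
Definition geom_bounded r c := exists C, forall m, `|c m| * r ^+ m <= C.

Lemma geom_bounded_cvg r c t : 0 < r -> geom_bounded r c -> `|t| < r -> cvgn (pseries c t).
Proof.
move=> r0 [C cC] tr; apply: normed_cvg; rewrite /=.
have C0 : 0 <= C by apply: le_trans (cC 0%N); rewrite expr0 mulr1.
have q0 : 0 <= `|t| / r by rewrite divr_ge0// ltW.
have tr1 : `| (`|t| / r) | < 1 by rewrite ger0_norm// ltr_pdivrMr// mul1r.
apply: (@series_le_cvg _ _ (fun m => C * (`|t| / r) ^+ m)).
- by move=> m /=.
- by move=> m; rewrite mulr_ge0// exprn_ge0.
- move=> m /=; rewrite normrM normrX exprMn exprVn.
  have rm : 0 < r ^+ m by rewrite exprn_gt0.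
  rewrite [_ ^+ m / _]mulrC mulrA ler_wpM2r ?exprn_ge0//.
  by rewrite ler_pdivlMr.
- exact: is_cvg_geometric_series.
Qed.

Lemma geom_bounded_diffs r c : 0 < r -> geom_bounded r c -> geom_bounded (r / 2) (pseries_diffs c).
Proof.
move=> r0 [C cC]; exists (C / r) => m; rewrite /pseries_diffs normrM ger0_norm//.
have h1 : (m.+1%:R : R) <= 2 ^+ m.
  by rewrite -natrX ler_nat; elim: m => // m IH; rewrite expnS mul2n -addnn -addn1 leq_add// expn_gt0.
have rm : 0 < r ^+ m by rewrite exprn_gt0.
rewrite ler_pdivlMr//; apply: le_trans (cC m.+1); rewrite exprS exprMn exprVn.
have p2 : 0 < (2 ^+ m : R) by rewrite exprn_gt0.
rewrite (_ : _ * _ * _ * r = (m.+1%:R / 2 ^+ m) * (`|c m.+1| * (r * r ^+ m))); last by ring.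
rewrite -[leRHS]mul1r ler_wpM2r//; first by rewrite !mulr_ge0// ltW.
by rewrite ler_pdivrMr// mul1r.
Qed.

Lemma geom_bounded_iter r c k : 0 < r -> geom_bounded r c ->
  geom_bounded (r / 2 ^+ k) (iter k (@pseries_diffs R) c).
Proof.
move=> r0 bc; elim: k => [|k IH]; first by rewrite expr0 divr1.
rewrite exprS invfM mulrCA mulrC; apply: geom_bounded_diffs => //.
by rewrite divr_gt0// exprn_gt0.
Qed.

Lemma pseries_is_derive r c : 0 < r -> geom_bounded r c ->
  \forall t \near (0 : R), is_derive t (1 : R) (fun s => limn (pseries c s))
     (limn (pseries (pseries_diffs c) t)).
Proof.
(* Each termwise derivation halves the radius at which the coefficients are
   bounded; the criterion for differentiating termwise needs two of them. *)
move=> r0 bc; pose K := r / 8; have K0 : 0 < K by rewrite divr_gt0.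
have b1 := geom_bounded_diffs r0 bc.
have r20 : 0 < r / 2 by rewrite divr_gt0.
have b2 := geom_bounded_diffs r20 b1.
have r40 : 0 < r / 2 / 2 by rewrite divr_gt0.
have sm : \forall t \near (0 : R), `|t| < K by exact: nbhs0_lt.
near=> t; apply: (@pseries_snd_diffs _ c K).
- by apply: (geom_bounded_cvg r0 bc); rewrite ger0_norm ?ltW// /K; lra.
- by apply: (geom_bounded_cvg r20 b1); rewrite ger0_norm ?ltW// /K; lra.
- by apply: (geom_bounded_cvg r40 b2); rewrite ger0_norm ?ltW// /K; lra.
- by rewrite (ger0_norm (ltW K0)); near: t; exact: sm.
Unshelve. all: by end_near. Qed.

Lemma pseries_derive1n r c k : 0 < r -> geom_bounded r c ->
  \forall t \near (0 : R), derive1n k (fun s => limn (pseries c s)) t =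
     limn (pseries (iter k (@pseries_diffs R) c) t).
Proof.
move=> r0 bc; elim: k => [|k IH]; first by near=> t.
have rk : 0 < r / 2 ^+ k by rewrite divr_gt0// exprn_gt0.
have D := pseries_is_derive rk (geom_bounded_iter k r0 bc).
have I := nbhs_interior IH.
near=> t; rewrite derive1nS derive1E.
rewrite (@near_eq_derive _ _ _ _ (fun s => limn (pseries (iter k (@pseries_diffs R) c) s))).
  have d : is_derive t (1 : R) (fun s => limn (pseries (iter k (@pseries_diffs R) c) s))
     (limn (pseries (pseries_diffs (iter k (@pseries_diffs R) c)) t)) by near: t.
  exact: derive_val.
by near: t.
Unshelve. all: by end_near. Qed.

Lemma iter_diffs_fact c k j : (iter k (@pseries_diffs R) c) j * j`!%:R = (j + k)`!%:R * c (j + k)%N.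
Proof.
elim: k j => [|k IH] j; first by rewrite addn0 mulrC.
rewrite /= {1}/pseries_diffs addnS -addSn -IH factS natrM; ring.
Qed.

Lemma pseries_at0 c : limn (pseries c 0) = c 0.
Proof.
apply: cvg_lim => //; apply: (@cvg_trans _ ((fun=> c 0) N @[N --> \oo])); last exact: cvg_cst.
apply: near_eq_cvg; exists 1%N => // N /= N1.
rewrite /pseries /series /= -(ltn_predK N1) big_nat_recl// expr0 mulr1 big1 ?addr0// => i _.
by rewrite expr0n mulr0.
Qed.

(** Used to recognise Lagrange's coefficients as Taylor coefficients in eps. *)
Lemma derive1n_pseries (G : R -> R) r c m : 0 < r -> geom_bounded r c ->
  (\forall t \near (0 : R), pseries c t @ \oo --> G t) ->
  derive1n m G 0 = m`!%:R * c m.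
Proof.
move=> r0 bc cG.
have E : \forall t \near (0 : R), G t = limn (pseries c t).
  by apply: filterS cG => t /cvg_lim ->.
have -> : derive1n m G 0 = derive1n m (fun s => limn (pseries c s)) 0.
  suff : \forall s \near (0 : R), derive1n m G s = derive1n m (fun s => limn (pseries c s)) s.
    exact: nbhs_singleton.
  elim: m => [//|m IH]; have := nbhs_interior IH; apply: filterS => s ns.
  by rewrite !derive1nS !derive1E; exact: near_eq_derive.
rewrite (nbhs_singleton (pseries_derive1n m r0 bc)) pseries_at0.
by have := iter_diffs_fact c m 0; rewrite fact0 mulr1 add0n.
Qed.

End PowerSeriesDerivatives.

(** * Transported functions and the explicit solution *)

#[local] Opaque derive.

Section Coordinates.
Variables (R : realType) (n : nat).
Local Notation V := 'rV[R]_n.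
Local Notation W := (V * V)%type.
Implicit Types (p q w : W).

Lemma is_derive_fst_coord i p w :
  is_derive p w (fun q : W => q.1 0 i) (w.1 0 i).
Proof.
apply: derive_of_cvg.
rewrite (_ : (fun h => _) = (fun h : R => h^-1 * h * w.1 0 i)).
  rewrite -[X in _ --> X]mul1r.
  exact: (cvgM (@cvg_dnbhs_ratio R) (cvg_cst _)).
by apply/funext => h; rewrite /= !mxE; ring.
Qed.

Lemma fst_coord_continuous i : continuous (fun q : W => q.1 0 i).
Proof.
move=> p; apply: (@cvg_comp _ _ _ fst (fun x : V => x 0 i)); first exact: cvg_fst.
exact: coord_continuous.
Qed.

Lemma is_derive_snd_coord i p w :
  is_derive p w (fun q : W => q.2 0 i) (w.2 0 i).
Proof.
apply: derive_of_cvg.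
rewrite (_ : (fun h => _) = (fun h : R => h^-1 * h * w.2 0 i)).
  rewrite -[X in _ --> X]mul1r.
  exact: (cvgM (@cvg_dnbhs_ratio R) (cvg_cst _)).
by apply/funext => h; rewrite /= !mxE; ring.
Qed.

Lemma snd_coord_continuous i : continuous (fun q : W => q.2 0 i).
Proof.
move=> p; apply: (@cvg_comp _ _ _ snd (fun x : V => x 0 i)); first exact: cvg_snd.
exact: coord_continuous.
Qed.

End Coordinates.

Section Transport.
Variables (R : realType) (n : nat).
Local Notation V := 'rV[R]_n.
Local Notation W := (V * V)%type.
Variables (A : set W) (F : W -> R).
Hypotheses (oA : open A) (sF : smooth_on A F).
Hypothesis FF : forall p v, A p -> 'D_(v, 0) F p = F p * 'D_(0, v) F p.
Implicit Types (u v : V) (p q w : W) (L : W -> R).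

Lemma smooth_snd_coord i : smooth_on A (fun p => p.2 0 i).
Proof.
apply: (@smalg_smooth _ _ _ oA (fun f => exists i, f = fun p : W => p.2 0 i)).
- move=> f [j ->] p _; split; first exact: snd_coord_continuous.
  by move=> w; have [] := is_derive_snd_coord j p w.
- move=> f w [j ->]; apply: smalg_ext (smalg_cst _ _ (w.2 0 j)) _ => p _.
  by have d := is_derive_snd_coord j p w; exact: derive_val.
- by apply: smalg_gen; exists i.
Qed.

Lemma smooth_fst_coord i : smooth_on A (fun p => p.1 0 i).
Proof.
apply: (@smalg_smooth _ _ _ oA (fun f => exists i, f = fun p : W => p.1 0 i)).
- move=> f [j ->] p _; split; first exact: fst_coord_continuous.
  by move=> w; have [] := is_derive_fst_coord j p w.
- move=> f w [j ->]; apply: smalg_ext (smalg_cst _ _ (w.1 0 j)) _ => p _.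
  by have d := is_derive_fst_coord j p w; exact: derive_val.
- by apply: smalg_gen; exists i.
Qed.

(** The Jacobian determinant of y |-> z at fixed x, equal to 1 / (1 - D_x phi (z))
for the Funk metric. *)
Definition jac p : R := 1 + \sum_i p.1 0 i * 'D_(0, e_ R i) F p.

Lemma smooth_jac : smooth_on A jac.
Proof.
apply: (smoothD oA); first exact: smooth_cst.
apply: (smooth_sum oA) => i; apply: (smoothM oA); first exact: smooth_fst_coord.
exact: smooth_derive.
Qed.

Lemma pair_sum_e v : (0, v) = \sum_i v 0 i *: (0, e_ R i) :> W.
Proof.
rewrite [RHS]surjective_pairing; congr pair.
  rewrite (big_morph fst (id1 := 0) (op1 := +%R))//.
  by rewrite big1// => i _ /=; rewrite scaler0.
rewrite (big_morph snd (id1 := 0) (op1 := +%R))//=.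
exact: row_sum_e.
Qed.

Lemma pair_sum_e1 v : (v, 0) = \sum_i v 0 i *: (e_ R i, 0) :> W.
Proof.
rewrite [RHS]surjective_pairing; congr pair.
  rewrite (big_morph fst (id1 := 0) (op1 := +%R))//=.
  exact: row_sum_e.
rewrite (big_morph snd (id1 := 0) (op1 := +%R))//.
by rewrite big1// => i _ /=; rewrite scaler0.
Qed.

Lemma derive_y_sum L v p : smooth_on A L -> A p ->
  'D_(0, v) L p = \sum_i v 0 i * 'D_(0, e_ R i) L p.
Proof.
move=> sL Ap; rewrite pair_sum_e (derive_sumr oA _ _ _ sL Ap).
by apply: eq_bigr => i _; exact: (deriveZr oA _ _ sL Ap).
Qed.

Lemma derive_x_sum L v p : smooth_on A L -> A p ->
  'D_(v, 0) L p = \sum_i v 0 i * 'D_(e_ R i, 0) L p.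
Proof.
move=> sL Ap; rewrite pair_sum_e1 (derive_sumr oA _ _ _ sL Ap).
by apply: eq_bigr => i _; exact: (deriveZr oA _ _ sL Ap).
Qed.

Lemma derive_big (I : Type) (r : seq I) (f : I -> W -> R) w p :
  (forall i, smooth_on A (f i)) -> A p ->
  'D_w (fun q => \sum_(i <- r) f i q) p = \sum_(i <- r) 'D_w (f i) p.
Proof.
move=> sf Ap; elim: r => [|i r IH].
  by under eq_fun do rewrite big_nil; rewrite derive_cst big_nil.
under eq_fun do rewrite big_cons.
by rewrite big_cons -IH; exact: (derive_add _ (sf i) (smooth_sum oA r sf) Ap).
Qed.

Lemma derive_jac p w : A p -> 'D_w jac p =
  'D_(0, w.1) F p + \sum_i p.1 0 i * 'D_w ('D_(0, e_ R i) F) p.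
Proof.
move=> Ap.
have sdi i : smooth_on A ('D_(0, e_ R i) F) by exact: smooth_derive.
have sm i : smooth_on A (fun q => q.1 0 i * 'D_(0, e_ R i) F q).
  exact: (smoothM oA (smooth_fst_coord i) (sdi i)).
have s1 : smooth_on A (fun=> 1 : R) by exact: smooth_cst.
rewrite (derive_add w s1 (smooth_sum oA _ sm) Ap) derive_cst add0r.
rewrite (derive_big _ w sm Ap) (derive_y_sum w.1 sF Ap) -big_split /=.
apply: eq_bigr => i _; rewrite (derive_mul w (smooth_fst_coord i) (sdi i) Ap).
have d := is_derive_fst_coord i p w.
have -> : 'D_w (fun q : W => q.1 0 i) p = w.1 0 i by exact: derive_val.
by ring.
Qed.

Lemma jac_algebra (x a b c : 'I_n -> R) d f :
  (forall i, a i = c i * d + f * b i) ->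
  d + \sum_i x i * a i = (1 + \sum_i x i * c i) * d + f * \sum_i x i * b i.
Proof.
move=> E; rewrite mulrDl mul1r -addrA; congr (_ + _).
rewrite mulr_suml mulr_sumr -big_split /=; apply: eq_bigr => i _.
by rewrite E; ring.
Qed.

Lemma swap_products (a b c d : R) : a * b + c * d = d * c + a * b.
Proof. by rewrite addrC [c * d]mulrC. Qed.

(** This is the transport equation for J.  The x-derivative of J is computed from
F_x = F F_y after exchanging the order of derivatives. *)
Lemma jac_transport p v : A p ->
  'D_(v, 0) jac p = jac p * 'D_(0, v) F p + F p * 'D_(0, v) jac p.
Proof.
move=> Ap; rewrite !derive_jac//= derive0 add0r.
have E i : 'D_(v, 0) ('D_(0, e_ R i) F) p =
    'D_(0, e_ R i) F p * 'D_(0, v) F p + F p * 'D_(0, v) ('D_(0, e_ R i) F) p.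
  rewrite (derive_comm oA _ _ sF Ap).
  have sdv : smooth_on A ('D_(0, v) F) by exact: smooth_derive.
  have E1 := derive_ext oA (0, e_ R i) (fun q Aq => FF v Aq) Ap.
  have E2 := derive_comm oA (0, v) (0, e_ R i) sF Ap.
  rewrite E1 (derive_mul _ sF sdv Ap) E2; exact: swap_products.
exact: jac_algebra.
Qed.

(** The conservation law L_x = (F L)_y. *)
Definition transports L : Prop :=
  forall p v, A p -> 'D_(v, 0) L p = 'D_(0, v) (fun q => F q * L q) p.

(** A function constant along the characteristics times one transported function
is transported, by Leibniz's rule. *)
Lemma jac_mul_transports g : smooth_on A g ->
  (forall p v, A p -> 'D_(v, 0) g p = F p * 'D_(0, v) g p) ->
  transports (fun p => g p * jac p).
Proof.
move=> sg gF p v Ap; have sJ := smooth_jac.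
rewrite (derive_mul _ sg sJ Ap) (derive_mul _ sF (smoothM oA sg sJ) Ap).
rewrite (derive_mul _ sg sJ Ap) jac_transport// gF//; ring.
Qed.

Lemma transports_ext L L' : transports L -> (forall p, A p -> L' p = L p) ->
  transports L'.
Proof.
move=> tL LL p v Ap; rewrite (derive_ext oA _ LL Ap) tL//; apply/esym.
by apply: (derive_ext oA _ _ Ap) => q Aq; rewrite LL.
Qed.

End Transport.

Section FunkSmooth.
Variables (R : realType) (n : nat).
Local Notation V := 'rV[R]_n.
Local Notation W := (V * V)%type.
Variable phi : V -> R.
Hypothesis hphi : minkowski_norm phi.
Implicit Types (x y u v z : V) (a s t : R) (p q w : W).
Local Notation V0 := [set y : V | y != 0].
Local Notation funk_dom := (funk_dom phi).
Local Notation funkp := (funkp phi).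
Local Notation exit_pt := (exit_pt phi).
Let oD : open funk_dom := open_funk_dom hphi.

(** Functions whose derivatives are algebraic expressions in functions of the
same kind: they generate an algebra stable by derivation, so the implicit
function F is smooth. *)
Inductive funk_gen : (W -> R) -> Prop :=
| funk_gen_F : funk_gen funkp
| funk_gen_x i : funk_gen (fun p => p.1 0 i)
| funk_gen_z (f : V -> R) : smooth_on V0 f -> funk_gen (f \o exit_pt).

Local Notation alg := (smalg funk_dom funk_gen).

Lemma smalg_sum (I : Type) (r : seq I) (f : I -> W -> R) :
  (forall i, alg (f i)) -> alg (fun p => \sum_(i <- r) f i p).
Proof.
move=> af; elim: r => [|i r IH].
  by under eq_fun do rewrite big_nil; exact: smalg_cst.
by under eq_fun do rewrite big_cons; exact: smalg_add.
Qed.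

(** Expanding the direction x in the standard basis keeps the generators down to
functions of the exit point alone. *)
Lemma smalg_derive_x (f : V -> R) : smooth_on V0 f ->
  alg (fun p => 'D_(p.1) f (exit_pt p)).
Proof.
move=> sf; apply: (@smalg_ext _ _ _ _
  (fun p => \sum_i p.1 0 i * ('D_(e_ R i) f \o exit_pt) p)).
  apply: smalg_sum => i; apply: smalg_mul; apply: smalg_gen; constructor.
  exact: smooth_derive.
move=> p Dp; rewrite (derive_row _ (open_neq0 (n:=n)) sf)//.
exact: exit_neq0.
Qed.

Definition den p : R := 1 - 'D_(p.1) phi (exit_pt p).

Lemma den_neq0 p : funk_dom p -> den p != 0.
Proof.
by move=> Dp; rewrite gt_eqF// den_gt0//; [case: Dp|exact: exit_neq0].
Qed.

Lemma smalg_invden : alg (fun p => (den p)^-1).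
Proof.
apply: smalg_inv; first exact: den_neq0.
apply: (@smalg_ext _ _ _ _ (fun p => 1 + (-1) * 'D_(p.1) phi (exit_pt p))).
  apply: smalg_add; first exact: smalg_cst.
  apply: smalg_mul; first exact: smalg_cst.
  by apply: smalg_derive_x; exact: phi_smooth.
by move=> p _; rewrite /den mulN1r.
Qed.

Lemma funk_gen_c1 f : funk_gen f -> forall p, funk_dom p ->
  {for p, continuous f} /\ forall w, derivable f p w.
Proof.
case=> {f} [|i|f sf] p Dp.
- split=> [|w]; first exact: funkp_continuous.
  by have [] := is_derive_funkp hphi w Dp.
- split=> [|w]; first exact: fst_coord_continuous.
  by have [] := is_derive_fst_coord i p w.
- split=> [|w]; last by have [] := is_derive_exit hphi w sf Dp.
  apply: (@cvg_comp _ _ _ exit_pt f); last first.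
    by apply: smooth_continuous sf _; exact: exit_neq0.
  apply: cvgD; first exact: cvg_snd.
  by apply: cvgZ; [exact: (funkp_continuous hphi Dp)|exact: cvg_fst].
Qed.

Lemma smalg_dfunk w : alg (fun p => dfunk phi p w).
Proof.
have sphi := phi_smooth hphi.
apply: smalg_mul; last exact: smalg_invden.
apply: smalg_add; [|apply: smalg_mul]; apply: smalg_gen.
- by apply: (funk_gen_z (f := 'D_(w.2) phi)); exact: smooth_derive.
- exact: funk_gen_F.
- by apply: (funk_gen_z (f := 'D_(w.1) phi)); exact: smooth_derive.
Qed.

Lemma funk_gen_derive f w : funk_gen f -> alg ('D_w f).
Proof.
case=> {f} [|i|f sf].
- apply: smalg_ext (smalg_dfunk w) _ => p Dp.
  by have d := is_derive_funkp hphi w Dp; exact: derive_val.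
- apply: smalg_ext (smalg_cst _ _ (w.1 0 i)) _ => p Dp.
  by have d := is_derive_fst_coord i p w; exact: derive_val.
- apply: (@smalg_ext _ _ _ _ (fun p => dfunk phi p w * 'D_p.1 f (exit_pt p) +
     ('D_w.2 f (exit_pt p) + funkp p * 'D_w.1 f (exit_pt p)))); last first.
    by move=> p Dp; have d := is_derive_exit hphi w sf Dp; exact: derive_val.
  apply: smalg_add.
    by apply: smalg_mul; [exact: smalg_dfunk|exact: smalg_derive_x].
  apply: smalg_add; [|apply: smalg_mul]; apply: smalg_gen.
  + by apply: (funk_gen_z (f := 'D_(w.2) f)); exact: smooth_derive.
  + exact: funk_gen_F.
  + by apply: (funk_gen_z (f := 'D_(w.1) f)); exact: smooth_derive.
Qed.

Lemma funk_alg_smooth f : alg f -> smooth_on funk_dom f.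
Proof. exact: (smalg_smooth oD funk_gen_c1 funk_gen_derive). Qed.

Lemma smooth_funkp : smooth_on funk_dom funkp.
Proof. by apply/funk_alg_smooth/smalg_gen; exact: funk_gen_F. Qed.

Lemma smooth_exit (f : V -> R) : smooth_on V0 f -> smooth_on funk_dom (f \o exit_pt).
Proof. by move=> sf; apply/funk_alg_smooth/smalg_gen; exact: funk_gen_z. Qed.

(** The explicit solution of the transport equation with value psi at x = 0. *)
Definition sol (psi : V -> R) x y : R :=
  psi (y + funk phi x y *: x) / (1 - 'D_x phi (y + funk phi x y *: x)).

Lemma smooth_sol psi : smooth_on V0 psi -> smooth_on funk_dom (fun p => sol psi p.1 p.2).
Proof.
move=> sp; apply: funk_alg_smooth; apply: smalg_mul; last exact: smalg_invden.
by apply: smalg_gen; exact: funk_gen_z.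
Qed.

Lemma derive_funkp p w : funk_dom p -> 'D_w funkp p = dfunk phi p w.
Proof. by move=> Dp; have d := is_derive_funkp hphi w Dp; exact: derive_val. Qed.

Lemma derive_exit (f : V -> R) p w : smooth_on V0 f -> funk_dom p ->
  'D_w (f \o exit_pt) p = dfunk phi p w * 'D_p.1 f (exit_pt p) +
     ('D_w.2 f (exit_pt p) + funkp p * 'D_w.1 f (exit_pt p)).
Proof. by move=> sf Dp; have d := is_derive_exit hphi w sf Dp; exact: derive_val. Qed.

(** A displacement v of x moves the exit point, to first order, by F times what
the displacement v of y does. *)
Lemma dfunk_transport p v : dfunk phi p (v, 0) = funkp p * dfunk phi p (0, v).
Proof. by rewrite /dfunk /= !derive0 mulr0 addr0 add0r mulrA. Qed.

Lemma funk_transport p v : funk_dom p -> 'D_(v, 0) funkp p = funkp p * 'D_(0, v) funkp p.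
Proof. by move=> Dp; rewrite !derive_funkp// dfunk_transport. Qed.

Lemma exit_transport (f : V -> R) p v : smooth_on V0 f -> funk_dom p ->
  'D_(v, 0) (f \o exit_pt) p = funkp p * 'D_(0, v) (f \o exit_pt) p.
Proof.
move=> sf Dp; rewrite !derive_exit// dfunk_transport /= !derive0; ring.
Qed.

Lemma jacE p : funk_dom p -> jac funkp p = (den p)^-1.
Proof.
move=> Dp; have d0 := den_neq0 Dp; apply: (mulIf d0); rewrite mulVf//.
have -> : jac funkp p = 1 + 'D_(p.1) phi (exit_pt p) / den p.
  rewrite /jac (derive_row _ (open_neq0 (n:=n)) (phi_smooth hphi)); last exact: exit_neq0.
  rewrite mulr_suml; congr (1 + _); apply: eq_bigr => i _.
  by rewrite derive_funkp// /dfunk /= derive0 mulr0 addr0 mulrA.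
by rewrite mulrDl divfK// mul1r /den subrK.
Qed.

Lemma solE psi p : funk_dom p -> sol psi p.1 p.2 = (psi \o exit_pt) p * jac funkp p.
Proof. by move=> Dp; rewrite jacE. Qed.

Lemma sol_transport psi : smooth_on V0 psi ->
  transports funk_dom funkp (fun p => sol psi p.1 p.2).
Proof.
move=> sp; apply: (transports_ext oD _ (fun p Dp => solE psi Dp)).
apply: (jac_mul_transports oD smooth_funkp _ (smooth_exit sp)) => p v Dp.
- exact: funk_transport.
- exact: exit_transport.
Qed.

End FunkSmooth.

(** * The spray of a Finsler metric in directional derivatives *)

#[local] Opaque e_.

Lemma near_line (R : realType) (V : normedModType R) (A : set V) (p w : V) :
  open A -> A p -> \forall s \near (0 : R), A (p + s *: w).
Proof.
move=> oA Ap; have : (p + s *: w) @[s --> (0 : R)] --> p + 0 *: w.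
  by apply: cvgD; [exact: cvg_cst|apply: cvgZr_tmp; exact: cvg_id].
by rewrite scale0r addr0; apply; exact: nearA.
Qed.

Lemma derive_comm3 (R : realType) (V : normedModType R) (A : set V) f (a b c p : V) :
  open A -> smooth_on A f -> A p ->
  'D_a ('D_b ('D_c f)) p = 'D_b ('D_c ('D_a f)) p :> R.
Proof.
move=> oA sf Ap; apply: etrans (derive_comm oA a b (smooth_derive c sf) Ap) _.
exact: (derive_ext oA b (fun q Aq => derive_comm oA a c sf Aq) Ap).
Qed.

Section SlitBundle.
Variables (R : realType) (n : nat).
Local Notation V := 'rV[R]_n.
Local Notation W := (V * V)%type.
Variable U : set V.
Hypothesis oU : open U.
Implicit Types (x y u v : V) (p q w : W) (L : V -> V -> R) (G : W -> R).

(** The tangent bundle of U without its zero section. *)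
Definition slit : set W := [set p | U p.1 /\ p.2 != 0].
Local Notation A := slit.

Lemma open_slit : open A.
Proof.
rewrite (_ : A = (fst @^-1` U) `&` (snd @^-1` [set y | y != 0]))//.
apply: openI; apply: open_comp => //.
- by move=> p _; exact: cvg_fst.
- by move=> p _; exact: cvg_snd.
- exact: open_neq0.
Qed.
Let oA := open_slit.

Definition homog k G : Prop :=
  forall p (a : R), A p -> 0 < a -> G (p.1, a *: p.2) = a ^+ k * G p.

Lemma homog_euler k G p : homog k G -> A p -> 'D_(0, p.2) G p = k%:R * G p.
Proof.
move=> hG Ap; apply: euler => s s1; rewrite -hG//; last by lra.
by congr G; rewrite scalerDl scale1r; congr pair; rewrite /= scaler0 addr0.
Qed.

Lemma homog_euler_sum k G p : smooth_on A G -> homog k G -> A p ->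
  \sum_j p.2 0 j * 'D_(0, e_ R j) G p = k%:R * G p.
Proof.
by move=> sG hG Ap; exact: etrans (esym (derive_y_sum oA _ sG Ap)) (homog_euler hG Ap).
Qed.

Lemma homog_dx k G u : smooth_on A G -> homog k G -> homog k ('D_(u, 0) G).
Proof.
move=> sG hG p a Ap a0.
rewrite -[a ^+ k]mulr1; apply: (homog_derive oA sG Ap).
have nA := near_line (u, 0) oA Ap.
near=> s; rewrite mulr1 -hG//; last by near: s.
by congr G; congr pair; rewrite /= scaler0 !addr0.
Unshelve. all: by end_near. Qed.

Lemma homog_dy k G u : smooth_on A G -> homog k.+1 G -> homog k ('D_(0, u) G).
Proof.
move=> sG hG p a Ap a0; have aN : a != 0 by rewrite gt_eqF.
rewrite (_ : a ^+ k = a ^+ k.+1 * a^-1); last by rewrite exprSr mulfK.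
apply: (homog_derive oA sG Ap).
have nA := near_line (a^-1 *: (0, u)) oA Ap.
near=> s; rewrite -hG//; last by rewrite -scalerA; near: s.
congr G; congr pair; rewrite /= ?scaler0 ?addr0//.
by rewrite scalerDr scalerA mulrCA divff// mulr1.
Unshelve. all: by end_near. Qed.

Lemma dxE (f : V -> V -> R) k x y :
  dx k f x y = 'D_(e_ R k, 0) (fun p => f p.1 p.2) (x, y).
Proof.
rewrite /dx -(derive1_line0 (f^~ y)) -(derive1_line0 (fun p : W => f p.1 p.2)).
by congr (derive1 _ 0); apply/funext => s /=; rewrite scaler0 addr0.
Qed.

Lemma derive_yE (f : V -> V -> R) v x y :
  'D_v (f x) y = 'D_(0, v) (fun p => f p.1 p.2) (x, y).
Proof.
rewrite -(derive1_line0 (f x)) -(derive1_line0 (fun p : W => f p.1 p.2)).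
by congr (derive1 _ 0); apply/funext => s /=; rewrite scaler0 addr0.
Qed.

Lemma dyE (f : V -> V -> R) k x y :
  dy k f x y = 'D_(0, e_ R k) (fun p => f p.1 p.2) (x, y).
Proof. exact: derive_yE. Qed.

Lemma dy_uncurry (f : V -> V -> R) k :
  (fun p : W => dy k f p.1 p.2) = 'D_(0, e_ R k) (fun p => f p.1 p.2).
Proof. by apply/funext => -[x y]; exact: dyE. Qed.

Definition energy L : W -> R := fun p => L p.1 p.2 ^+ 2.

Lemma gmatE L x y i j : gmat L x y i j =
  2^-1 * 'D_(0, e_ R i) ('D_(0, e_ R j) (energy L)) (x, y).
Proof. by rewrite mxE dyE dy_uncurry. Qed.

Lemma iter_derive_yE (f : V -> V -> R) vs x :
  iter_derive vs (f x) =
  fun y => iter_derive (map (fun v => (0, v)) vs) (fun p => f p.1 p.2) (x, y).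
Proof.
elim: vs => //= v vs IH; apply/funext => y; rewrite IH.
rewrite (derive_yE (fun x y =>
  iter_derive (map (fun v => (0, v)) vs) (fun p => f p.1 p.2) (x, y))).
by congr ('D__ _ _); apply/funext => -[].
Qed.

Section Energy.
Variable L : V -> V -> R.
Hypothesis fL : finsler_metric U L.
Local Notation E := (energy L).

Lemma smooth_L : smooth_on A (fun p => L p.1 p.2). Proof. by case: fL. Qed.

Lemma smooth_E : smooth_on A E.
Proof. exact: (smoothX oA 2 smooth_L). Qed.

Lemma L_gt0 p : A p -> 0 < L p.1 p.2.
Proof. by move=> [Up p0]; case: fL => m _; exact: (phi_gt0 (m _ Up)). Qed.

Lemma homog_L : homog 1 (fun p => L p.1 p.2).
Proof. by move=> p a [Up _] a0; case: fL => /(_ _ Up) m _; rewrite expr1 /= (phiZ m). Qed.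

Lemma homog_E : homog 2 E.
Proof.
move=> p a Ap a0; rewrite /energy; have := homog_L Ap a0; rewrite /= => ->.
by rewrite expr1 exprMn.
Qed.

Lemma derive2_energy x y u :
  'D_u ('D_u (fun z => L x z ^+ 2)) y = 'D_(0, u) ('D_(0, u) E) (x, y).
Proof.
have E1 : (fun p : W => 'D_u (fun z => L p.1 z ^+ 2) p.2) = 'D_(0, u) E.
  by apply/funext => -[x' y']; exact: (derive_yE (fun x z => L x z ^+ 2)).
by rewrite (derive_yE (fun x => 'D_u (fun z => L x z ^+ 2))) E1.
Qed.

Lemma mul4_perm (a b c d : R) : a * (b * (c * d)) = a * d * b * c.
Proof. by ring. Qed.

Lemma mul3_perm (a b c : R) : a * b * c = c * (b * a).
Proof. by ring. Qed.

Lemma mul3_perm' (a b c : R) : a * b * c = a * (c * b).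
Proof. by ring. Qed.

Lemma bracket_perm (a b c d : R) : (2 * (2^-1 * a) - 2^-1 * d) * b * c =
  c * (b * a) - 2^-1 * (d * b * c).
Proof. by field. Qed.

Lemma gmat_quad x y u : U x -> y != 0 -> u != 0 ->
  0 < \sum_i \sum_j gmat L x y i j * u 0 i * u 0 j.
Proof.
move=> Ux y0 u0; have Ap : A (x, y) by [].
have [m _] := fL; have [_ _ _ /(_ y u y0 u0)] := m x Ux.
rewrite fund_formE derive2_energy => H; apply: lt_le_trans H _.
rewrite le_eqVlt; apply/orP; left; apply/eqP.
apply: etrans (congr1 _ (derive_y_sum oA _ (smooth_derive _ smooth_E) Ap)) _.
rewrite mulr_sumr; apply: eq_bigr => i _.
apply: etrans (congr1 (fun r => _ * (_ * r)) (derive_comm oA (0, e_ R i) (0, u) smooth_E Ap)) _.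
apply: etrans (congr1 (fun r => _ * (_ * r))
  (derive_y_sum oA _ (smooth_derive _ smooth_E) Ap)) _.
rewrite !mulr_sumr; apply: eq_bigr => j _; rewrite gmatE.
apply: etrans (congr1 (fun r => _ * (_ * (_ * r)))
  (derive_comm oA (0, e_ R j) (0, e_ R i) smooth_E Ap)) _.
exact: mul4_perm.
Qed.

(** The kernel is trivial because the quadratic form of the matrix is the
fundamental form, which is positive definite. *)
Lemma gmat_unit x y : U x -> y != 0 -> gmat L x y \in unitmx.
Proof.
move=> Ux y0; rewrite -row_free_unit -kermx_eq0; apply/rowV0P => u /sub_kermxP ug.
apply/eqP; apply: contraT => u0; have := gmat_quad Ux y0 u0.
have -> : \sum_i \sum_j gmat L x y i j * u 0 i * u 0 j = \sum_j (u *m gmat L x y) 0 j * u 0 j.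
  rewrite exchange_big; apply: eq_bigr => j _; rewrite mxE mulr_suml.
  by apply: eq_bigr => i _; rewrite [gmat _ _ _ _ _ * _]mulrC.
by rewrite ug big1 ?ltxx// => j _; rewrite mxE mul0r.
Qed.

(** The Euler-Lagrange expression of the energy along v without its acceleration
term; contracted with the
inverse fundamental matrix it is four times the spray coefficient. *)
Definition bracket v p : R :=
  'D_(p.2, 0) ('D_(0, v) E) p - 'D_(v, 0) E p.

(** Contracting with y collapses the sums of third derivatives of the energy, by
Euler's identity for the homogeneous functions E_(x^k y^l) and E_(x^l). *)
Lemma bracketE p l : A p ->
  \sum_j \sum_k
    (2 * dx k (fun x' y' => gmat L x' y' j l) p.1 p.2
     - dx l (fun x' y' => gmat L x' y' j k) p.1 p.2) * p.2 0 j * p.2 0 k =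
  bracket (e_ R l) p.
Proof.
move=> Ap; have sE := smooth_E.
have sx v : smooth_on A ('D_(v, 0) E) by exact: smooth_derive.
have sy v : smooth_on A ('D_(0, v) E) by exact: smooth_derive.
have dgE k j m : dx k (fun x' y' => gmat L x' y' j m) p.1 p.2 =
    2^-1 * 'D_(e_ R k, 0) ('D_(0, e_ R j) ('D_(0, e_ R m) E)) p.
  rewrite dxE -surjective_pairing.
  rewrite (_ : (fun p0 : W => _) = (fun q => 2^-1 * 'D_(0, e_ R j) ('D_(0, e_ R m) E) q)).
    rewrite (@derive_mul _ _ A (fun=> 2^-1) ('D_(0, e_ R j) ('D_(0, e_ R m) E)) _ p).
    - by rewrite derive_cst mulr0 addr0.
    - exact: smooth_cst.
    - exact: (smooth_derive _ (sy _)).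
    - exact: Ap.
  by apply/funext => q; rewrite gmatE -surjective_pairing.
have E1 k : \sum_j p.2 0 j * 'D_(e_ R k, 0) ('D_(0, e_ R j) ('D_(0, e_ R l) E)) p =
    'D_(e_ R k, 0) ('D_(0, e_ R l) E) p.
  have sG := smooth_derive (e_ R k, 0) (sy (e_ R l)).
  have hG : homog 1 ('D_(e_ R k, 0) ('D_(0, e_ R l) E)).
    by apply: homog_dx (sy _) _; exact: homog_dy sE homog_E.
  apply: etrans (etrans (homog_euler_sum sG hG Ap) (mul1r _)).
  by apply: eq_bigr => j _; exact: (congr1 ( *%R _) (derive_comm oA _ _ (sy _) Ap)).
have E2 : \sum_j \sum_k 'D_(e_ R l, 0) ('D_(0, e_ R j) ('D_(0, e_ R k) E)) p * p.2 0 j * p.2 0 k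
    = 2 * 'D_(e_ R l, 0) E p.
  have hG : homog 2 ('D_(e_ R l, 0) E) by exact: homog_dx sE homog_E.
  apply: etrans (homog_euler_sum (sx _) hG Ap); rewrite exchange_big /=.
  apply: eq_bigr => k _.
  have sG := smooth_derive (0, e_ R k) (sx (e_ R l)).
  have hG' : homog 1 ('D_(0, e_ R k) ('D_(e_ R l, 0) E)) by exact: homog_dy (sx _) hG.
  apply: etrans (congr1 ( *%R (p.2 0 k)) (etrans (homog_euler_sum sG hG' Ap) (mul1r _))).
  rewrite mulr_sumr; apply: eq_bigr => j _.
  apply: etrans (congr1 (fun r => r * _ * _)
    (derive_comm3 (e_ R l, 0) (0, e_ R j) (0, e_ R k) oA sE Ap)) _.
  exact: mul3_perm.
rewrite /bracket (derive_x_sum oA _ (sy _) Ap).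
rewrite (eq_bigr (fun j => (\sum_k p.2 0 k * (p.2 0 j * 'D_(e_ R k, 0) ('D_(0, e_ R j) ('D_(0, e_ R l) E)) p)) -
  2^-1 * \sum_k 'D_(e_ R l, 0) ('D_(0, e_ R j) ('D_(0, e_ R k) E)) p * p.2 0 j * p.2 0 k)); last first.
  move=> j _; rewrite mulr_sumr -sumrB; apply: eq_bigr => k _; rewrite !dgE.
  exact: bracket_perm.
rewrite sumrB -mulr_sumr E2 mulrA mulVf ?mul1r ?pnatr_eq0//; congr (_ - _).
by rewrite exchange_big; apply: eq_bigr => k _; rewrite -mulr_sumr E1.
Qed.

Lemma gmat_y p l : A p ->
  \sum_j gmat L p.1 p.2 l j * p.2 0 j = 2^-1 * 'D_(0, e_ R l) E p.
Proof.
move=> Ap; have sE := smooth_E.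
have hG : homog 1 ('D_(0, e_ R l) E) by exact: homog_dy sE homog_E.
have sG : smooth_on A ('D_(0, e_ R l) E) by exact: smooth_derive.
rewrite -[X in _ = _ * X](etrans (homog_euler_sum sG hG Ap) (mul1r _)).
rewrite mulr_sumr; apply: eq_bigr => j _.
rewrite gmatE -surjective_pairing.
apply: etrans (congr1 (fun r => _ * r * _) (derive_comm oA (0, e_ R l) (0, e_ R j) sE Ap)) _.
exact: mul3_perm'.
Qed.

Lemma spray_coefE p (f : R) : A p ->
  spray_coef L p.1 p.2 = f *: p.2 <->
  forall l, bracket (e_ R l) p = 2 * f * 'D_(0, e_ R l) E p.
Proof.
move=> Ap; have gu : gmat L p.1 p.2 \in unitmx by case: Ap => *; exact: gmat_unit.
pose b := \col_l bracket (e_ R l) p.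
have sE : (spray_coef L p.1 p.2)^T = 4^-1 *: (invmx (gmat L p.1 p.2) *m b).
  apply/colP => i; rewrite !mxE; congr (_ * _).
  by apply: eq_bigr => l _; rewrite bracketE// mxE.
have gy l : (gmat L p.1 p.2 *m (f *: p.2)^T) l 0 = 2^-1 * f * 'D_(0, e_ R l) E p.
  rewrite mxE (eq_bigr (fun j => f * (gmat L p.1 p.2 l j * p.2 0 j))).
    by rewrite -mulr_sumr gmat_y// mulrCA mulrA.
  by move=> j _; rewrite !mxE mulrCA.
split=> H.
- move=> l; have := congr1 (fun m => (gmat L p.1 p.2 *m m^T) l 0) H.
  rewrite sE -scalemxAr mulKVmx// gy !mxE => H'.
  by have := congr1 ( *%R 4) H'; set d := derive _ _ _; set c := bracket _ _; lra.
- apply: (can_inj (@trmxK _ _ _)); rewrite sE.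
  apply: (can_inj (mulKmx gu)); rewrite -scalemxAr mulKVmx//.
  apply/colP => l; rewrite gy !mxE H.
  by set d := derive _ _ _; lra.
Qed.

End Energy.

End SlitBundle.

(** * Inducing a radial spray is a transport equation; flatness *)

Section Spray.
Variables (R : realType) (n : nat).
Local Notation V := 'rV[R]_n.
Local Notation W := (V * V)%type.
Variable U : set V.
Hypothesis oU : open U.
Local Notation A := (slit U).
Let oA : open A := open_slit oU.
Variable F : W -> R.
Hypothesis sF : smooth_on A F.
Hypothesis FF : forall p v, A p -> 'D_(v, 0) F p = F p * 'D_(0, v) F p.
Hypothesis hF : homog U 1 F.
Implicit Types (x y u v : V) (p q w : W) (L : V -> V -> R).

Section Induces.
Variable L : V -> V -> R.
Hypothesis fL : finsler_metric U L.
Local Notation E := (energy L).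
Let sE : smooth_on A E := smooth_E oU fL.
Let hE : homog U 2 E := homog_E fL.
Let Lj : W -> R := fun p => L p.1 p.2.
Let sL : smooth_on A Lj := smooth_L fL.

Lemma bracket_sum v p : A p -> bracket L v p = \sum_l v 0 l * bracket L (e_ R l) p.
Proof.
move=> Ap; rewrite /bracket.
apply: etrans (congr2 (fun a b => a - b)
  (etrans (derive_comm oA (p.2, 0) (0, v) sE Ap)
     (derive_y_sum oA v (smooth_derive (p.2, 0) sE) Ap))
  (derive_x_sum oA v sE Ap)) _.
rewrite -sumrB; apply: eq_bigr => l _.
apply: etrans (esym (mulrBr _ _ _)) _.
exact: (congr1 (fun r => _ * (r - _)) (derive_comm oA (0, e_ R l) (p.2, 0) sE Ap)).
Qed.

Let S : W -> R := fun q => \sum_k q.2 0 k * 'D_(e_ R k, 0) E q.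

Let SE p : A p -> S p = 'D_(p.2, 0) E p.
Proof. by move=> Ap; exact: (esym (derive_x_sum oA _ sE Ap)). Qed.

(** Differentiating y^k E_(x^k) in y produces the two terms of the bracket with
equal signs; combined with their difference they separate. *)
Lemma derive_S v p : A p ->
  'D_(0, v) S p = 'D_(v, 0) E p + 'D_(p.2, 0) ('D_(0, v) E) p.
Proof.
move=> Ap; have sk k := smooth_derive (e_ R k, 0) sE.
have sm k := smoothM oA (smooth_snd_coord oA k) (sk k).
apply: etrans (derive_big oA _ (0, v) sm Ap) _.
apply: etrans (eq_bigr _ (fun k _ => derive_mul (0, v) (smooth_snd_coord oA k) (sk k) Ap)) _.
rewrite big_split /= addrC; congr (_ + _).
- apply: etrans _ (esym (derive_x_sum oA v sE Ap)); apply: eq_bigr => k _.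
  have -> : 'D_(0, v) (fun q : W => q.2 0 k) p = v 0 k.
    by have d := is_derive_snd_coord k p (0, v); exact: derive_val.
  exact: mulrC.
- apply: etrans _ (esym (derive_x_sum oA p.2 (smooth_derive (0, v) sE) Ap)).
  apply: eq_bigr => k _.
  exact: (congr1 ( *%R _) (derive_comm oA (0, v) (e_ R k, 0) sE Ap)).
Qed.

Let FE : W -> R := fun q => 4 * (F q * E q).

Let derive_FE v p : A p -> 'D_(0, v) FE p = 4 * (F p * 'D_(0, v) E p + E p * 'D_(0, v) F p).
Proof.
move=> Ap; have s4 := smooth_cst oA (4 : R).
apply: etrans (derive_mul (0, v) s4 (smoothM oA sF sE) Ap) _.
by rewrite derive_cst mulr0 addr0 (derive_mul (0, v) sF sE Ap).
Qed.

Lemma energy_eq_of_bracket (a b c d f e : R) : a + b = 4 * (f * c + e * d) -> b - a = 2 * f * c ->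
  a = f * c + 2 * e * d.
Proof. by move=> h1 h2; lra. Qed.

Lemma bracket_eq_of_energy (a b c d f e : R) : a + b = 4 * (f * c + e * d) ->
  a = f * c + 2 * e * d -> b - a = 2 * f * c.
Proof. by move=> h1 h2; lra. Qed.

Lemma euler_bracket_scalar (a b c : R) : 2 * a - a = 2 * b * (2 * c) -> a = 4 * (b * c).
Proof. by move=> h; lra. Qed.

Lemma euler_transport_scalar (b c : R) : b * (2 * c) + 2 * c * (1 * b) = 4 * (b * c).
Proof. by ring. Qed.

Lemma derive_sum_identity v p : (forall q, A q -> S q = 4 * (F q * E q)) -> A p ->
  'D_(v, 0) E p + 'D_(p.2, 0) ('D_(0, v) E) p =
  4 * (F p * 'D_(0, v) E p + E p * 'D_(0, v) F p).
Proof.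
move=> H Ap; apply: etrans (esym (derive_S v Ap)) (etrans _ (derive_FE v Ap)).
exact: (derive_ext oA (0, v) H Ap).
Qed.

(** The transport equation of L multiplied by 2 L, that is, written for the
energy E = L^2. *)
Definition energy_transport : Prop := forall p v, A p ->
  'D_(v, 0) E p = F p * 'D_(0, v) E p + 2 * E p * 'D_(0, v) F p.

(** Contracting either equation with y gives y^k E_(x^k) = 4 F E by Euler's identity.
The y-derivative of this scalar equation is the sum of the two terms of the
bracket, whereas the equation on the left is their difference. *)
Lemma bracket_energy :
  (forall p v, A p -> bracket L v p = 2 * F p * 'D_(0, v) E p) <-> energy_transport.
Proof.
split=> H p v Ap.
- apply: energy_eq_of_bracket (H p v Ap); apply: (derive_sum_identity v _ Ap) => q Aq.
  rewrite (SE Aq); have := H q q.2 Aq; rewrite /bracket.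
  have h1 := homog_euler (homog_dx oU q.2 sE hE) Aq.
  have h2 := homog_euler hE Aq.
  have h3 := derive_comm oA (q.2, 0) (0, q.2) sE Aq.
  rewrite (etrans h3 h1) h2; move: ('D_(q.2, 0) E q) (F q) (E q) => a b c.
  exact: euler_bracket_scalar.
- apply: bracket_eq_of_energy (H p v Ap); apply: (derive_sum_identity v _ Ap) => q Aq.
  rewrite (SE Aq) H// (homog_euler hE Aq) (homog_euler hF Aq).
  exact: euler_transport_scalar.
Qed.

Lemma derive_energy w p : A p -> 'D_w E p = 2 * Lj p * 'D_w Lj p.
Proof.
move=> Ap; apply: etrans (derive_ext oA w (f := fun q => Lj q * Lj q) _ Ap) _.
  by move=> q _; rewrite /energy expr2.
apply: etrans (derive_mul w sL sL Ap) _.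
by move: ('D_w _ _) (Lj p) => a b; ring.
Qed.

Lemma energy_eq_scalar (l x f y d : R) : l != 0 ->
  2 * l * x = f * (2 * l * y) + 2 * l ^+ 2 * d <-> x = f * y + l * d.
Proof.
move=> l0; have l2 : 2 * l != 0 by rewrite mulf_neq0 ?pnatr_eq0.
split=> [H|->]; last by ring.
by apply: (mulfI l2); rewrite H; ring.
Qed.

Lemma energy_transports : energy_transport <-> transports A F Lj.
Proof.
have key p v : A p ->
    ('D_(v, 0) E p = F p * 'D_(0, v) E p + 2 * E p * 'D_(0, v) F p) <->
    ('D_(v, 0) Lj p = 'D_(0, v) (fun q => F q * Lj q) p).
  move=> Ap; rewrite (derive_mul (0, v) sF sL Ap) !(derive_energy _ Ap).
  by apply: energy_eq_scalar; rewrite gt_eqF//; exact: (L_gt0 fL Ap).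
by split=> H p v Ap; apply/key => //; exact: H.
Qed.

(** The spray equation is linear in the bracket because the fundamental matrix is
invertible; the bracket equation is then the transport of the energy, and
dividing by 2 L gives that of L. *)
Lemma induces_transports : induces U L (fun x y => F (x, y) *: y) <-> transports A F Lj.
Proof.
apply: iff_trans energy_transports; apply: iff_trans bracket_energy.
split=> H.
- move=> p v Ap; have [Up p0] := Ap.
  have /(spray_coefE oU fL _ Ap) B := H _ _ Up p0.
  rewrite (bracket_sum v Ap) (eq_bigr _ (fun l _ => congr1 ( *%R _) (B l))).
  apply: etrans _ (congr1 ( *%R _) (esym (derive_y_sum oA v sE Ap))).
  rewrite mulr_sumr -surjective_pairing; apply: eq_bigr => l _; exact: mulrCA.
- move=> x y Ux y0; have Ap : A (x, y) by [].
  by apply/(spray_coefE oU fL _ Ap) => l; exact: H.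
Qed.

End Induces.

Lemma combine4 (a a' b b' c c' d d' : R) : a = a' -> b = b' -> c = c' -> d = d' ->
  2 * a - b + 2 * c - d = 2 * a' - b' + 2 * c' - d'.
Proof. by move=> -> -> -> ->. Qed.

Lemma riemannE (G : V -> V -> V) i k x y :
  let g j := fun p : W => G p.1 p.2 0 j in
  riemann G i k x y = 2 * 'D_(e_ R k, 0) (g i) (x, y)
  - \sum_j y 0 j * 'D_(e_ R j, 0) ('D_(0, e_ R k) (g i)) (x, y)
  + 2 * \sum_j G x y 0 j * 'D_(0, e_ R j) ('D_(0, e_ R k) (g i)) (x, y)
  - \sum_j 'D_(0, e_ R j) (g i) (x, y) * 'D_(0, e_ R k) (g j) (x, y).
Proof.
move=> g; apply: combine4; first exact: dxE.
- by apply: eq_bigr => j _; rewrite dxE dy_uncurry.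
- by apply: eq_bigr => j _; rewrite dyE dy_uncurry.
- by apply: eq_bigr => j _; rewrite !dyE.
Qed.

Lemma riemann_uncurry (G : V -> V -> V) (g : 'I_n -> W -> R) i k x y :
  (forall j, (fun p : W => G p.1 p.2 0 j) = g j) ->
  riemann G i k x y = 2 * 'D_(e_ R k, 0) (g i) (x, y)
  - \sum_j y 0 j * 'D_(e_ R j, 0) ('D_(0, e_ R k) (g i)) (x, y)
  + 2 * \sum_j g j (x, y) * 'D_(0, e_ R j) ('D_(0, e_ R k) (g i)) (x, y)
  - \sum_j 'D_(0, e_ R j) (g i) (x, y) * 'D_(0, e_ R k) (g j) (x, y).
Proof.
move=> gE; have <- : (fun j p => G p.1 p.2 0 j) = g by apply/funext.
exact: riemannE.
Qed.

Lemma riemann_ext (G G' : V -> V -> V) i k x y : A (x, y) ->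
  (forall p, A p -> G p.1 p.2 = G' p.1 p.2) -> riemann G i k x y = riemann G' i k x y.
Proof.
move=> Ap GG; rewrite !riemannE /=.
have g j q : A q -> G q.1 q.2 0 j = G' q.1 q.2 0 j by move=> Aq; rewrite GG.
have g1 j w q : A q -> 'D_w (fun p : W => G p.1 p.2 0 j) q =
    'D_w (fun p : W => G' p.1 p.2 0 j) q by move=> Aq; exact: (derive_ext oA w (g j) Aq).
have g2 j w w' q : A q -> 'D_w ('D_w' (fun p : W => G p.1 p.2 0 j)) q =
    'D_w ('D_w' (fun p : W => G' p.1 p.2 0 j)) q.
  by move=> Aq; exact: (derive_ext oA w (g1 j w') Aq).
apply: combine4; first exact: g1.
- by apply: eq_bigr => j _; exact: (congr1 ( *%R _) (g2 i _ _ _ Ap)).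
- by apply: eq_bigr => j _; exact: (congr2 ( *%R) (g j _ Ap) (g2 i _ _ _ Ap)).
- by apply: eq_bigr => j _; exact: (congr2 ( *%R) (g1 i _ _ Ap) (g1 j _ _ Ap)).
Qed.

Lemma flat_algebra (f h d y dl : R) : h = f * dl + y * d ->
  2 * (f * (h - f * dl)) - f * h + 2 * (f * h) - (f * h + d * (2 * (f * y))) = 0.
Proof. by move=> ->; ring. Qed.

Lemma mixed_derivative_scalar (f h d y b : R) : b = 2 * (f * y) -> f * (h - d * y) + (b - f * y) * d = f * h.
Proof. by move=> ->; ring. Qed.

Lemma distr_perm (a f e y d : R) : a * (f * e + y * d) = f * (e * a) + d * (y * a).
Proof. by ring. Qed.

(** With G = F y and F_x = F F_y, every term is expressed by F, y and the y-gradient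
of F, thanks to the homogeneity of G and of its y-derivatives; the four
contributions cancel. *)
Lemma riemann_flat i k x y : A (x, y) ->
  riemann (fun x y => F (x, y) *: y) i k x y = 0.
Proof.
move=> Ap; set p : W := (x, y).
pose g j : W -> R := fun q => F q * q.2 0 j.
have gE j : (fun q : W => (F (q.1, q.2) *: q.2) 0 j) = g j.
  by apply/funext => q; rewrite mxE -surjective_pairing.
have sc j := smooth_snd_coord oA j.
have sg j : smooth_on A (g j) := smoothM oA sF (sc j).
have hg j : homog U 2 (g j).
  by move=> q a Aq a0; rewrite /g hF//= mxE; ring.
have cx j v q : 'D_(v, 0) (fun q : W => q.2 0 j) q = 0.
  have d := is_derive_snd_coord j q (v, 0).
  by apply: etrans (@derive_val _ _ _ _ _ _ _ d) _; rewrite /= mxE.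
have cy j v q : 'D_(0, v) (fun q : W => q.2 0 j) q = v 0 j.
  by have d := is_derive_snd_coord j q (0, v); exact: derive_val.
have gy j v q : A q -> 'D_(0, v) (g j) q = F q * v 0 j + q.2 0 j * 'D_(0, v) F q.
  by move=> Aq; apply: etrans (derive_mul (0, v) sF (sc j) Aq) _; rewrite cy.
have gx j v q : A q -> 'D_(v, 0) (g j) q = F q * ('D_(0, v) (g j) q - F q * v 0 j).
  move=> Aq; apply: etrans (derive_mul (v, 0) sF (sc j) Aq) _.
  rewrite cx (FF v Aq) (gy j v q Aq); move: ('D_(0, v) F q) (F q) (q.2 0 j) (v 0 j) => *; ring.
rewrite (riemann_uncurry i k x y gE) -/p.
have sH := smooth_derive (0, e_ R k) (sg i).
have hH : homog U 1 ('D_(0, e_ R k) (g i)) := homog_dy oU (e_ R k) (sg i) (hg i).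
set H := 'D_(0, e_ R k) (g i) in sH hH *.
have Hy : 'D_(0, y) H p = H p by exact: (etrans (homog_euler hH Ap) (mul1r _)).
have gyy : 'D_(0, y) (g i) p = 2 * (F p * y 0 i) by exact: (homog_euler (hg i) Ap).
set d := 'D_(0, e_ R k) F p.
have Hp : H p = F p * (e_ R k) 0 i + y 0 i * d by exact: (gy i (e_ R k) p Ap).
have T1 : 'D_(e_ R k, 0) (g i) p = F p * (H p - F p * (e_ R k) 0 i) := gx i (e_ R k) p Ap.
have T2 : \sum_j y 0 j * 'D_(e_ R j, 0) H p = F p * H p.
  apply: etrans (esym (derive_x_sum oA y sH Ap)) _.
  apply: etrans (derive_comm oA (y, 0) (0, e_ R k) (sg i) Ap) _.
  apply: etrans (derive_ext oA (0, e_ R k) (gx i y) Ap) _.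
  have sy := smooth_derive (0, y) (sg i).
  have sFy : smooth_on A (fun q => F q * y 0 i) := smoothM oA sF (smooth_cst oA _).
  have sD : smooth_on A (fun q => 'D_(0, y) (g i) q - F q * y 0 i).
    apply: (smooth_ext oA (f := fun q => 'D_(0, y) (g i) q + (-1) * (F q * y 0 i))).
      exact: (smoothD oA sy (smoothM oA (smooth_cst oA _) sFy)).
    by move=> q _; rewrite mulN1r.
  apply: etrans (derive_mul (0, e_ R k) sF sD Ap) _.
  have -> : 'D_(0, e_ R k) (fun q => 'D_(0, y) (g i) q - F q * y 0 i) p = H p - d * y 0 i.
    apply: etrans (deriveB _ _) _.
    - exact: smooth_derivable sy Ap.
    - exact: smooth_derivable sFy Ap.
    congr (_ - _).
      exact: etrans (derive_comm oA (0, e_ R k) (0, y) (sg i) Ap) Hy.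
    apply: etrans (derive_mul (0, e_ R k) sF (smooth_cst oA (y 0 i)) Ap) _.
    by rewrite derive_cst mulr0 add0r mulrC.
  exact: (mixed_derivative_scalar _ _ gyy).
have T3 : \sum_j g j p * 'D_(0, e_ R j) H p = F p * H p.
  apply: etrans (congr1 ( *%R _) (etrans (esym (derive_y_sum oA y sH Ap)) Hy)).
  by rewrite mulr_sumr; apply: eq_bigr => j _; exact: esym (mulrA _ _ _).
have T4 : \sum_j 'D_(0, e_ R j) (g i) p * 'D_(0, e_ R k) (g j) p =
    F p * H p + d * (2 * (F p * y 0 i)).
  apply: etrans (eq_bigr _ (fun j _ => congr1 ( *%R _) (gy j (e_ R k) p Ap))) _.
  rewrite -gyy.
  apply: etrans _ (esym (congr2 (fun a b => _ * a + d * b)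
    (derive_y_sum oA (e_ R k) (sg i) Ap) (derive_y_sum oA y (sg i) Ap))).
  rewrite !mulr_sumr -big_split /=; apply: eq_bigr => j _.
  exact: distr_perm.
exact: (etrans (combine4 T1 T2 T3 T4) (flat_algebra Hp)).
Qed.

Lemma spray_zero_flag L : finsler_metric U L -> transports A F (fun p => L p.1 p.2) ->
  zero_flag_curvature U L.
Proof.
move=> fL /(induces_transports fL) ind x y u Ux fr.
have y0 : y != 0 by apply: free_not0 fr _; rewrite mem_head.
rewrite /flag_curvature (_ : gform _ _ _ _ _ = 0) ?mul0r//.
rewrite /gform big1// => i _; rewrite big1// => j _.
suff -> : riemann_op (spray_coef L) x y u 0 i = 0 by rewrite mulr0 mul0r.
rewrite mxE big1// => k _.
rewrite (@riemann_ext _ (fun x y => F (x, y) *: y)) ?riemann_flat ?mul0r//.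
by move=> [x' y'] [Ux' y'0] /=; exact: ind.
Qed.

End Spray.

(** * Straight geodesics and Taylor coefficients *)

Section Straight.
Variables (R : realType) (n : nat).
Local Notation V := 'rV[R]_n.

Lemma is_derive_coord (c : R -> V) t j : derivable c t 1 ->
  is_derive t (1 : R) (fun s => c s 0 j) (derive1 c t 0 j).
Proof.
move=> dc; have dj := (@derivable_mxP R R^o 1 n c t 1).1 dc 0 j.
by apply: DeriveDef; [exact: dj|rewrite derive1E derive_mx// mxE].
Qed.

Lemma is_derive_cross (c : R -> V) t (v : V) i j : derivable c t 1 ->
  is_derive t (1 : R) (fun s => c s 0 j * v 0 i - c s 0 i * v 0 j)
    (derive1 c t 0 j * v 0 i - derive1 c t 0 i * v 0 j).
Proof.
move=> dc; have di := is_derive_coord i dc; have dj := is_derive_coord j dc.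
have d1 := is_deriveM dj (is_derive_cst (v 0 i) t (1 : R)).
have d2 := is_deriveM di (is_derive_cst (v 0 j) t (1 : R)).
apply: is_derive_eq (is_deriveB d1 d2) _.
rewrite !scaler0 !add0r [v 0 i *: _]mulrC [v 0 j *: _]mulrC.
by [].
Qed.

Lemma cross_algebra (l a b c d h : R) : h = a * b - c * d ->
  h * (- l * a * b - - l * c * d) + h * (- l * a * b - - l * c * d) = - (2 * l * (h * h)).
Proof. by move=> ->; ring. Qed.

(** For a fixed velocity v at time t1 let h(t) be a component of the cross product
of c'(t) with v.  Then (h^2)' = - 2 lam h^2 <= 0 and h(t1) = 0, so h vanishes at
later times.  Hence all velocities are parallel, without integrating lam, which is
not assumed continuous. *)
Lemma straight_line (c : R -> V) (lam : R -> R) (a b : R) : a < b ->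
  (forall t, a < t < b -> [/\ derivable c t 1, derivable (derive1 c) t 1,
    derive1 c t != 0, 0 <= lam t & derive1 (derive1 c) t = - lam t *: derive1 c t]) ->
  exists p v, v != 0 /\ forall t, a < t < b -> exists s, c t = p + s *: v.
Proof.
move=> ab H.
have mid t1 t2 t : a < t1 < b -> a < t2 < b -> t1 <= t <= t2 -> a < t < b.
  by move=> /andP[? ?] /andP[? ?] /andP[? ?]; lra.
have fwd t1 t2 i j : a < t1 < b -> a < t2 < b -> t1 <= t2 ->
    derive1 c t2 0 j * derive1 c t1 0 i = derive1 c t2 0 i * derive1 c t1 0 j.
  move=> ht1 ht2 t12; set v := derive1 c t1.
  pose h s := derive1 c s 0 j * v 0 i - derive1 c s 0 i * v 0 j.
  have dh t : t1 <= t <= t2 -> is_derive t (1 : R) (fun s => h s * h s) (- (2 * lam t * (h t * h t))).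
    move=> /(mid _ _ _ ht1 ht2) /H [_ dc _ _ E].
    have d := is_derive_cross v i j dc; rewrite -/h in d.
    apply: is_derive_eq (is_deriveM d d) _; rewrite E !mxE.
    exact: (@cross_algebra _ _ _ _ _ (h t) erefl).
  have [||s] := @MVT_segment R (fun s => h s * h s) (fun t => - (2 * lam t * (h t * h t))) t1 t2 t12.
  - by move=> t; rewrite in_itv /= => /andP[? ?]; apply: dh; rewrite !ltW.
  - by apply: derivable_within_continuous => t; rewrite in_itv /= => /dh [].
  rewrite in_itv /= => hs; have [_ _ _ ls _] := H _ (mid _ _ _ ht1 ht2 hs).
  have -> : h t1 = 0 by rewrite /h /v mulrC subrr.
  rewrite mul0r subr0 => hE.
  have h0 : h t2 * h t2 <= 0.
    have hh : 0 <= h s * h s by rewrite -expr2 sqr_ge0.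
    by rewrite hE mulNr oppr_le0 mulr_ge0 ?subr_ge0// mulr_ge0// mulr_ge0.
  have : h t2 ^+ 2 == 0 by rewrite eq_le sqr_ge0 expr2 h0.
  by rewrite sqrf_eq0 subr_eq0 => /eqP.
have par t1 t2 i j : a < t1 < b -> a < t2 < b ->
    derive1 c t2 0 j * derive1 c t1 0 i = derive1 c t2 0 i * derive1 c t1 0 j.
  move=> h1 h2; case: (leP t1 t2) => [|/ltW] t12; first exact: fwd.
  by rewrite mulrC -(fwd t2 t1)// mulrC.
pose t0 := (a + b) / 2.
have ht0 : a < t0 < b by rewrite /t0; apply/andP; split; lra.
(* The cross products with the velocity at t0 are constant along c, and a
   coordinate i with nonzero velocity gives the parameter on the line. *)
exists (c t0), (derive1 c t0); have [_ _ v0 _ _] := H _ ht0; split=> // t ht.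
have [i vi] : exists i, derive1 c t0 0 i != 0.
  apply/existsP; apply: contraT; rewrite negb_exists => /forallP allz.
  by case/eqP: v0; apply/rowP => i; apply/eqP; have := allz i; rewrite negbK mxE.
set v := derive1 c t0 in vi v0 *.
have cst j : c t 0 j * v 0 i - c t 0 i * v 0 j = c t0 0 j * v 0 i - c t0 0 i * v 0 j.
  have seg s : t0 <= s <= t \/ t <= s <= t0 -> a < s < b.
    by case=> [/(mid _ _ _ ht0 ht)|/(mid _ _ _ ht ht0)].
  have d s : t0 <= s <= t \/ t <= s <= t0 -> is_derive s (1 : R)
     (fun s => c s 0 j * v 0 i - c s 0 i * v 0 j) 0.
    move=> /seg hs; have [dc _ _ _ _] := H _ hs.
    apply: is_derive_eq (is_derive_cross v i j dc) _.
    by rewrite (par t0 s i j)// subrr.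
  case: (leP t0 t) => [|/ltW] tt.
  - have [||s _] := @MVT_segment R (fun s => c s 0 j * v 0 i - c s 0 i * v 0 j) (fun=> 0) t0 t tt.
    + by move=> s; rewrite in_itv /= => /andP[? ?]; apply: d; left; rewrite !ltW.
    + apply: derivable_within_continuous => s; rewrite in_itv /= => hs.
      by have [] := d s (or_introl hs).
    by rewrite mul0r => /eqP; rewrite subr_eq0 => /eqP.
  - have [||s _] := @MVT_segment R (fun s => c s 0 j * v 0 i - c s 0 i * v 0 j) (fun=> 0) t t0 tt.
    + by move=> s; rewrite in_itv /= => /andP[? ?]; apply: d; right; rewrite !ltW.
    + apply: derivable_within_continuous => s; rewrite in_itv /= => hs.
      by have [] := d s (or_intror hs).
    by rewrite mul0r => /eqP; rewrite subr_eq0 => /eqP/esym.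
exists ((c t 0 i - c t0 0 i) / v 0 i); apply/rowP => j; rewrite !mxE.
apply: (mulIf vi); rewrite mulrDl mulrAC divfK//.
by have := cst j; lra.
Qed.

End Straight.

Section HomogeneousLine.
Variable R : realType.

(** The difference quotients at a t and at t are homothetic, so they converge
together; if they diverge, both derivatives are 0 by convention. *)
Lemma derive1_homog (f : R -> R) k :
  (forall a t, 0 < a -> f (a * t) = a ^+ k.+1 * f t) ->
  forall a t, 0 < a -> derive1 f (a * t) = a ^+ k * derive1 f t.
Proof.
move=> hf; pose q t := fun h : R => h^-1 *: (f (h + t) - f t).
have qE a t : 0 < a -> q (a * t) = fun h => a ^+ k * q t (a^-1 * h).
  move=> a0; have aN : a != 0 by rewrite gt_eqF.
  apply/funext => h; rewrite /q.
  rewrite (_ : h + a * t = a * (a^-1 * h + t)); last first.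
    by rewrite mulrDr mulrA divff ?mul1r.
  rewrite !hf// -mulrBr -[LHS]/(h^-1 * _) -[_ *: (_ - _)]/(_ * _).
  rewrite invfM invrK exprSr; ring.
have sc a : 0 < a -> (a^-1 * h) @[h --> (0 : R)^'] --> (0 : R)^'.
  move=> a0 B [e /= e0 eB]; exists (e * a) => /=; first by rewrite mulr_gt0.
  move=> h /= hh h0; apply: eB; last by rewrite mulf_neq0// invr_eq0 gt_eqF.
  move: hh; rewrite /= !sub0r !normrN normrM gtr0_norm ?invr_gt0//.
  by move=> hh; rewrite [_ * `|h|]mulrC ltr_pdivrMr.
(* The step h is rescaled to h / a, which preserves the punctured neighbourhoods of 0. *)
have qc a t l : 0 < a -> q t h @[h --> (0 : R)^'] --> l ->
    q (a * t) h @[h --> (0 : R)^'] --> a ^+ k * l.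
  move=> a0 cl; rewrite qE//; apply: cvgM; first exact: cvg_cst.
  exact: (cvg_comp _ _ (sc a a0) cl).
move=> a t a0; rewrite /derive1 -/(q (a * t)) -/(q t).
have [ct|nct] := pselect (cvg (q t h @[h --> (0 : R)^'])).
  by apply: cvg_lim => //; exact: qc.
have nat' : ~ cvg (q (a * t) h @[h --> (0 : R)^']).
  move=> cat; apply: nct; have a0' : 0 < a^-1 by rewrite invr_gt0.
  have := qc _ _ _ a0' cat; rewrite mulrA mulVf ?gt_eqF// mul1r.
  by move=> /cvgP.
have e1 : lim (q (a * t) h @[h --> (0 : R)^']) = 0 :> R := dvgP nat'.
have e2 : lim (q t h @[h --> (0 : R)^']) = 0 :> R := dvgP nct.
by apply: etrans e1 _; apply/esym; apply: etrans (congr1 ( *%R _) e2) _; exact: mulr0.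
Qed.

(** At each order the derivative is homogeneous of positive degree, hence zero
at 0.  This applies to functions such as phi (t x)^m psi (t x), which need not
be differentiable at 0. *)
Lemma derive1n_homog (f : R -> R) m :
  (forall a t, 0 < a -> f (a * t) = a ^+ m.+1 * f t) -> derive1n m f 0 = 0.
Proof.
move=> hf; suff H k : (k <= m)%N -> forall a t, 0 < a ->
    derive1n k f (a * t) = a ^+ (m - k).+1 * derive1n k f t.
  have := H m (leqnn _) 2 0 (ltr0Sn _ _); rewrite mulr0 subnn expr1.
  by lra.
elim: k => [_|k IH km]; first by rewrite subn0; exact: hf.
rewrite derive1nS; apply: derive1_homog => a t a0.
by rewrite IH ?(ltnW km)// subnSK.
Qed.

End HomogeneousLine.

Lemma derive_iter_comm (R : realType) (V : normedModType R) (A : set V) f vs (u p : V) :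
  open A -> smooth_on A f -> A p ->
  'D_u (iter_derive vs f) p = iter_derive vs ('D_u f) p :> R.
Proof.
move=> oA sf; elim: vs p => //= v vs IH p Ap.
apply: etrans (derive_comm oA u v (smooth_iter_derive vs sf) Ap) _.
exact: (derive_ext oA v IH Ap).
Qed.

Lemma nseq_rcons (T : Type) m (w : T) : rcons (nseq m w) w = nseq m.+1 w.
Proof. by elim: m => //= m ->. Qed.

Section TaylorTransport.
Variables (R : realType) (n : nat).
Local Notation V := 'rV[R]_n.
Local Notation W := (V * V)%type.
Variable U : set V.
Hypothesis oU : open U.
Local Notation A := (slit U).
Let oA : open A := open_slit oU.
Variable F : W -> R.
Hypothesis sF : smooth_on A F.
Hypothesis FF : forall p v, A p -> 'D_(v, 0) F p = F p * 'D_(0, v) F p.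
Implicit Types (x y u v : V) (p q w : W) (L : W -> R).

Lemma transport_algebra (x l f d : R) : x + l * (f * d) = x + f * l * d.
Proof. by ring. Qed.

Lemma transports_mulF L : smooth_on A L -> transports A F L ->
  transports A F (fun q => F q * L q).
Proof.
move=> sL tL p v Ap.
apply: etrans (derive_mul (v, 0) sF sL Ap) _.
apply: etrans (congr2 (fun a b => F p * a + L p * b) (tL p v Ap) (FF v Ap)) _.
apply: etrans _ (esym (derive_mul (0, v) sF (smoothM oA sF sL) Ap)).
exact: transport_algebra.
Qed.

Lemma transports_pow L m : smooth_on A L -> transports A F L ->
  transports A F (fun q => F q ^+ m * L q).
Proof.
move=> sL tL; elim: m => [|m IH].
  by under eq_fun do rewrite expr0 mul1r.
have sm := smoothM oA (smoothX oA m sF) sL.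
rewrite (_ : (fun q => _) = (fun q => F q * (F q ^+ m * L q))).
  exact: transports_mulF sm IH.
by apply/funext => q; rewrite exprS mulrA.
Qed.

(** Each x-derivative is traded for a y-derivative at the price of a factor F, and
F^m L is again transported. *)
Lemma taylor_transport L m x y t : smooth_on A L -> transports A F L ->
  U (t *: x) -> y != 0 ->
  derive1n m (fun s : R => L (s *: x, y)) t =
  iter_derive (nseq m (0, x)) (fun q => F q ^+ m * L q) (t *: x, y).
Proof.
move=> sL tL Ut y0; elim: m t Ut => [|m IH] t Ut.
  by rewrite /= expr0 mul1r.
have lineE s : (0, y) + s *: (x, 0) = (s *: x, y) :> W.
  by congr pair; rewrite /= ?scaler0 ?addr0 ?add0r.
have At : A ((0, y) + t *: (x, 0)) by rewrite lineE.
have nA : \forall s \near t, A ((0, y) + s *: (x, 0)).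
  have : ((0, y) + s *: (x, 0) : W) @[s --> t] --> ((0, y) + t *: (x, 0) : W).
    by apply: cvgD; [exact: cvg_cst|apply: cvgZr_tmp; exact: cvg_id].
  by move=> c; exact: (c _ (nearA oA At)).
set g := iter_derive (nseq m (0, x)) (fun q => F q ^+ m * L q).
have sm := smoothM oA (smoothX oA m sF) sL.
have E1 : derive1n m.+1 (fun s : R => L (s *: x, y)) t =
    derive1 (fun s => g ((0, y) + s *: (x, 0))) t.
  rewrite derive1nS !derive1E; apply: near_eq_derive; near=> s.
  rewrite lineE; apply: IH.
  have [] : A ((0, y) + s *: (x, 0)) by near: s; exact: nA.
  by rewrite lineE.
apply: etrans E1 _; apply: etrans (derive1_line g _ _ _) _; rewrite lineE.
have At' : A (t *: x, y) by [].
apply: etrans (derive_iter_comm _ _ oA sm At') _.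
apply: etrans (iter_derive_ext oA _ (fun q Aq => transports_pow m sL tL x Aq) At') _.
rewrite -iter_derive_rcons nseq_rcons; congr (iter_derive _ _ _).
by apply/funext => q; rewrite exprS mulrA.
Unshelve. all: by end_near. Qed.

End TaylorTransport.

(** * The Funk spray: reformulation and uniqueness along characteristics *)

Lemma derive1n_near (R : realType) (f g : R -> R) m t :
  (\forall s \near t, f s = g s) -> derive1n m f t = derive1n m g t.
Proof.
move=> fg; suff : \forall s \near t, derive1n m f s = derive1n m g s by exact: nbhs_singleton.
elim: m => [//|m IH].
have : nbhs t (interior [set s | derive1n m f s = derive1n m g s]) by exact: nbhs_interior.
apply: filterS => s ns; rewrite !derive1nS !derive1E.
exact: near_eq_derive.
Qed.

Lemma derive1n_cst0 (R : realType) m t : derive1n m (fun=> 0 : R) t = 0.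
Proof.
elim: m t => // m IH t; rewrite derive1nS derive1E.
rewrite (_ : derive1n m (fun=> 0 : R) = fun=> 0); first exact: derive_cst.
by apply/funext => s; exact: IH.
Qed.

Section FunkSpray.
Variables (R : realType) (n : nat).
Local Notation V := 'rV[R]_n.
Local Notation W := (V * V)%type.
Variable phi : V -> R.
Hypothesis hphi : minkowski_norm phi.
Local Notation funkp := (funkp phi).
Local Notation Gt := (fun x y : V => funk phi x y *: y).
Implicit Types (x y z u v : V) (p q w : W) (L : V -> V -> R).

Section Domain.
Variable U : set V.
Hypotheses (oU : open U) (UO : U `<=` Omega phi).
Local Notation A := (slit U).
Let oA : open A := open_slit oU.

Lemma slit_funk_dom p : A p -> funk_dom phi p.
Proof. by move=> [Up p0]; split=> //; exact: UO. Qed.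

Lemma smooth_funk : smooth_on A funkp.
Proof. by move=> vs p /slit_funk_dom; exact: (smooth_funkp hphi). Qed.

(** Equation (1) for F itself. *)
Lemma funk_FF p v : A p -> 'D_(v, 0) funkp p = funkp p * 'D_(0, v) funkp p.
Proof. by move=> /slit_funk_dom; exact: (funk_transport hphi). Qed.

Lemma homog_funk : homog U 1 funkp.
Proof. by move=> p a [Up p0] a0; rewrite expr1; apply: funkZ => //; exact: UO. Qed.

Lemma induces_funk L : finsler_metric U L ->
  induces U L Gt <-> transports A funkp (fun p => L p.1 p.2).
Proof. by move=> fL; exact: (induces_transports oU smooth_funk homog_funk fL). Qed.

Lemma zero_flag_funk L : finsler_metric U L -> transports A funkp (fun p => L p.1 p.2) ->
  zero_flag_curvature U L.
Proof. exact: (spray_zero_flag oU smooth_funk funk_FF homog_funk). Qed.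

Lemma projectively_flat_funk L : induces U L Gt -> projectively_flat U L.
Proof.
move=> ind a b c ab geo.
apply: (straight_line (lam := fun t => 2 * funkp (c t, derive1 c t))) => // t ht.
have [Uc dc ddc c0 E] := geo t ht; split=> //.
  by rewrite mulr_ge0//; apply: (funk_ge0 hphi); exact: UO.
by rewrite E (ind _ _ Uc c0) scalerA scaleNr.
Qed.

Lemma series_term0 (psi : V -> R) x m :
  (forall (a : R) z, 0 < a -> psi (a *: z) = a * psi z) ->
  series_term phi psi x 0 m = 0.
Proof.
move=> psiZ; rewrite /series_term derive1n_homog ?mulr0// => a t a0.
rewrite !add0r -scalerA (phiZ hphi)// psiZ// exprMn exprS; ring.
Qed.

(** At x = 0 the Funk metric is phi, so the traded derivatives are those of
phi^m L(0, .); the direction y = 0 is treated apart, both sides being zero by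
homogeneity. *)
Lemma taylor_funk L : U 0 -> finsler_metric U L -> transports A funkp (fun p => L p.1 p.2) ->
  taylor_expansion phi (L 0) L.
Proof.
move=> U0 fL tL x y m; have [mL _] := fL.
have [->|y0] := eqVneq y 0.
  rewrite series_term0; last by move=> a z; exact: (phiZ (mL 0 U0)).
  rewrite (_ : derive1n _ _ _ = 0) ?mulr0//.
  rewrite (@derive1n_near _ _ (fun=> 0)) ?derive1n_cst0//.
  have Ux : U (0 + 0 *: x) by rewrite scale0r addr0.
  have := near_line x oU Ux; apply: filterS => s; rewrite scale0r !add0r => Us.
  exact: (phi0 (mL _ Us)).
rewrite /series_term; congr (_ * _).
have U0x : U (0 *: x) by rewrite scale0r.
apply: etrans (taylor_transport oU smooth_funk funk_FF m (smooth_L fL) tL U0x y0) _.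
set g := (fun q => _).
have gE t : g ((0, y) + t *: (0, x)) = phi (y + t *: x) ^+ m * L 0 (y + t *: x).
  rewrite (_ : (0, y) + t *: (0, x) = (0, y + t *: x)); last first.
    by congr pair; rewrite /= scaler0 addr0.
  by rewrite /g /funkp /= (funk_at0 hphi).
rewrite -(_ : (fun t => g ((0, y) + t *: (0, x))) = (fun t => phi (y + t *: x) ^+ m * L 0 (y + t *: x))); last by apply/funext.
apply/esym; apply: etrans (derive1n_line g (0, y) (0, x) m 0) _.
by rewrite !scale0r addr0.
Qed.

Lemma char_quotient (l1 l2 d : R) : l2 != 0 ->
  l1 *: (- l2 ^- 2 *: (l2 * d)) + l2^-1 *: (l1 * d) = 0.
Proof.
by move=> l0; rewrite -[LHS]/(l1 * (- l2 ^- 2 * (l2 * d)) + l2^-1 * (l1 * d)); field.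
Qed.

Lemma char_derive (a b f l d : R) : a = f * b + l * d -> a + - f * b = l * d.
Proof. by move=> ->; ring. Qed.

(** On the segment t |-> (t x, z - t F x) issued from (0, z), with z the exit point
of (x, y), F is constant and every solution satisfies L' = L D_(0,x) F.  The
quotient of two solutions is therefore constant from t = 0, where they agree, to
t = 1, which is the point (x, y). *)
Lemma char_unique (L1 L2 : W -> R) x y :
  smooth_on A L1 -> smooth_on A L2 -> transports A funkp L1 -> transports A funkp L2 ->
  (forall p, A p -> L2 p != 0) ->
  (forall t : R, 0 <= t <= 1 -> U (t *: x)) -> y != 0 ->
  (forall z, z != 0 -> L1 (0, z) = L2 (0, z)) -> L1 (x, y) = L2 (x, y).
Proof.
move=> s1 s2 t1 t2 L2n Ux y0 L12.
have x1 : phi x < 1 by apply: UO; rewrite -[x]scale1r; apply: Ux; rewrite ler01 lexx.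
pose c := funk phi x y; pose z := y + c *: x.
have c0 : 0 < c := funk_gt0 hphi x1 y0.
have pz : phi z = c := funkP hphi y x1.
have z0 : z != 0 by apply/eqP => z0; move: c0; rewrite -pz z0 phi0// ltxx.
pose w : W := (x, - c *: x).
have gE (t : R) : (0, z) + t *: w = (t *: x, z - (t * c) *: x) :> W.
  by congr pair; rewrite /= ?add0r// scalerA mulrN scaleNr.
have Fg (t : R) : 0 <= t <= 1 -> funkp ((0, z) + t *: w) = c.
  move=> t01; rewrite gE; apply: (funk_unique hphi); first exact: (UO (Ux t t01)).
  by rewrite /= scalerA [c * t]mulrC subrK.
have Ag (t : R) : 0 <= t <= 1 -> A ((0, z) + t *: w).
  move=> t01; rewrite gE; split=> /=; first exact: Ux.
  have /andP[t0 tl1] := t01.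
  apply/eqP => E; have zE : z = (t * c) *: x by apply/eqP; rewrite -subr_eq0 E.
  move: t0; rewrite le_eqVlt => /predU1P[t0|t0].
    by move: z0; rewrite zE -t0 mul0r scale0r eqxx.
  have : c = t * c * phi x by rewrite -(phiZ hphi) ?mulr_gt0// -zE.
  have : t * c * phi x < c.
    rewrite -mulrA mulrCA gtr_pMr//.
    have := phi_ge0 hphi x => p0.
    apply: le_lt_trans x1; rewrite -[leRHS]mul1r ler_wpM2r//.
  by move=> h1 h2; move: h1; rewrite -h2 ltxx.
have dL (K : W -> R) (t : R) : smooth_on A K -> transports A funkp K -> 0 <= t <= 1 ->
    'D_w K ((0, z) + t *: w) = K ((0, z) + t *: w) * 'D_(0, x) funkp ((0, z) + t *: w).
  move=> sK tK t01; have At := Ag t t01; set p := (0, z) + t *: w.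
  have wE : w = (x, 0) + (- c) *: (0, x) :> W.
    by congr pair; rewrite /= ?scaler0 ?addr0 ?add0r.
  rewrite {1}wE; apply: etrans (deriveDr oA _ _ sK At) _.
  apply: etrans (congr1 (fun r => _ + r) (deriveZr oA _ _ sK At)) _.
  apply: char_derive.
  apply: etrans (tK _ x At) _; apply: etrans (derive_mul (0, x) smooth_funk sK At) _.
  by rewrite Fg.
pose r (p : W) := L1 p * (L2 p)^-1.
have dr (t : R) : 0 <= t <= 1 -> is_derive t (1 : R) (fun t => r ((0, z) + t *: w)) 0.
  move=> t01; have At := Ag t t01.
  have d1 : derivable L1 ((0, z) + t *: w) w := smooth_derivable s1 At.
  have d2 : derivable L2 ((0, z) + t *: w) w := smooth_derivable s2 At.
  have d2' : derivable (fun q => (L2 q)^-1) ((0, z) + t *: w) w := derivableV (L2n _ At) d2.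
  have dr0 : derivable r ((0, z) + t *: w) w := derivableM d1 d2'.
  apply: is_derive_eq (is_derive_line dr0) _.
  apply: etrans (deriveM d1 d2') _.
  rewrite (deriveV (L2n _ At) d2) (dL L1 t s1 t1 t01) (dL L2 t s2 t2 t01).
  by apply: char_quotient; exact: L2n.
have [||s _] := @MVT_segment R (fun t => r ((0, z) + t *: w)) (fun=> 0) 0 1 ler01.
- by move=> t; rewrite in_itv /= => /andP[h1 h2]; apply: dr; rewrite !ltW.
- by apply: derivable_within_continuous => t; rewrite in_itv /= => /dr [].
rewrite mul0r scale0r addr0 => /eqP; rewrite subr_eq0 => /eqP.
have A0 : A (0, z) by have := Ag 0; rewrite scale0r addr0 lexx ler01; exact.
have A1 : A (x, y).
  have := Ag 1; rewrite ler01 lexx => /(_ isT); rewrite gE scale1r mul1r.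
  by rewrite /z addrK.
rewrite gE scale1r mul1r /z addrK /r (L12 _ z0) divff ?L2n// => E.
by have := congr1 ( *%R^~ (L2 (x, y))) E; rewrite divfK ?mul1r ?L2n.
Qed.

End Domain.

Lemma R_flat_funk : R_flat (Omega phi) Gt.
Proof.
move=> x y i k Ox y0; have oO := open_Omega hphi.
by apply: (riemann_flat oO (smooth_funk (fun x h => h)) (funk_FF (fun x h => h))
  (homog_funk (fun x h => h))).
Qed.

End FunkSpray.

(** * Positive definiteness near the origin *)

Section Sphere.
Variables (R : realType) (n : nat).
Local Notation V := 'rV[R]_n.

Definition sphere : set V := [set y | `|y| = 1].

Lemma compact_sphere : compact sphere.
Proof.
apply: bounded_closed_compact.
  exists 1; split; first exact: num_real.
  by move=> M M1 y /= ->; exact: ltW.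
rewrite (_ : sphere = Num.norm @^-1` [set 1 : R])//.
apply: closed_comp; last exact: closed_eq.
by move=> y _; exact: norm_continuous.
Qed.

Lemma normalized (y : V) : y != 0 -> sphere (`|y|^-1 *: y).
Proof.
move=> y0; have ny : 0 < `|y| by rewrite normr_gt0.
by rewrite /sphere /= normrZ gtr0_norm ?invr_gt0// mulVf// gt_eqF.
Qed.

Lemma sphere_neq0 (y : V) : sphere y -> y != 0.
Proof. by rewrite /sphere /= => y1; rewrite -normr_eq0 y1 oner_eq0. Qed.

Lemma normalizedK (y : V) : y != 0 -> y = `|y| *: (`|y|^-1 *: y).
Proof. by move=> y0; rewrite scalerA divff ?scale1r// normr_eq0. Qed.

End Sphere.

Lemma cvg_pair_section (T T' : topologicalType) (x : T) (y : T') :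
  (x, z) @[z --> y] --> (x, y).
Proof. exact: (cvg_pair (cvg_cst x) cvg_id). Qed.

Lemma half_pos (R : realType) (r : R) : 0 < 2^-1 * r -> 0 < r.
Proof. by move=> h; lra. Qed.

Section FinslerNear.
Variables (R : realType) (n : nat).
Local Notation V := 'rV[R]_n.
Local Notation W := (V * V)%type.
Implicit Types (x y z u v : V) (p q w : W) (L : V -> V -> R).

Lemma derivable_section (g : W -> R) x y v :
  derivable g (x, y) (0, v) -> derivable (fun z => g (x, z)) y v.
Proof.
rewrite /derivable; set q1 := (X in cvg (X @ _) -> _).
set q2 := (X in _ -> cvg (X @ _)).
suff E : q2 = q1 by rewrite E.
apply/funext => h; rewrite /q1 /q2 /= /shift; congr (h^-1 *: (g _ - _)).
by congr pair; rewrite /= scaler0 add0r.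
Qed.

(** On the fibre over x, joint smoothness restricts to smoothness and the
fundamental form is half the second derivative of the energy. *)
Lemma finsler_intro (U : set V) L : open U ->
  smooth_on (slit U) (fun p => L p.1 p.2) ->
  (forall x y, U x -> 0 <= L x y) ->
  (forall x (a : R) y, U x -> 0 < a -> L x (a *: y) = a * L x y) ->
  (forall x y u, U x -> y != 0 -> u != 0 ->
    0 < 'D_(0, u) ('D_(0, u) (energy L)) (x, y)) ->
  finsler_metric U L.
Proof.
move=> oU sL L0 LZ Lpos; split=> // x Ux; split.
- by move=> y; exact: L0.
- by move=> a y; exact: LZ.
- move=> vs y /= y0; have Ap : slit U (x, y) by [].
  rewrite iter_derive_yE; have [cg dg] := sL (map (fun v => (0, v)) vs) _ Ap.
  split=> [|v]; last exact: derivable_section (dg (0, v)).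
  exact: (@cvg_comp _ _ _ (fun y => (x, y)) _ _ _ _ (@cvg_pair_section _ _ x y) cg).
- move=> y u y0 u0; rewrite fund_formE (derive2_energy L x y u).
  by rewrite mulr_gt0// Lpos.
Qed.

Section PositiveNear.
Variables (U : set V) (E : W -> R).
Hypotheses (oU : open U) (U0 : U 0) (sE : smooth_on (slit U) E) (hE : homog U 2 E).
Local Notation A := (slit U).
Let oA : open A := open_slit oU.

(** The second derivative of E along (0, u) written in coordinates, so that it is
visibly continuous in (x, y, u). *)
Definition hess x y u : R :=
  \sum_i u 0 i * \sum_j u 0 j * 'D_(0, e_ R j) ('D_(0, e_ R i) E) (x, y).

Lemma hessE x y u : U x -> y != 0 -> 'D_(0, u) ('D_(0, u) E) (x, y) = hess x y u.
Proof.
move=> Ux y0; have Ap : A (x, y) by [].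
apply: etrans (derive_y_sum oA _ (smooth_derive _ sE) Ap) _.
apply: eq_bigr => i _; apply: congr1.
apply: etrans (derive_comm oA (0, e_ R i) (0, u) sE Ap) _.
exact: (derive_y_sum oA _ (smooth_derive _ sE) Ap).
Qed.

Lemma hessZ x y u (a b : R) : U x -> y != 0 -> 0 < a ->
  hess x (a *: y) (b *: u) = b ^+ 2 * hess x y u.
Proof.
move=> Ux y0 a0; have Ap : A (x, y) by [].
rewrite /hess mulr_sumr; apply: eq_bigr => i _; rewrite !mxE !mulr_sumr.
apply: eq_bigr => j _; rewrite !mxE.
have h1 : homog U 1 ('D_(0, e_ R i) E) := homog_dy oU _ sE hE.
have h0 : homog U 0 ('D_(0, e_ R j) ('D_(0, e_ R i) E)) :=
  homog_dy oU _ (smooth_derive _ sE) h1.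
have := h0 (x, y) a Ap a0; rewrite expr0 mul1r /= => ->.
by move: ('D_(_, _) _ _) => d; ring.
Qed.

(** Positivity is an open condition, uniform over the compact product of two unit
spheres; homogeneity extends it to all y and u. *)
Lemma hess_positive_near :
  (forall y u, y != 0 -> u != 0 -> 0 < hess 0 y u) ->
  \forall x \near (0 : V), forall y u, y != 0 -> u != 0 -> 0 < hess x y u.
Proof.
move=> pos0; pose K := @sphere R n `*` @sphere R n.
have cK : compact K by apply: compact_setX; exact: compact_sphere.
have H : \forall x \near (0 : V), K `<=` [set k : W | 0 < hess x k.1 k.2].
  apply: (compact_near_coveringP _).1 cK _ (nbhs (0 : V))
    (fun x k => 0 < hess x k.1 k.2) _ _ => k [/sphere_neq0 k1 /sphere_neq0 k2].
  have hc : hess r.2 r.1.1 r.1.2 @[r --> (k, (0 : V))] --> hess 0 k.1 k.2.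
    have c2 i : (r.1.2 : V) 0 i @[r --> (k, (0 : V))] --> k.2 0 i.
      apply: (@cvg_comp _ _ _ (fun r : W * V => r.1.2) (fun u : V => u 0 i)); last exact: coord_continuous.
      by apply: (@cvg_comp _ _ _ (fun r : W * V => r.1) snd); [exact: cvg_fst|exact: cvg_snd].
    apply: cvg_sum_seq => i; apply: cvgM; first exact: c2.
    apply: cvg_sum_seq => j; apply: cvgM; first exact: c2.
    have Ap : A (0, k.1) by [].
    have cg : {for (0, k.1), continuous ('D_(0, e_ R j) ('D_(0, e_ R i) E))}.
      exact: (smooth_continuous (smooth_derive _ (smooth_derive _ sE)) Ap).
    have c1 : r.1.1 @[r --> (k, (0 : V))] --> k.1.
      by apply: (@cvg_comp _ _ _ (fun r : W * V => r.1) fst); [exact: cvg_fst|exact: cvg_fst].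
    have c0 : r.2 @[r --> (k, (0 : V))] --> (0 : V) by exact: cvg_snd.
    exact: (@cvg_comp _ _ _ (fun r : W * V => (r.2, r.1.1)) _ _ _ _ (cvg_pair c0 c1) cg).
  exact: (cvgr_gt _ hc _ (pos0 _ _ k1 k2)).
have HU := nearA oU U0.
near=> x => y u y0 u0.
have Ux : U x by near: x.
have Kx : K `<=` [set k : W | 0 < hess x k.1 k.2] by near: x.
have := Kx (`|y|^-1 *: y, `|u|^-1 *: u) (conj (normalized y0) (normalized u0)) => /= p.
have y1 := sphere_neq0 (normalized y0).
rewrite (normalizedK y0) (normalizedK u0) hessZ//; last by rewrite normr_gt0.
by rewrite mulr_gt0// exprn_gt0// normr_gt0.
Unshelve. all: by end_near. Qed.

End PositiveNear.

End FinslerNear.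

Section Solution.
Variables (R : realType) (n : nat).
Local Notation V := 'rV[R]_n.
Local Notation W := (V * V)%type.
Variables phi psi : V -> R.
Hypotheses (hphi : minkowski_norm phi) (hpsi : minkowski_norm psi).
Implicit Types (x y z u v : V) (p q w : W) (L : V -> V -> R).
Local Notation Om := (Omega phi).
Let oO : open Om := open_Omega hphi.
Let spsi := phi_smooth hpsi.

Lemma Omega0 : Om 0. Proof. by rewrite /Omega /= (phi0 hphi). Qed.

Lemma smooth_sol_slit : smooth_on (slit Om) (fun p => sol phi psi p.1 p.2).
Proof. exact: (smooth_sol hphi spsi). Qed.

Lemma sol_y0 x : sol phi psi x 0 = 0.
Proof. by rewrite /sol funk0 scale0r addr0 (phi0 hpsi) mul0r. Qed.

Lemma sol_den x y : Om x -> y != 0 -> 0 < 1 - 'D_x phi (y + funk phi x y *: x).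
Proof.
move=> Ox y0; apply: (den_gt0 hphi Ox).
by apply: (@exit_neq0 _ _ _ hphi (x, y)).
Qed.

Lemma sol_ge0 x y : Om x -> 0 <= sol phi psi x y.
Proof.
move=> Ox; have [->|y0] := eqVneq y 0; first by rewrite sol_y0.
by rewrite divr_ge0 ?(phi_ge0 hpsi)// ltW// sol_den.
Qed.

Lemma solZ x (a : R) y : Om x -> 0 < a -> sol phi psi x (a *: y) = a * sol phi psi x y.
Proof.
move=> Ox a0; have [->|y0] := eqVneq y 0; first by rewrite scaler0 sol_y0 mulr0.
rewrite /sol (funkZ hphi)// -scalerA -scalerDr (phiZ hpsi)// (derive_phiZ hphi)//.
  by rewrite mulrA.
exact: (@exit_neq0 _ _ _ hphi (x, y)).
Qed.

Lemma sol_at0 y : sol phi psi 0 y = psi y.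
Proof. by rewrite /sol scaler0 addr0 derive0 subr0 divr1. Qed.

Lemma homog_sol2 : homog Om 2 (energy (sol phi psi)).
Proof. by move=> p a [Ox _] a0; rewrite /energy /= solZ// exprMn. Qed.

Lemma sol_finsler_near : exists U : set V, [/\ open U, U 0, U `<=` Om & finsler_metric U (sol phi psi)].
Proof.
have sE : smooth_on (slit Om) (energy (sol phi psi)).
  exact: (smoothX (open_slit oO) 2 smooth_sol_slit).
have pos0 y u : y != 0 -> u != 0 -> 0 < hess (energy (sol phi psi)) 0 y u.
  move=> y0 u0; rewrite -(hessE oO sE u Omega0 y0) -derive2_energy.
  have -> : (fun z => sol phi psi 0 z ^+ 2) = (fun z => psi z ^+ 2).
    by apply/funext => z; rewrite sol_at0.
  apply: half_pos; rewrite -fund_formE.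
  by have [_ _ _] := hpsi; apply.
pose U := interior [set x | (forall y u, y != 0 -> u != 0 ->
  0 < hess (energy (sol phi psi)) x y u) /\ Om x].
have oU : open U by exact: open_interior.
have UO x : U x -> Om x by move=> /interior_subset [].
have U0 : U 0.
  have h1 := hess_positive_near oO Omega0 sE homog_sol2 pos0.
  have h2 := nearA oO Omega0.
  by near=> x; split; near: x.
exists U; split; [exact: oU|exact: U0|exact: UO|].
apply: (finsler_intro oU).
- by move=> vs p [/UO Op p0]; exact: smooth_sol_slit.
- by move=> x y /UO; exact: sol_ge0.
- by move=> x a y /UO; exact: solZ.
- move=> x y u Ux y0 u0; rewrite (hessE oO sE u (UO _ Ux) y0).
  by have [H _] := interior_subset Ux; exact: H.
Unshelve. all: by end_near. Qed.

Lemma sol_transports (U : set V) : U `<=` Om ->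
  transports (slit U) (funkp phi) (fun p => sol phi psi p.1 p.2).
Proof.
move=> UO p v [Up p0]; apply: (sol_transport hphi spsi); split=> //; exact: UO.
Qed.

(** The segment from 0 to x must lie in U, for the characteristic through (x, y)
projects onto it. *)
Lemma sol_unique (U : set V) L : open U -> U `<=` Om -> U 0 ->
  finsler_metric U L -> induces U L (fun x y => funk phi x y *: y) -> L 0 = psi ->
  forall x, (forall t : R, 0 <= t <= 1 -> U (t *: x)) -> forall y, L x y = sol phi psi x y.
Proof.
move=> oU UO U0 fL ind L0 x Ux y.
have Uxx : U x by rewrite -[x]scale1r; apply: Ux; rewrite ler01 lexx.
have [mL sL] := fL.
have [->|y0] := eqVneq y 0; first by rewrite sol_y0 (phi0 (mL _ Uxx)).
have spsi' := phi_smooth hpsi.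
apply: (char_unique hphi oU UO (L1 := fun p => L p.1 p.2)
  (L2 := fun p => sol phi psi p.1 p.2)) => //.
- by move=> vs p [Up p0]; apply: smooth_sol_slit; split => //; exact: UO.
- exact/(induces_funk hphi oU UO fL).
- exact: sol_transports.
- move=> p [Up p0]; have Op := UO _ Up; rewrite gt_eqF// divr_gt0 ?sol_den//.
  apply: (phi_gt0 hpsi); apply: (@exit_neq0 _ _ _ hphi p); split=> //.
- by move=> z z0 /=; rewrite L0 sol_at0.
Qed.

End Solution.

(** * Local convergence of the series *)

Section LinePolynomials.
Variables (R : realType) (n : nat).
Local Notation V := 'rV[R]_n.
Implicit Types (h x y a : V) (c : ('I_n -> nat) -> R) (s t k : R).

Lemma coord_le_norm x i : `|x 0 i| <= `|x|.
Proof. by rewrite [leRHS]/Num.norm /= mx_normrE; apply: (le_bigmax _ _ (0, i)). Qed.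

Lemma norm_const_mx k : 0 <= k -> `|const_mx k : V| <= k.
Proof.
move=> k0; rewrite [leLHS]/Num.norm /= mx_normrE; apply: bigmax_le => // i _.
by rewrite mxE ger0_norm.
Qed.

(** The degree m part of a power series in n variables, restricted to the line
h + t x and viewed as a polynomial in t. *)
Definition line_term c h x m : {poly R} :=
  \sum_(al : {ffun 'I_n -> 'I_m.+1} | (\sum_i al i)%N == m)
    c (fun i => al i : nat) *: \prod_i (x 0 i *: 'X + (h 0 i)%:P) ^+ al i.

Lemma line_termE c h x m t : (line_term c h x m).[t] = power_term c (h + t *: x) m.
Proof.
rewrite horner_sum; apply: eq_bigr => al _.
rewrite hornerZ horner_prod; congr (_ * _); apply: eq_bigr => i _.
by rewrite horner_exp !hornerE !mxE mulrC addrC.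
Qed.

Lemma pnorm_prod (I : Type) (r : seq I) (F : I -> {poly R}) s : 0 <= s ->
  pnorm s (\prod_(i <- r) F i) <= \prod_(i <- r) pnorm s (F i).
Proof.
move=> s0; elim: r => [|i r IH]; first by rewrite !big_nil pnorm1.
rewrite !big_cons; apply: le_trans (pnormM _ _ s0) _.
by rewrite ler_wpM2l// pnorm_ge0.
Qed.

(** Each coordinate h_i + t x_i has norm at most k, so the restriction is dominated
by the absolute series at the diagonal point (k, ..., k). *)
Lemma pnorm_line_term c h x s k m : 0 <= s -> `|h| + s * `|x| <= k ->
  pnorm s (line_term c h x m) <= abs_power_term c (const_mx k) m.
Proof.
move=> s0 hx; apply: le_trans (pnorm_sum _ _ _ s0) _.
apply: ler_sum => al _; rewrite pnorm_scale normrM ler_wpM2l//.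
apply: le_trans (pnorm_prod _ _ s0) _; rewrite normr_prod.
apply: ler_prod => i _; rewrite pnorm_ge0//= mxE normrX.
apply: le_trans (pnorm_exp _ _ s0) _.
rewrite lerXn2r ?nnegrE ?pnorm_ge0//; apply: le_trans (pnormD _ _ s0) _.
rewrite pnorm_scale pnormX pnormC (le_trans _ (ler_norm k))// (le_trans _ hx)// addrC.
by rewrite lerD ?coord_le_norm// mulrC ler_wpM2l ?coord_le_norm.
Qed.

(** Near a, the restrictions of f to all lines with |h| + s |x| <= k are limits of
polynomials bounded by one constant M, whatever s: taking x small allows a
radius s much larger than M, as Lagrange inversion requires. *)
Lemma analytic_line (f : V -> R) a : analytic_on [set y | y != 0] f -> a != 0 ->
  exists k M : R, [/\ 0 < k, 0 <= M & forall h x s, 0 < s -> `|h| + s * `|x| <= k ->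
    exists P : nat -> {poly R}, [/\ forall N, pnorm s (P N) <= M, coef_cvg P &
      forall t, `|t| <= s -> (P N).[t] @[N --> \oo] --> f (a + h + t *: x)]].
Proof.
move=> anf a0; have [c [r [r0 cf]]] := anf a a0.
pose k := r / 2; have k0 : 0 < k by rewrite divr_gt0.
have kr : k < r by rewrite /k; lra.
have [ca _] := cf (const_mx k) (le_lt_trans (norm_const_mx (ltW k0)) kr).
have a_ge0 m : 0 <= abs_power_term c (const_mx k) m by exact: sumr_ge0.
pose M := limn (series (abs_power_term c (const_mx k))).
have sM N : \sum_(m < N) abs_power_term c (const_mx k) m <= M.
  have -> : \sum_(m < N) abs_power_term c (const_mx k) m = series (abs_power_term c (const_mx k)) N.
    by rewrite /series /= big_mkord.
  by apply: nondecreasing_cvgn_le => //; exact: nondecreasing_series.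
exists k, M; split=> //; first by have := sM 0%N; rewrite big_ord0.
move=> h x s s0 hx; have s0' := ltW s0.
exists (fun N => \sum_(m < N) line_term c h x m); split.
- move=> N; apply: le_trans (pnorm_sum _ _ _ s0') _; apply: le_trans (sM N).
  by apply: ler_sum => m _; exact: pnorm_line_term.
- move=> j; rewrite (_ : (fun N => _) = series (fun m => (line_term c h x m)`_j)); last first.
    by apply/funext => N; rewrite /series /= coef_sum big_mkord.
  have sj : 0 < s ^+ j by rewrite exprn_gt0.
  apply: normed_cvg => /=.
  apply: (@series_le_cvg _ _ (fun m => (s ^+ j)^-1 * abs_power_term c (const_mx k) m)).
  + by move=> m /=.
  + by move=> m; rewrite mulr_ge0// invr_ge0 ltW.
  + move=> m /=; rewrite ler_pdivlMl// mulrC.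
    by apply: le_trans (pnorm_coef _ _ s0') _; exact: pnorm_line_term.
  + exact: is_cvg_seriesZ.
- move=> t ts; have hr : `|h + t *: x| < r.
    apply: le_lt_trans kr; apply: le_trans hx; apply: le_trans (ler_normD _ _) _.
    by rewrite lerD2l normrZ ler_wpM2r.
  have [_] := cf _ hr; rewrite addrA (_ : series _ = (fun N => (\sum_(m < N) line_term c h x m).[t]))//.
  apply/funext => N; rewrite /series /= horner_sum big_mkord.
  by apply: eq_bigr => m _; rewrite line_termE.
Qed.

End LinePolynomials.

Section LocalSeries.
Variables (R : realType) (n : nat).
Local Notation V := 'rV[R]_n.
Variables phi psi : V -> R.
Hypotheses (hphi : minkowski_norm phi) (hpsi : minkowski_norm psi).
Implicit Types (h x y a z : V).
Local Notation V0 := [set y : V | y != 0].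
Local Notation sol := (sol phi psi).

Lemma sol_taylor : taylor_expansion phi psi sol.
Proof.
have [U [oU U0 UO fU]] := sol_finsler_near hphi hpsi.
have := taylor_funk hphi oU UO U0 fU (sol_transports hphi hpsi UO).
by rewrite (_ : sol 0 = psi)//; apply/funext => y; exact: sol_at0.
Qed.

Lemma funk_le x y : phi x <= 2^-1 -> y != 0 -> funk phi x y <= 2 * phi y.
Proof.
move=> x2 y0; have x1 : phi x < 1 by apply: le_lt_trans x2 _; rewrite invf_lt1 ?ltr1n.
have s0 := funk_gt0 hphi x1 y0; have := funkP hphi y x1.
have := phi_triangle hphi y (funk phi x y *: x); rewrite (phiZ hphi)//.
have := ler_wpM2l (ltW s0) x2; move: (funk _ _ _) (phi (_ + _)) => s q.
by move: (s * _) => w; lra.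
Qed.

(** With t = eps F (eps x, y), the fixed-point equation of the Funk metric becomes
eps f(t) = t for f(t) = phi (y + t x), and the solution at eps x is Lagrange's
residue at t. *)
Lemma sol_line x y (M : R) : y != 0 -> phi y <= M -> phi x <= 2^-1 -> phi (- x) <= 2^-1 ->
  forall eps : R, `|eps| <= 1 -> exists t : R, [/\ `|t| <= 2 * M, y + t *: x != 0,
    eps * phi (y + t *: x) = t, 1 - eps * 'D_x phi (y + t *: x) != 0 &
    sol (eps *: x) y = psi (y + t *: x) / (1 - eps * 'D_x phi (y + t *: x))].
Proof.
move=> y0 yM x2 nx2 eps e1.
have ex2 : phi (eps *: x) <= 2^-1.
  have [e0|e0|->] := ltgtP eps 0; last by rewrite scale0r (phi0 hphi) invr_ge0.
  - rewrite -[eps]opprK scaleNr -scalerN (phiZ hphi) ?oppr_gt0// -ltr0_norm//.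
    by apply: le_trans nx2; rewrite ler_piMl ?(phi_ge0 hphi).
  - rewrite (phiZ hphi)// -[eps]gtr0_norm//.
    by apply: le_trans x2; rewrite ler_piMl ?(phi_ge0 hphi).
have Ox : Omega phi (eps *: x) by apply: le_lt_trans ex2 _; rewrite invf_lt1 ?ltr1n.
pose s := funk phi (eps *: x) y; exists (s * eps).
have s0 : 0 < s := funk_gt0 hphi Ox y0.
have zE : y + s *: (eps *: x) = y + (s * eps) *: x by rewrite scalerA.
have z0 : y + (s * eps) *: x != 0.
  by rewrite -zE; apply: (@exit_neq0 _ _ _ hphi (eps *: x, y)).
have dE : 'D_(eps *: x) phi (y + (s * eps) *: x) = eps * 'D_x phi (y + (s * eps) *: x).
  exact: (deriveZr (@open_neq0 R n) x eps (phi_smooth hphi) z0).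
split=> //.
- rewrite normrM gtr0_norm//; apply: (@le_trans _ _ s); first by rewrite ler_piMr// ltW.
  by apply: le_trans (funk_le ex2 y0) _; rewrite ler_wpM2l.
- by rewrite -zE (funkP hphi y Ox) mulrC.
- by rewrite -dE -zE gt_eqF// (sol_den hphi Ox y0).
- by rewrite /sol -/s zE dE.
Qed.

(** The radius r = 4 (M + 1) exceeds four times the bound M of phi near a, so that
eps f maps the disc into itself for |eps| <= 1 and the Lagrange coefficients are
O(4^-m).  They are the Taylor coefficients of eps |-> sol (eps x) y, hence the
terms of the series. *)
Lemma series_near a : analytic_on V0 phi -> analytic_on V0 psi -> a != 0 ->
  \forall y \near a & x \near (0 : V),
    series (series_term phi psi x y) @ \oo --> sol x y.
Proof.
move=> aphi apsi a0.
have [k1 [M [k10 M0 phiP]]] := analytic_line aphi a0.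
have [k2 [M2 [k20 M20 psiP]]] := analytic_line apsi a0.
have [C C0 phiC] := phi_le_norm hphi.
pose k := Num.min k1 k2; have k0 : 0 < k by rewrite lt_min k10.
(* The polynomials are bounded by M on the disc of radius 2 r, and M <= r / 4. *)
pose r := 4 * (M + 1); have r0 : 0 < r by rewrite mulr_gt0// ltr_wpDl.
have r20 : 0 < 2 * r by rewrite mulr_gt0.
have ny : \forall y \near a, `|y - a| <= k / 2 /\ y != 0.
  have h1 : \forall y \near a, `|a - y| <= k / 2.
    have F0 : Filter (nbhs a) by exact: nbhs_filter.
    have c : z @[z --> a] --> a by exact: cvg_id.
    by have /cvgrPdist_le := c; apply; rewrite divr_gt0.
  have h2 := nearA (@open_neq0 R n) a0.
  by near=> y; split; [rewrite distrC|]; near: y.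
have nx : \forall x \near (0 : V), 2 * r * `|x| <= k / 2 /\ C * `|x| <= 2^-1.
  have h1 : \forall x \near (0 : V), `|x| < k / 2 / (2 * r) by apply: nbhs0_lt; rewrite !divr_gt0.
  have h2 : \forall x \near (0 : V), `|x| < 2^-1 / (C + 1).
    by apply: nbhs0_lt; rewrite divr_gt0 ?invr_gt0 ?ltr_wpDl.
  near=> x; have x1 : `|x| < k / 2 / (2 * r) by near: x.
  have x2 : `|x| < 2^-1 / (C + 1) by near: x.
  split; first by rewrite mulrC -ler_pdivlMr// ltW.
  move: x2; rewrite ltr_pdivlMr ?ltr_wpDl// => /ltW; apply: le_trans.
  by rewrite mulrC ler_wpM2l// lerDl.
near=> y x; have [hy y0] : `|y - a| <= k / 2 /\ y != 0 by near: y.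
have [hx Cx] : 2 * r * `|x| <= k / 2 /\ C * `|x| <= 2^-1 by near: x.
have hk : `|y - a| + 2 * r * `|x| <= k by rewrite [leRHS]splitr lerD.
have hk1 : `|y - a| + 2 * r * `|x| <= k1 by rewrite (le_trans hk)// ge_min lexx.
have hk2 : `|y - a| + 2 * r * `|x| <= k2 by rewrite (le_trans hk)// ge_min lexx orbT.
have [P [PM cP Pf]] := phiP _ _ _ r20 hk1; have [H [HM cH Hf]] := psiP _ _ _ r20 hk2.
rewrite [a + _]addrC subrK in Pf Hf.
have HP N : pnorm (2 * r) (P N) <= r / 4 by apply: le_trans (PM N) _; rewrite /r; lra.
have HH N : pnorm r (H N) <= M2.
  by apply: le_trans (HM N); apply: pnorm_le; [exact: ltW|have := r0; lra].
have yM : phi y <= M.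
  have := Pf 0; rewrite normr0 scale0r addr0 => /(_ (ltW r20)) c.
  apply: (ler_cvg_to c (cvg_cst M)); apply: nearW => N.
  apply: le_trans (ler_norm _) _; apply: le_trans (PM N).
  by apply: pnorm_horner; rewrite normr0 ltW.
have x2 : phi x <= 2^-1 by apply: le_trans Cx.
have nx2 : phi (- x) <= 2^-1 by apply: le_trans Cx; rewrite -[`|x|]normrN.
pose b := lagr_term P H.
have ser (eps : R) : `|eps| <= 1 ->
    series (fun m => b m * eps ^+ m) @ \oo --> sol (eps *: x) y.
  move=> e1; have [t [tM z0 et den ->]] := sol_line y0 yM x2 nx2 e1.
  have tr : `|t| <= r / 2 by apply: le_trans tM _; rewrite /r; lra.
  have tr2 : `|t| <= 2 * r by apply: le_trans tr _; have := r0; lra.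
  apply: (lagr_series r0 HP HH cP cH e1 tr (Pf _ tr2) et _ (Hf _ tr2) den).
  apply: (deriv_limit r0 HP tr (f := fun s => phi (y + s *: x))).
    by move=> s sr; apply: Pf; apply: le_trans sr _; have := r0; lra.
  by apply: is_derive_line; exact: (smooth_derivable (phi_smooth hphi) z0).
have bb : geom_bounded 4 b.
  exists M2 => m; rewrite -ler_pdivlMr ?exprn_gt0// -exprVn.
  exact: (lagr_term_bound r0 HP HH cP cH m).
(* Both sides are the m-th Taylor coefficient of eps |-> sol (eps x) y at 0. *)
have termE m : series_term phi psi x y m = b m.
  rewrite -sol_taylor (@derive1n_pseries _ _ 4 b)//; last first.
    have e1 : \forall e \near (0 : R), `|e| <= 1 by exact: nbhs0_le.
    by apply: filterS e1 => e; exact: ser.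
  by rewrite mulKf// pnatr_eq0 -lt0n fact_gt0.
have := ser 1; rewrite normr1 scale1r => /(_ (lexx 1)).
rewrite (_ : (fun m => b m * 1 ^+ m) = series_term phi psi x y)//.
by apply/funext => m; rewrite termE expr1n mulr1.
Unshelve. all: by end_near. Qed.

End LocalSeries.

(** * Convergence for all directions, and the theorem *)

Section GlobalSeries.
Variables (R : realType) (n : nat).
Local Notation V := 'rV[R]_n.
Variables phi psi : V -> R.
Hypotheses (hphi : minkowski_norm phi) (hpsi : minkowski_norm psi).
Implicit Types (h x y a z : V).
Local Notation V0 := [set y : V | y != 0].
Let oV : open V0 := @open_neq0 R n.

Lemma iter_derive_homog x m k y (a : R) : (k <= m)%N -> y != 0 -> 0 < a ->
  iter_derive (nseq k x) (fun z => phi z ^+ m * psi z) (a *: y) =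
  a ^+ (m - k).+1 * iter_derive (nseq k x) (fun z => phi z ^+ m * psi z) y.
Proof.
set g := fun z => _; move=> + + a0; have aN : a != 0 by rewrite gt_eqF.
have sg : smooth_on V0 g.
  exact: (smoothM oV (smoothX oV m (phi_smooth hphi)) (phi_smooth hpsi)).
elim: k y => [|k IH] y km y0.
  by rewrite /= subn0 /g (phiZ hphi)// (phiZ hpsi)// exprMn exprS; ring.
rewrite /= (homog_derive (b := a^-1) (c := a ^+ (m - k).+1) oV (smooth_iter_derive (nseq k x) sg) y0).
  by rewrite -(subnSK km) exprSr mulfK.
have nV : \forall s \near (0 : R), y + (s / a) *: x != 0.
  have := near_line (a^-1 *: x) oV y0; apply: filterS => s.
  by rewrite scalerA.
near=> s; rewrite -IH ?(ltnW km)//; last by near: s.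
by rewrite scalerDr scalerA mulrCA divff// mulr1.
Unshelve. all: by end_near. Qed.

Lemma series_termZ x y m (a : R) : 0 < a -> y != 0 ->
  series_term phi psi x (a *: y) m = a * series_term phi psi x y m.
Proof.
move=> a0 y0; rewrite /series_term [RHS]mulrCA; congr (_ * _).
pose g z := phi z ^+ m * psi z.
have E z : derive1n m (fun t : R => phi (z + t *: x) ^+ m * psi (z + t *: x)) 0 =
    iter_derive (nseq m x) g z.
  by apply: etrans (derive1n_line g z x m 0) _; rewrite scale0r addr0.
by rewrite !E iter_derive_homog// subnn expr1.
Qed.

(** The local statements cover the compact unit sphere of directions; all the
terms and the sum are homogeneous of degree one in y. *)
Lemma series_cvg_near : analytic_on V0 phi -> analytic_on V0 psi ->
  \forall x \near (0 : V), forall y,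
    series (series_term phi psi x y) @ \oo --> sol phi psi x y.
Proof.
move=> aphi apsi.
have H : \forall x \near (0 : V), @sphere R n `<=`
    [set y | series (series_term phi psi x y) @ \oo --> sol phi psi x y].
  apply: (compact_near_coveringP _).1 (@compact_sphere R n) _ (nbhs (0 : V))
    (fun x y => series (series_term phi psi x y) @ \oo --> sol phi psi x y) _ _.
  by move=> a /sphere_neq0 a0; exact: series_near.
have nO := nearA (open_Omega hphi) (Omega0 hphi).
near=> x => y; have Ox : Omega phi x by near: x.
have [->|y0] := eqVneq y 0.
  rewrite (sol_y0 phi hpsi) (_ : series _ = cst 0); first exact: cvg_cst.
  apply/funext => N; rewrite /series /= big1// => m _.
  by apply: (series_term0 hphi) => a z; exact: (phiZ hpsi).
have Kx : @sphere R n `<=` [set y | series (series_term phi psi x y) @ \oo --> sol phi psi x y].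
  by near: x.
have := Kx _ (normalized y0) => /= c.
have y1 := sphere_neq0 (normalized y0).
have ny : 0 < `|y| by rewrite normr_gt0.
rewrite (normalizedK y0) (solZ hphi hpsi)//.
rewrite (_ : series _ = (fun N => `|y| * series (series_term phi psi x (`|y|^-1 *: y)) N)).
  exact: (cvgM (cvg_cst _) c).
apply/funext => N; rewrite /series /= mulr_sumr.
by apply: eq_bigr => m _; rewrite series_termZ.
Unshelve. all: by end_near. Qed.

End GlobalSeries.

Section Assembly.
Variables (R : realType) (n : nat).
Local Notation V := 'rV[R]_n.
Variable phi : V -> R.
Hypothesis hphi : minkowski_norm phi.
Local Notation V0 := [set y : V | y != 0].
Local Notation Gt := (fun x y : V => funk phi x y *: y).
Local Notation Om := (Omega phi).
Implicit Types (U W : set V) (L : V -> V -> R) (psi : V -> R).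

Lemma near_segment U : open U -> U 0 ->
  \forall x \near (0 : V), forall t : R, 0 <= t <= 1 -> U (t *: x).
Proof.
move=> oU U0; have /nbhs_normP[e /= e0 eU] := nearA oU U0.
have sm : \forall x \near (0 : V), `|x| < e by exact: nbhs0_lt.
apply: filterS sm => x xe t /andP[t0 t1]; apply: eU => /=.
rewrite sub0r normrN normrZ ger0_norm// (le_lt_trans _ xe)//.
by rewrite ler_piMl.
Qed.

Lemma sol_unique_near U L : open U -> U 0 -> U `<=` Om -> finsler_metric U L ->
  induces U L Gt -> \forall x \near (0 : V), forall y, L x y = sol phi (L 0) x y.
Proof.
move=> oU U0 UO fL ind; have := near_segment oU U0; apply: filterS => x Ux.
exact: (sol_unique hphi (fL.1 _ U0) oU UO U0 fL ind erefl Ux).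
Qed.

Lemma taylor_at0 psi L : taylor_expansion phi psi L -> L 0 = psi.
Proof.
move=> tL; apply/funext => y; have := tL 0 y 0%N.
by rewrite /series_term fact0 invr1 !mul1r /= !scale0r addr0 expr0 mul1r.
Qed.

Lemma finsler_sub U W L L' : open W -> W `<=` U -> finsler_metric U L ->
  (forall x y, W x -> L' x y = L x y) -> finsler_metric W L'.
Proof.
move=> oW WU [mL sL] LL; split=> [x Wx|].
  by rewrite (_ : L' x = L x); [exact/mL/WU|apply/funext => y; exact: LL].
apply: (smooth_ext (open_slit oW) (f := fun p => L p.1 p.2)).
  by move=> vs p [/WU Up p0]; exact: sL.
by move=> p [Wp p0]; exact: LL.
Qed.

(** Any function agreeing with the solution over U inherits the conclusions, so
that they apply both to the closed formula and to the sum of the series. *)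
Lemma sol_metric psi U L : minkowski_norm psi -> open U -> U `<=` Om ->
  finsler_metric U (sol phi psi) -> (forall x y, U x -> L x y = sol phi psi x y) ->
  [/\ induces U L Gt, finsler_metric U L, projectively_flat U L & zero_flag_curvature U L].
Proof.
move=> hpsi oU UO fS LS.
have fL : finsler_metric U L by exact: finsler_sub fS LS.
have tL : transports (slit U) (funkp phi) (fun p => L p.1 p.2).
  apply: (transports_ext (open_slit oU) (sol_transports hphi hpsi UO)).
  by move=> p [Up p0]; exact: LS.
have ind : induces U L Gt by apply/(induces_funk hphi oU UO fL).
split=> //; first exact: (projectively_flat_funk hphi UO ind).
exact: (zero_flag_funk hphi oU UO fL tL).
Qed.

End Assembly.

Theorem theorem4p1 (R : realType) (n : nat) (phi : 'rV[R]_n -> R)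
    (hphi : minkowski_norm phi) :
  let Gt := fun x y : 'rV[R]_n => funk phi x y *: y in
  [/\ R_flat (Omega phi) Gt,
      forall (U : set 'rV[R]_n) (Ft : 'rV[R]_n -> 'rV[R]_n -> R),
        open U -> U 0 -> U `<=` Omega phi ->
        finsler_metric U Ft -> induces U Ft Gt ->
        taylor_expansion phi (Ft 0) Ft /\
        (analytic_on [set y | y != 0] phi ->
         analytic_on [set y | y != 0] (Ft 0) ->
         exists W : set 'rV[R]_n, [/\ open W, W 0, W `<=` U &
           forall x y, W x ->
             series (series_term phi (Ft 0) x y) @ \oo --> Ft x y])
    & forall psi : 'rV[R]_n -> R, minkowski_norm psi ->
        (exists (U : set 'rV[R]_n) (Ft : 'rV[R]_n -> 'rV[R]_n -> R),
          [/\ open U, U 0 & U `<=` Omega phi] /\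
          [/\ taylor_expansion phi psi Ft,
              induces U Ft Gt,
              finsler_metric U Ft,
              projectively_flat U Ft
            & zero_flag_curvature U Ft] /\
          (forall (U' : set 'rV[R]_n) (Ft' : 'rV[R]_n -> 'rV[R]_n -> R),
            open U' -> U' 0 -> U' `<=` Omega phi ->
            finsler_metric U' Ft' -> induces U' Ft' Gt ->
            taylor_expansion phi psi Ft' ->
            \forall x \near (0 : 'rV[R]_n), forall y, Ft' x y = Ft x y)) /\
        (analytic_on [set y | y != 0] phi ->
         analytic_on [set y | y != 0] psi ->
         exists U : set 'rV[R]_n,
          [/\ open U, U 0 & U `<=` Omega phi] /\
          (forall x y, U x -> cvgn (series (series_term phi psi x y))) /\
          [/\ induces U (series_sum phi psi) Gt,
              finsler_metric U (series_sum phi psi),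
              projectively_flat U (series_sum phi psi)
            & zero_flag_curvature U (series_sum phi psi)])].
Proof.
move=> Gt; split=> [|U Ft oU U0 UO fF ind|psi hpsi]; first exact: R_flat_funk.
  split=> [|aphi apsi].
    by apply: (taylor_funk hphi oU UO U0 fF); exact/(induces_funk hphi oU UO fF).
  have h1 := series_cvg_near hphi (fF.1 _ U0) aphi apsi.
  have h2 := sol_unique_near hphi oU U0 UO fF ind; have h3 := nearA oU U0.
  pose T := [set x | U x /\ forall y,
    series (series_term phi (Ft 0) x y) @ \oo --> Ft x y].
  exists (interior T); split; first exact: open_interior.
  - rewrite /interior /=; near=> x; split; first by near: x.
    move=> y; have -> : Ft x y = sol phi (Ft 0) x y by move: y; near: x.
    by move: y; near: x.
  - by move=> x /interior_subset[].
  - by move=> x y /interior_subset[_]; exact.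
have [U [oU U0 UO fS]] := sol_finsler_near hphi hpsi.
split=> [|aphi apsi].
  exists U, (sol phi psi); split=> //; split.
    have [indS _ pS zS] := sol_metric hphi hpsi oU UO fS (fun _ _ _ => erefl).
    by split=> //; exact: sol_taylor.
  move=> U' Ft' oU' U'0 U'O fF' ind' /taylor_at0 F0.
  by rewrite -F0; exact: (sol_unique_near hphi oU' U'0 U'O fF' ind').
have h1 := series_cvg_near hphi hpsi aphi apsi; have h3 := nearA oU U0.
pose T := [set x | U x /\ forall y,
  series (series_term phi psi x y) @ \oo --> sol phi psi x y].
have oT : open (interior T) by exact: open_interior.
have TU : interior T `<=` U by move=> x /interior_subset[].
have TO : interior T `<=` Omega phi by move=> x /TU/UO.
have Tc x y : interior T x -> series (series_term phi psi x y) @ \oo --> sol phi psi x y.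
  by move=> /interior_subset[_]; exact.
exists (interior T); split; first split=> //.
  by rewrite /interior /=; near=> x; split; near: x.
split=> [x y Tx|]; first by apply/cvg_ex; exists (sol phi psi x y); exact: Tc.
apply: (sol_metric hphi hpsi oT TO).
  exact: (finsler_sub oT TU fS).
by move=> x y Tx; apply: cvg_lim => //; exact: Tc.
Unshelve. all: by end_near. Qed.
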